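(* Let $n\le m$ be positive integers, $\mathbb{K}$ a field, $\mathbf{X}=(x_{i,j})$ a generic $n\times m$ matrix, $\mathbf{L}$ a ladder of $\mathbf{X}$, and let $L=I_n(\mathbf{X}_{\mathbf{L}})$ be the ideal generated by the maximal minors of the ladder matrix $\mathbf{X}_{\mathbf{L}}$ over the polynomial ring $R=\mathbb{K}[\mathbf{L}]$. Let $\mathcal{L}$ denote the associated column index set, assumed nonempty. For any positive integer $r$, we have: (a) The polynomials of the set $\{[\boldsymbol a]_{\mathbf{L}}t_i\mid(\boldsymbol a,i)\in\mathcal{L}\times[r]\}$ form a SAGBI basis of the $\mathbb{K}$-algebra they generate with respect to the monomial order $\tau'$. In particular, $$\operatorname{in}_{\tau'}\big(\mathbb{K}[[\boldsymbol a]_{\mathbf{L}}t_i\mid(\boldsymbol a,i)\in\mathcal{L}\times[r]]\big)=\mathbb{K}[\operatorname{in}_\tau([\boldsymbol a]_{\mathbf{L}})t_i\mid(\boldsymbol a,i)\in\mathcal{L}\times[r]].$$ (b) The polynomials in the set $\mathbf{L}\cup\{[\boldsymbol a]_{\mathbf{L}}t_i\mid(\boldsymbol a,i)\in\mathcal{L}\times[r]\}$ form a SAGBI basis of the Rees algebra $\mathcal{R}(\bigoplus_{i=1}^rL)$ with respect to $\tau'$. In particular, $$\operatorname{in}_{\tau'}\Big(\mathcal{R}\Big(\bigoplus_{i=1}^rL\Big)\Big)=\mathbb{K}\big[\mathbf{L}\cup\{\operatorname{in}_\tau([\boldsymbol a]_{\mathbf{L}})t_i\mid(\boldsymbol a,i)\in\mathcal{L}\times[r]\}\big]=\mathcal{R}\Big(\bigoplus_{i=1}^r\operatorname{in}_\tau(L)\Big).$$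 (c) The presentation ideal of $\mathcal{F}(\bigoplus_{i=1}^rL)$ has a Gröbner basis consisting entirely of Plücker type relations, with respect to a particular induced monomial order $\omega$ on $\mathbb{K}[T_{\boldsymbol a,i}\mid(\boldsymbol a,i)\in\mathcal{L}\times[r]]$. (d) With respect to some monomial ordering $\omega'$ on $R[T_{\boldsymbol a,i}\mid(\boldsymbol a,i)\in\mathcal{L}\times[r]]$, the presentation ideal of $\mathcal{R}(\bigoplus_{i=1}^rL)$ possesses a Gröbner basis comprising Eagon--Northcott type relations and Plücker type relations. In particular, $\mathcal{R}(\bigoplus_{i=1}^rL)$ is of fiber type.
   Context: Notation: $[q]=\{1,\dots,q\}$. Index lattice. $\mathcal{D}=\{\boldsymbol a=(a_1,\dots,a_n)\in\mathbb{Z}_{+}^n \mid a_1<\dots<a_n\le m\}$ is a distributive lattice under componentwise comparison (meet = componentwise min, join = componentwise max); $\mathcal{D}\times[r]$ is the product lattice with the chain $[r]$. Ladders. A ladder $\mathbf{L}$ is a set of entries of $\mathbf{X}$ such that whenever $x_{i,j},x_{i',j'}\in\mathbf{L}$ with $i\le i'$, $j\ge j'$, then $x_{u,v}\in\mathbf{L}$ for all $i\le u\le i'$, $j'\le v\le j$. It is described by integers $1=\ell_1\le\dots\le\ell_n\le m$ and $1\le k_1\le\dots\le k_n=m$ with $x_{i,j}\in\mathbf{L}\iff \ell_i\le j\le k_i$. $\mathbf{X}_{\mathbf{L}}$ is $\mathbf{X}$ with all entries not in $\mathbf{L}$ set to zero; $[\boldsymbol a]_{\mathbf{L}}$ is its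 maximal minor with columns $\boldsymbol a\in\mathcal{D}$; $\mathcal{L}=\{\boldsymbol a\in\mathcal{D}\mid[\boldsymbol a]_{\mathbf{L}}\ne0\}$ is the associated column index set. Orders. $\tau$ is the lexicographic order on $\mathbb{K}[\mathbf{X}]$ (restricted to $R$) with $x_{i,j}>x_{l,k}$ iff $i<l$, or $i=l$ and $j<k$. $\delta$ is the graded reverse lexicographic order on $\mathbb{K}[t_1,\dots,t_r]$ with $t_1>\dots>t_r$. $\tau'$ on $R[t_1,\dots,t_r]$ compares first the $t$-parts by $\delta$, then, in case of equality, the $x$-parts by $\tau$. The initial algebra $\operatorname{in}(A)$ of a subalgebra $A$ is the $\mathbb{K}$-algebra generated by the initial monomials of elements of $A$; $\mathcal{A}\subseteq A$ is a SAGBI basis if $\operatorname{in}(A)=\mathbb{K}[\operatorname{in}(a)\mid a\in\mathcal{A}]$. Blowup algebras. For an equigenerated homogeneous ideal $I\subset R$ and $M=\bigoplus_{i=1}^rI$: $\mathcal{R}(M)=R[It_1,\dots,It_r]\subseteq R[t_1,\dots,t_r]$ and $\mathcal{F}(M)=\mathcal{R}(M)\otimes_R\mathbb{K}$. For $I=L$, $\mathcal{F}(M)\cong\mathbb{K}[[\boldsymbol a]_{\mathbf{L}}t_i\mid(\boldsymbol a,i)\in\mathcal{L}\times[r]]$, and the presentation ideals are the kernels of $R[T_{\boldsymbol a,i}]\to\mathcal{R}(M)$ (identity on $R$) and $\mathbb{K}[T_{\boldsymbol a,i}]\to\mathcal{F}(M)$, $T_{\boldsymbol a,i}\mapsto[\boldsymbol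 a]_{\mathbf{L}}t_i$, $(\boldsymbol a,i)\in\mathcal{L}\times[r]$. $\mathcal{R}(M)$ is of fiber type if its presentation ideal is generated by that of $\mathcal{F}(M)$ together with the relations of $\operatorname{Sym}(M)$. Relations. In $R[T_{\boldsymbol a,i}]$ set $T_{\boldsymbol a,i}=0$ for $\boldsymbol a\in\mathcal{D}\setminus\mathcal{L}$ and $x_{i,j}=0$ for $x_{i,j}\notin\mathbf{L}$. Eagon--Northcott type relations: for $1\le c_1<\dots<c_{n+1}\le m$, $\widetilde{\boldsymbol c}=\{c_1,\dots,c_{n+1}\}$, $i\in[n]$, $k\in[r]$, the polynomial $\sum_{j\in[n+1]}(-1)^{i+j}x_{i,c_j}T_{\widetilde{\boldsymbol c}\setminus c_j,k}$, where $\widetilde{\boldsymbol c}\setminus c_j=(c_1,\dots,c_{j-1},c_{j+1},\dots,c_{n+1})\in\mathcal{D}$. Plücker type relations: let $(\boldsymbol a,i_1),(\boldsymbol b,i_2)$ be incomparable elements of $\mathcal{L}\times[r]$, $(\boldsymbol c,j_1)=(\boldsymbol a,i_1)\wedge(\boldsymbol b,i_2)$, $(\boldsymbol d,j_2)=(\boldsymbol a,i_1)\vee(\boldsymbol b,i_2)$. Tuples $(\boldsymbol e,j_1),(\boldsymbol g,j_2)\in\mathcal{D}\times[r]$ are vibrations of $(\boldsymbol a,i_1),(\boldsymbol b,i_2)$ if $\boldsymbol e\ne\boldsymbol c$, $\boldsymbol g\neq\boldsymbol d$, $\boldsymbol e\le\boldsymbol g\wedge\boldsymbol c$, and $\{e_1,\dots,e_n,g_1,\dots,g_n\}=\{a_1,\dots,a_n,b_1,\dots,b_n\}$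 as multisets; then $(e_1,\dots,e_n,g_1,\dots,g_n)$ is derived from $(a_1,\dots,a_n,b_1,\dots,b_n)$ via a permutation $\iota_{\boldsymbol e,\boldsymbol g}\in\mathfrak{S}_{2n}$. The relation is $$T_{\boldsymbol a,i_1}T_{\boldsymbol b,i_2}-T_{\boldsymbol c,j_1}T_{\boldsymbol d,j_2}+\sum\operatorname{sgn}(\iota_{\boldsymbol e,\boldsymbol g})\,T_{\boldsymbol e,j_1}T_{\boldsymbol g,j_2},$$ the sum being over the vibrations $(\boldsymbol e,j_1),(\boldsymbol g,j_2)$ of $(\boldsymbol a,i_1),(\boldsymbol b,i_2)$.
   Formalization: In the Plücker type relations the coefficients sgn(ι) of the vibrations are replaced by the integers making the relation hold for generic maximal minors; with signs (c), (d) fail, e.g. n=2, m=4, r=2, pair (13,2),(24,1), whose relation maps to ±[12][34]t₁t₂≠0. *)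

(* Defs.v *)
From mathcomp Require Import all_boot all_order all_algebra.
From mathcomp Require Export finmap.
From mathcomp.multinomials Require Export monalg.

Set Implicit Arguments.
Unset Strict Implicit.
Unset Printing Implicit Defensive.

Import Order.TTheory GRing.Theory.
Local Open Scope ring_scope.

(* Polynomial rings are monoid algebras on the free commutative monoid over an
   arbitrary finite type of variables, so that no enumeration of the matrix
   entries or of the index lattice is needed.  Subsets of rings that need not
   be decidable (ideals, subalgebras) are Prop-valued predicates. *)
Notation mpol K V := {malg K[{cmonom V}]}.
Notation "''V_' v" := (<< ucm v >> : mpol _ _)
  (at level 8, v at level 2, format "''V_' v") : ring_scope.

Definition same_set (T : Type) (A B : T -> Prop) : Prop :=
  forall x, A x <-> B x.

Inductive ideal_gen (A : comNzRingType) (S : A -> Prop) : A -> Prop :=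
  | ideal_gen0 : ideal_gen S 0
  | ideal_genS p : S p -> ideal_gen S p
  | ideal_genD p q : ideal_gen S p -> ideal_gen S q -> ideal_gen S (p + q)
  | ideal_genM c p : ideal_gen S p -> ideal_gen S (c * p).

Inductive alg_gen (K : fieldType) (A : comAlgType K) (S : A -> Prop) :
    A -> Prop :=
  | alg_genC c : alg_gen S c%:A
  | alg_genS p : S p -> alg_gen S p
  | alg_genD p q : alg_gen S p -> alg_gen S q -> alg_gen S (p + q)
  | alg_genM p q : alg_gen S p -> alg_gen S q -> alg_gen S (p * q).

(* The K-algebra morphism K[V] -> A sending the variable v to F v. *)
Definition mev (K : fieldType) (V : finType) (A : comAlgType K) (F : V -> A)
    (p : mpol K V) : A :=
  mmap (in_alg A) (fun u : {cmonom V} => \prod_v F v ^+ u v) p.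

(* Monomial orders are given by their "less than or equal" relation. *)

Definition monomial_order (V : finType) (le : rel {cmonom V}) : Prop :=
  [/\ total le, antisymmetric le & transitive le] /\
  ((forall u, le mone u) /\
   (forall u v w, le u v -> le (mmul u w) (mmul v w))).

(* In [lex_le] and [grevlex_le], [gt v w] means that the variable v is greater
   than the variable w. *)
Definition lex_le (V : finType) (gt : rel V) : rel {cmonom V} := fun u v =>
  (u == v) ||
  [exists s, (u s < v s)%N && [forall w, gt w s ==> (u w == v w)]].

Definition grevlex_le (V : finType) (gt : rel V) : rel {cmonom V} := fun u v =>
  (mdeg u < mdeg v)%N ||
  (mdeg u == mdeg v) &&
  ((u == v) ||
   [exists s, (v s < u s)%N && [forall w, gt s w ==> (u w == v w)]]).

(* The largest monomial of the support of p; the junk value for p = 0 is the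
   unit monomial, which is the least one. *)
Definition inm (K : fieldType) (V : finType) (le : rel {cmonom V})
    (p : mpol K V) : {cmonom V} :=
  \big[(fun u v => if le u v then v else u)/mone]_(u <- msupp p) u.

Definition initials (K : fieldType) (V : finType) (le : rel {cmonom V})
    (S : mpol K V -> Prop) : mpol K V -> Prop :=
  fun q => exists p, [/\ S p, p != 0 & q = << inm le p >>].

Definition initial_ideal (K : fieldType) (V : finType) (le : rel {cmonom V})
    (I : mpol K V -> Prop) : mpol K V -> Prop :=
  ideal_gen (initials le I).

Definition initial_algebra (K : fieldType) (V : finType) (le : rel {cmonom V})
    (A : mpol K V -> Prop) : mpol K V -> Prop :=
  alg_gen (initials le A).

Definition sagbi (K : fieldType) (V : finType) (le : rel {cmonom V})
    (G A : mpol K V -> Prop) : Prop :=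
  (forall p, G p -> A p) /\
  same_set (initial_algebra le A) (alg_gen (initials le G)).

Definition groebner (K : fieldType) (V : finType) (le : rel {cmonom V})
    (G : seq (mpol K V)) (I : mpol K V -> Prop) : Prop :=
  (forall p, p \in G -> I p) /\
  same_set (initial_ideal le I) (initial_ideal le (fun p => p \in G)).

(* Column indices: tuples (a_1, ..., a_n) of columns; the lattice D is the set
   of those that satisfy [increasing]. *)

Notation colidx n m := {ffun 'I_n -> 'I_m}.

Definition increasing n m (a : colidx n m) : bool :=
  [forall k : 'I_n, forall l : 'I_n, (k < l)%N ==> (a k < a l)%N].

Definition col_le n m (a b : colidx n m) : bool :=
  [forall k, (a k <= b k)%N].

Definition col_meet n m (a b : colidx n m) : colidx n m :=
  [ffun k => Order.min (a k) (b k)].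

Definition col_join n m (a b : colidx n m) : colidx n m :=
  [ffun k => Order.max (a k) (b k)].

Definition pair_le n m r (p q : colidx n m * 'I_r) : bool :=
  col_le p.1 q.1 && (p.2 <= q.2)%N.

Definition maxminor (A : comNzRingType) n m (X : 'M[A]_(n, m))
    (a : colidx n m) : A := \det (colsub a X).


Definition ladder n m (L : {set 'I_n * 'I_m}) : Prop :=
  forall (i i' : 'I_n) (j j' : 'I_m), (i, j) \in L -> (i', j') \in L ->
    (i <= i')%N -> (j' <= j)%N ->
    forall (u : 'I_n) (v : 'I_m), (i <= u <= i')%N -> (j' <= v <= j)%N -> (u, v) \in L.

Section LadderRings.

Context (K : fieldType) (n m : nat) (L : {set 'I_n * 'I_m}).

Definition xvar : finType := {p : 'I_n * 'I_m | p \in L}.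

Definition ladder_mx : 'M[mpol K xvar]_(n, m) :=
  \matrix_(i, j) if insub (i, j) is Some x then 'V_(x : xvar) else 0.

Definition lminor (a : colidx n m) : mpol K xvar := maxminor ladder_mx a.

Definition colset : {set colidx n m} :=
  [set a | increasing a & lminor a != 0].

Definition minor_ideal : mpol K xvar -> Prop :=
  ideal_gen (fun p => exists2 a, increasing a & p = lminor a).

Definition tau : rel {cmonom xvar} :=
  lex_le (fun x y : xvar => ((val x).1 < (val y).1)%N ||
     ((val x).1 == (val y).1) && ((val x).2 < (val y).2)%N).

Context (r : nat).

(* R[t_1, ..., t_r] is K[x, t]: inl x is a ladder entry, inr i is t_i. *)
Definition xtvar : finType := (xvar + 'I_r)%type.

Definition xpart (w : {cmonom xtvar}) : {cmonom xvar} :=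
  \big[mmul/mone]_(x : xvar) expcmn (ucm x) (w (inl x)).

Definition tpart (w : {cmonom xtvar}) : {cmonom 'I_r} :=
  \big[mmul/mone]_(i < r) expcmn (ucm i) (w (inr i)).

Definition tau' : rel {cmonom xtvar} := fun u v =>
  if tpart u == tpart v then tau (xpart u) (xpart v)
  else grevlex_le (fun i j : 'I_r => (i < j)%N) (tpart u) (tpart v).

Definition t_ (i : 'I_r) : mpol K xtvar := 'V_(inr i : xtvar).

Definition R_to_Rt : mpol K xvar -> mpol K xtvar :=
  mev (fun x => 'V_(inl x : xtvar)).

(* The Rees algebra of the direct sum of r copies of the ideal I of R. *)
Definition rees (I : mpol K xvar -> Prop) : mpol K xtvar -> Prop :=
  alg_gen (fun p => (exists f, p = R_to_Rt f) \/
                    (exists f i, I f /\ p = R_to_Rt f * t_ i)).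

Definition x_gens (p : mpol K xtvar) : Prop := exists x, p = 'V_(inl x : xtvar).

Definition minor_gens (p : mpol K xtvar) : Prop :=
  exists a i, a \in colset /\ p = R_to_Rt (lminor a) * t_ i.

Definition inminor_gens (p : mpol K xtvar) : Prop :=
  exists a i, a \in colset /\
    p = R_to_Rt << inm tau (lminor a) >> * t_ i.

Definition Tvar : finType := {p : colidx n m * 'I_r | p.1 \in colset}.
Definition xTvar : finType := (xvar + Tvar)%type.

Definition fiber_map : mpol K Tvar -> mpol K xtvar :=
  mev (fun v => R_to_Rt (lminor (val v).1) * t_ (val v).2).

Definition rees_map : mpol K xTvar -> mpol K xtvar :=
  mev (fun w : xTvar => match w with
    | inl x => 'V_(inl x : xtvar)
    | inr v => R_to_Rt (lminor (val v).1) * t_ (val v).2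
    end).

Definition fiber_ideal (p : mpol K Tvar) : Prop := fiber_map p = 0.
Definition rees_ideal (p : mpol K xTvar) : Prop := rees_map p = 0.

(* An order on K[T] is induced by tau' if it refines the comparison by tau' of
   the initial monomials of the images of the monomials in T. *)
Definition induced_order (le : rel {cmonom Tvar}) : Prop :=
  forall u v : {cmonom Tvar}, le u v ->
    tau' (inm tau' (fiber_map << u >>)) (inm tau' (fiber_map << v >>)).

Definition R_to_RT : mpol K xvar -> mpol K xTvar :=
  mev (fun x => 'V_(inl x : xTvar)).

Definition KT_to_RT : mpol K Tvar -> mpol K xTvar :=
  mev (fun v => 'V_(inr v : xTvar)).

(* Relations of Sym(M) on the generators [a]_L e_(i): the linear forms in T
   given by the syzygies of these generators in the free module R^r. *)
Definition sym_relation (q : mpol K xTvar) : Prop :=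
  exists f : Tvar -> mpol K xvar,
    (forall i : 'I_r,
       \sum_(v : Tvar | (val v).2 == i) f v * lminor (val v).1 = 0) /\
    q = \sum_(v : Tvar) R_to_RT (f v) * 'V_(inr v : xTvar).

Definition fiber_type : Prop :=
  same_set rees_ideal
    (ideal_gen (fun q => (exists2 p, fiber_ideal p & q = KT_to_RT p) \/
                         sym_relation q)).

(* The variable T_(a,i), set to 0 when a does not belong to [colset]. *)
Definition T_ (a : colidx n m) (i : 'I_r) : mpol K Tvar :=
  if insub (a, i) is Some v then 'V_(v : Tvar) else 0.

Definition col_del (c : {ffun 'I_n.+1 -> 'I_m}) (j : 'I_n.+1) : colidx n m :=
  [ffun k => c (lift j k)].

Definition eagon_northcott (p : mpol K xTvar) : Prop :=
  exists (c : {ffun 'I_n.+1 -> 'I_m}) (i : 'I_n) (k : 'I_r),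
    increasing c /\
    p = \sum_(j < n.+1) (-1) ^+ (i + j) * R_to_RT (ladder_mx i (c j))
                          * KT_to_RT (T_ (col_del c j) k).

Definition vibration (a b e g : colidx n m) : bool :=
  [&& increasing e, increasing g,
      e != col_meet a b, g != col_join a b,
      col_le e (col_meet g (col_meet a b))
    & perm_eq (codom e ++ codom g) (codom a ++ codom b)].

(* The integer coefficients of the vibrations are those of the straightening
   law for generic maximal minors; they are unique, as standard monomials are
   linearly independent.  These relations are usually displayed with the sign
   of the permutation taking (a, b) to (e, g) as the coefficient of [e][g], but
   that is not a relation among minors in general: for
   n = 2 the coefficient of [12][34] is 0 for (a, b) = (13, 24), and for n = 3
   the coefficients of [134][256] and [124][356] are 0 for
   (a, b) = (146, 235). *)
Definition straightening_coeffs (a b : colidx n m)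
    (lam : colidx n m -> colidx n m -> int) : Prop :=
  forall X : 'M[int]_(n, m),
    maxminor X a * maxminor X b
    - maxminor X (col_meet a b) * maxminor X (col_join a b)
    + \sum_(eg : colidx n m * colidx n m | vibration a b eg.1 eg.2)
        lam eg.1 eg.2 * (maxminor X eg.1 * maxminor X eg.2) = 0.

Definition plucker (p : mpol K Tvar) : Prop :=
  exists (a b : colidx n m) (i1 i2 : 'I_r)
         (lam : colidx n m -> colidx n m -> int),
  let c := col_meet a b in let d := col_join a b in
  let j1 := Order.min i1 i2 in let j2 := Order.max i1 i2 in
  [/\ a \in colset, b \in colset,
      ~~ pair_le (a, i1) (b, i2) && ~~ pair_le (b, i2) (a, i1),
      straightening_coeffs a b lam
    & p = T_ a i1 * T_ b i2 - T_ c j1 * T_ d j2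
          + \sum_(eg : colidx n m * colidx n m | vibration a b eg.1 eg.2)
              (T_ eg.1 j1 * T_ eg.2 j2) *~ lam eg.1 eg.2].

End LadderRings.

Arguments tau {n m L}.
Arguments tau' {n m L r}.

(* Main.v *)
(** By uncrossing in the ladder, a nonzero maximal minor has its lexicographic
    initial monomial on the diagonal, so [[a]_L] is nonzero exactly when the
    diagonal of the columns [a] lies in the ladder.  Let [psi u] be the initial
    monomial of the image of a monomial [u] in the variables [x] and [T].  Two
    kinds of replacements preserve [psi]: [T_p T_q] by
    [T_(p /\ q) T_(p \/ q)], and [x_(i,j) T_a] by [x_(i,a_i) T_a'], where [a']
    is [a] with [a_i] lowered to [j].  A weight that is convex and decreasing in
    the heights of column tuples grows under both, hence both terminate.
    A monomial admitting neither is determined by its value under [psi], since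
    its smallest [T]-variable can be recovered greedily.  The Plücker and
    Eagon-Northcott type relations lift these replacements, with the replaced
    monomial as initial monomial for the order that refines [psi] by the reversed
    weight.  A polynomial in the kernel of the presentation cannot have an initial
    monomial minimal in its fiber of [psi], so the relations form a Gröbner basis;
    and modulo the relations every polynomial reduces to one with distinct values
    of [psi] on its monomials, whence the SAGBI bases.  The Plücker type relations
    over the integers come from a [2n x 2n] determinant, and the bound on the
    first factors from the linear independence of standard products. *)
Require Import Defs.
From HB Require Import structures.
From mathcomp Require Import all_boot all_order all_algebra.
From mathcomp Require Import perm zify ring.

Set Implicit Arguments.
Unset Strict Implicit.
Unset Printing Implicit Defensive.

Import Order.TTheory GRing.Theory.
Local Open Scope ring_scope.

Local Notation "u ** v" := (mmul u v) (at level 40, left associativity).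

(** * Monomial orders *)

(** One replacement spreads two [T]-variables apart while keeping the sum of their heights, the
    other lowers a single one. A measure for both has to be additive over products, so that it can
    define a multiplicative order; any strictly decreasing, strictly convex function of the height
    would do, and a square is the simplest one that lives in [nat]. The straightening law is
    established with integer coefficients valid for matrices over every commutative ring, and only
    then specialised to the ladder matrix, whose minors outside [colset] vanish. The ladder thus
    enters through diagonals alone: those lying in it are stable under meet, join and lowering. The
    order on [K[T]] is the restriction of the one on [R[T]], so the same leading monomials serve
    both Gröbner bases. In (b), the Rees algebra of the initial ideal involves initial monomials of
    arbitrary elements [f] of the ideal; they are reached through [in(f) t_i = in(f t_i)], an
    element of the initial algebra already computed. *)

Lemma cmonomP (V : choiceType) (u v : {cmonom V}) : (forall x, u x = v x) -> u = v.
Proof. by move=> uv; apply/eqP/cmP. Qed.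

Lemma expcmnE (V : choiceType) (u : {cmonom V}) k x : expcmn u k x = (k * u x)%N.
Proof.
rewrite /expcmn (@Monoid.iteropE _ mone mmul k).
by elim: k => [|k IHk] /=; rewrite ?cm1 // cmM IHk mulSn.
Qed.

Lemma mprodE (V : choiceType) I (s : seq I) (P : pred I) (F : I -> {cmonom V}) x :
  (\big[mmul/mone]_(i <- s | P i) F i) x = (\sum_(i <- s | P i) F i x)%N.
Proof.
by rewrite (big_morph (fun u : {cmonom V} => u x) (fun u v => cmM x u v) (cm1 x)).
Qed.

Lemma mmulI (V : choiceType) (w : {cmonom V}) : injective (mmul^~ w).
Proof. by move=> u v /eqP/cmP uv; apply: cmonomP => x; have := uv x; rewrite !cmM; lia. Qed.

Lemma mdegT (V : finType) (u : {cmonom V}) : mdeg u = (\sum_x u x)%N.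
Proof.
rewrite mdegE [RHS](bigID (fun x => x \in finsupp u)) /= addnC [X in _ = (X + _)%N]big1 => [|x]; last first.
  by rewrite -cmE_eq0 => /eqP.
rewrite add0n -[RHS]big_filter; apply: perm_big.
apply: uniq_perm; rewrite ?fset_uniq ?filter_uniq ?index_enum_uniq //.
by move=> x; rewrite mem_filter mem_index_enum andbT.
Qed.

Definition msub (V W : finType) (f : V -> {cmonom W}) (u : {cmonom V}) : {cmonom W} :=
  \big[mmul/mone]_v expcmn (f v) (u v).

Section Msub.
Variables (V W : finType) (f : V -> {cmonom W}).

Lemma msubE u x : msub f u x = (\sum_v u v * f v x)%N.
Proof. by rewrite mprodE; apply: eq_bigr => v _; rewrite expcmnE. Qed.

Lemma msub1 : msub f mone = mone.
Proof. by apply: cmonomP => x; rewrite msubE big1 ?cm1 // => v _; rewrite cm1. Qed.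

Lemma msubM u v : msub f (u ** v) = msub f u ** msub f v.
Proof.
apply: cmonomP => x; rewrite cmM !msubE -big_split /=.
by apply: eq_bigr => y _; rewrite cmM mulnDl.
Qed.

Lemma msubU v : msub f (ucm v) = f v.
Proof.
apply: cmonomP => x; rewrite msubE (bigD1 v) //= cmUU mul1n big1 ?addn0 // => w wv.
by rewrite cmU eq_sym (negPf wv).
Qed.

End Msub.

Lemma mdvdP (V : finType) (u v : {cmonom V}) :
  (forall x, u x <= v x)%N -> exists w, v = u ** w.
Proof.
move=> uv; exists (divcm v u); apply: cmonomP => x.
by rewrite cmM divcmE subnKC.
Qed.

Lemma ucm_dvd (V : finType) (u : {cmonom V}) x : (0 < u x)%N -> exists w, u = ucm x ** w.
Proof.
move=> ux; apply: mdvdP => y; rewrite cmU.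
by case: eqP => // <-.
Qed.

Lemma ucm2_dvd (V : finType) (u : {cmonom V}) x y :
  x != y -> (0 < u x)%N -> (0 < u y)%N -> exists w, u = ucm x ** ucm y ** w.
Proof.
move=> xy ux uy; apply: mdvdP => z; rewrite cmM !cmU.
case: (eqVneq x z) ux => [<-|_] ux; first by rewrite eq_sym (negPf xy).
by case: (eqVneq y z) uy => [<-|].
Qed.

Lemma mdeg_monomials (V : finType) d :
  exists s : seq {cmonom V}, forall u, mdeg u = d -> u \in s.
Proof.
elim: d => [|d [s sP]].
  by exists [:: mone] => u /mdeg_eq0I ->; rewrite inE.
exists [seq ucm x ** u | x <- enum V, u <- s] => u du.
have [x ux] : exists x, (0 < u x)%N.
  apply/existsP; apply: contraT; rewrite negb_exists => /forallP u0.
  by move: du; rewrite mdegT big1 // => x _; have := u0 x; lia.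
have [w uE] := ucm_dvd ux; move: du; rewrite uE mdegM mdegU add1n => -[/sP ws].
by apply/allpairsP; exists (x, w); rewrite mem_enum.
Qed.

(* Total preorders compatible with multiplication are closed under pullback
   along monoid morphisms, reversal and lexicographic composition; all the
   orders below are built in this way. *)
Definition cmp_order (V : choiceType) (le : rel {cmonom V}) : Prop :=
  [/\ total le, transitive le & forall u v w, le (u ** w) (v ** w) = le u v].

Definition lex_comp (T : Type) (le1 le2 : rel T) : rel T :=
  fun u v => le1 u v && (le1 v u ==> le2 u v).

Section Orders.
Variables (V : finType).
Implicit Types (u v w : {cmonom V}) (le : rel {cmonom V}).

Lemma cmp_order_pull (W : choiceType) (f : {cmonom V} -> {cmonom W}) (le : rel {cmonom W}) :
  {morph f : u v / u ** v >-> u ** v} -> cmp_order le ->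
  cmp_order (fun u v => le (f u) (f v)).
Proof.
move=> fM [tot tr co]; split=> [u v|v u w|u v w]; first exact: tot.
- exact: tr.
- by rewrite !fM co.
Qed.

Lemma cmp_order_nat (f : {cmonom V} -> nat) :
  {morph f : u v / u ** v >-> (u + v)%N} -> cmp_order (fun u v => f u <= f v)%N.
Proof.
move=> fM; split=> [u v|v u w|u v w]; first exact: leq_total.
- exact: leq_trans.
- by rewrite !fM leq_add2r.
Qed.

Lemma cmp_order_rev le : cmp_order le -> cmp_order (fun u v => le v u).
Proof.
move=> [tot tr co]; split=> [u v|v u w uv vw|u v w]; [exact: tot| |exact: co].
exact: tr vw uv.
Qed.

Lemma cmp_order_lex le1 le2 :
  cmp_order le1 -> cmp_order le2 -> cmp_order (lex_comp le1 le2).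
Proof.
move=> [tot1 tr1 co1] [tot2 tr2 co2]; split=> [u v|v u w|u v w].
- rewrite /lex_comp; have := tot1 u v; have := tot2 u v.
  by case: (le1 u v) (le1 v u) (le2 u v) => [] [] [].
- rewrite /lex_comp => /andP[uv uvI] /andP[vw vwI]; rewrite (tr1 _ _ _ uv vw) /=.
  apply/implyP => wu; apply: (tr2 v).
    by apply: (implyP uvI); apply: tr1 wu.
  by apply: (implyP vwI); apply: tr1 uv.
- by rewrite /lex_comp !co1 co2.
Qed.

Lemma eq_cmp_order le1 le2 : le1 =2 le2 -> cmp_order le1 -> cmp_order le2.
Proof.
move=> e [tot tr co]; split=> [u v|v u w|u v w]; rewrite -!e //; first exact: tr.
Qed.

Lemma monomial_orderI le :
  cmp_order le -> (forall u v, le u v -> le v u -> u = v) -> (forall u, le mone u) ->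
  monomial_order le.
Proof.
move=> [tot tr co] anti min; split; first split=> //.
  by move=> u v /andP[]; exact: anti.
by split=> // u v w uv; rewrite co.
Qed.

(** The converse implication is the point: if [u ** w] is below [v ** w] while [v] is below [u],
    antisymmetry makes the two products equal, and monomials are cancellative. *)
Lemma monomial_order_cmp le : monomial_order le -> cmp_order le.
Proof.
move=> [[tot anti tr] [_ co]]; split=> // u v w.
apply/idP/idP => [uw|]; last exact: co.
case/orP: (tot u v) => // vu.
by have /mmulI-> : u ** w = v ** w; [apply: anti; rewrite uw co | case/orP: (tot v v)].
Qed.

End Orders.

Section LexOrder.
Variables (V : finType) (gt : rel V) (rk : V -> nat).
Hypothesis gtE : forall x y, gt x y = (rk x < rk y)%N.
Hypothesis rk_inj : injective rk.
Implicit Types (u v w : {cmonom V}).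

(** Presenting the variable order by a rank turns the choice of the first difference into a
    minimisation over a finite type. *)
Lemma first_diff u v : u != v ->
  exists x, u x != v x /\ (forall y, gt y x -> u y = v y).
Proof.
move=> uv; have [x0 x0P] : exists x, u x != v x.
  apply/existsP; apply: contraR uv; rewrite negb_exists => /forallP uv.
  by apply/cmP => x; apply/eqP; have := uv x; rewrite negbK.
case: (arg_minnP (P := fun x => u x != v x) rk x0P) => x xP xmin.
exists x; split=> // y; rewrite gtE => yx; apply/eqP; apply: contraLR yx => yP.
by rewrite -leqNgt xmin.
Qed.

Lemma lex_leI u v x :
  (u x < v x)%N -> (forall y, gt y x -> u y = v y) -> lex_le gt u v.
Proof.
move=> ux uvx; apply/orP; right; apply/existsP; exists x; rewrite ux /=.
by apply/forallP => y; apply/implyP => /uvx ->.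
Qed.

Lemma lex_leP u v : reflect
  (u = v \/ exists x, (u x < v x)%N /\ forall y, gt y x -> u y = v y) (lex_le gt u v).
Proof.
apply: (iffP orP) => [[/eqP|/existsP[x /andP[ux /forallP uvx]]]|[->|[x [ux uvx]]]].
- by left.
- by right; exists x; split=> // y yx; apply/eqP/(implyP (uvx y)).
- by left.
- by case/orP: (lex_leI ux uvx); auto.
Qed.

Lemma lex_le_anti u v : lex_le gt u v -> lex_le gt v u -> u = v.
Proof.
move=> /lex_leP[//|[x [ux uvx]]] /lex_leP[//|[y [vy vuy]]].
case: (ltngtP (rk x) (rk y)) => [xy|yx|/rk_inj xy].
- by have := vuy x; rewrite gtE xy => /(_ isT) xE; rewrite xE ltnn in ux.
- by have := uvx y; rewrite gtE yx => /(_ isT) yE; rewrite yE ltnn in vy.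
- by rewrite xy in ux; have := ltn_trans ux vy; rewrite ltnn.
Qed.

Lemma lex_cmp_order : cmp_order (lex_le gt).
Proof.
split=> [u v|v u w|u v w].
- case: (eqVneq u v) => [->|/first_diff[x [xP uvx]]].
    by rewrite /lex_le eqxx.
  case/orP: (leq_total (u x) (v x)) => uvl; apply/orP.
    by left; apply: (lex_leI (x := x)) => //; rewrite ltn_neqAle xP.
  right; apply: (lex_leI (x := x)); first by rewrite ltn_neqAle eq_sym xP.
  by move=> y /uvx.
- move=> /lex_leP[->//|[x [ux uvx]]] /lex_leP[<-|[y [vy vwy]]].
    exact: lex_leI ux uvx.
  case: (ltngtP (rk x) (rk y)) => [xy|yx|/rk_inj xy].
  + apply: (lex_leI (x := x)) => [|z zx]; first by rewrite -vwy // gtE.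
    by rewrite uvx // vwy // gtE (ltn_trans _ xy) // -gtE.
  + apply: (lex_leI (x := y)) => [|z zy]; first by rewrite uvx // gtE.
    by rewrite uvx ?vwy // gtE (ltn_trans _ yx) // -gtE.
  + subst y; apply: (lex_leI (x := x)) => [|z zy]; first exact: ltn_trans vy.
    by rewrite uvx ?vwy.
- apply/lex_leP/lex_leP => -[].
  + by move/mmulI; left.
  + move=> [x [ux uvx]]; right; exists x; rewrite !cmM ltn_add2r in ux; split=> // y yx.
    by have := uvx y yx; rewrite !cmM; lia.
  + by move->; left.
  + by move=> [x [ux uvx]]; right; exists x; rewrite !cmM ltn_add2r; split=> // y yx; rewrite !cmM uvx.
Qed.

Lemma lex_le_min u : lex_le gt mone u.
Proof.
have [tot _ _] := lex_cmp_order.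
case/orP: (tot mone u) => // /lex_leP[->|[x [+ _]]]; last by rewrite cm1.
by rewrite /lex_le eqxx.
Qed.

End LexOrder.

Section Grevlex.
Variables (V : finType) (gt : rel V) (rk : V -> nat).
Hypothesis gtE : forall x y, gt y x = (rk x < rk y)%N.
Hypothesis rk_inj : injective rk.

Let tg : rel V := fun x y => gt y x.

(** After the degree, the comparison is the opposite of the lexicographic order that reads the
    variables from the smallest one ([tg]), so the closure properties of [cmp_order] apply. *)
Lemma grevlexE (u v : {cmonom V}) : grevlex_le gt u v =
  lex_comp (fun u v => mdeg u <= mdeg v)%N (fun u v => lex_le tg v u) u v.
Proof.
rewrite /grevlex_le /lex_comp /lex_le.
case: (ltngtP (mdeg u) (mdeg v)) => //= _; rewrite eq_sym; congr (_ || _).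
by apply: eq_existsb => x; congr (_ && _); apply: eq_forallb => y; rewrite eq_sym.
Qed.

Lemma grevlex_cmp_order : cmp_order (grevlex_le gt).
Proof.
apply: (@eq_cmp_order _ (lex_comp (fun u v => mdeg u <= mdeg v)%N (fun u v => lex_le tg v u))).
  by move=> u v; rewrite grevlexE.
apply: cmp_order_lex; first by apply: cmp_order_nat; exact: mdegM.
apply: cmp_order_rev; apply: (lex_cmp_order (rk := rk)) => // x y; exact: gtE.
Qed.

Lemma grevlex_anti (u v : {cmonom V}) : grevlex_le gt u v -> grevlex_le gt v u -> u = v.
Proof.
rewrite !grevlexE /lex_comp => /andP[-> /= uv] /andP[vu].
rewrite vu /= in uv => vu'; apply/esym.
exact: (lex_le_anti (gt := tg) (rk := rk) (fun x y => gtE x y) rk_inj uv vu').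
Qed.

Lemma grevlex_min (u : {cmonom V}) : grevlex_le gt mone u.
Proof.
rewrite grevlexE /lex_comp mdeg1 leq0n leqn0 mdeg_eq0 /=.
by apply/implyP => /eqP ->; rewrite /lex_le eqxx.
Qed.

End Grevlex.

(** * Generated subalgebras and ideals, evaluation of polynomials *)

Lemma alg_gen_sub (K : fieldType) (A : comAlgType K) (S S' : A -> Prop) :
  (forall p, S p -> alg_gen S' p) -> forall p, alg_gen S p -> alg_gen S' p.
Proof.
move=> SS' p; elim=> [c|q /SS' //|q q' _ Hq _ Hq'|q q' _ Hq _ Hq'].
- exact: alg_genC.
- exact: alg_genD.
- exact: alg_genM.
Qed.

Lemma alg_gen_sum (K : fieldType) (A : comAlgType K) (S : A -> Prop) I (s : seq I) (F : I -> A) :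
  (forall i, alg_gen S (F i)) -> alg_gen S (\sum_(i <- s) F i).
Proof.
move=> SF; apply: (big_ind (alg_gen S)) => [|p q|i _]; last exact: SF.
- by rewrite -(scale0r (1 : A)); exact: alg_genC.
- exact: alg_genD.
Qed.

Lemma alg_gen_prod (K : fieldType) (A : comAlgType K) (S : A -> Prop) I (s : seq I) (F : I -> A) :
  (forall i, alg_gen S (F i)) -> alg_gen S (\prod_(i <- s) F i).
Proof.
move=> SF; apply: (big_ind (alg_gen S)) => [|p q|i _]; last exact: SF.
- by rewrite -(scale1r (1 : A)); exact: alg_genC.
- exact: alg_genM.
Qed.

Lemma alg_gen_exp (K : fieldType) (A : comAlgType K) (S : A -> Prop) p k :
  alg_gen S p -> alg_gen S (p ^+ k).
Proof.
move=> Sp; rewrite -[k]card_ord -prodr_const.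
exact: alg_gen_prod.
Qed.

Lemma alg_genZ (K : fieldType) (A : comAlgType K) (S : A -> Prop) c p :
  alg_gen S p -> alg_gen S (c *: p).
Proof. by move=> Sp; rewrite -mulr_algl; apply: alg_genM => //; exact: alg_genC. Qed.

Lemma ideal_gen_sub (A : comNzRingType) (S S' : A -> Prop) :
  (forall p, S p -> ideal_gen S' p) -> forall p, ideal_gen S p -> ideal_gen S' p.
Proof.
move=> SS' p; elim=> [|q /SS' //|q q' _ Hq _ Hq'|q q' _ Hq].
- exact: ideal_gen0.
- exact: ideal_genD.
- exact: ideal_genM.
Qed.

Lemma mUZ (K : fieldType) (V : finType) c (u : {cmonom V}) : << c *g u >> = c *: << u >> :> mpol K V.
Proof.
apply/malgP => w; apply: (etrans (mcoeffU u c w)); apply/esym.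
by apply: (etrans (mcoeffZ _ _ _)); rewrite mcoeffU1 mulr_natr.
Qed.

Section Evaluation.
Variables (K : fieldType) (V : finType) (A : comAlgType K) (F : V -> A).

Definition mon_eval (u : {cmonom V}) : A := \prod_v F v ^+ u v.

Fact mon_eval_mmorphism : mmorphism mon_eval.
Proof.
rewrite /mon_eval; split=> [u v|]; last by rewrite big1 // => v _; rewrite cm1 expr0.
by rewrite -big_split /=; apply: eq_bigr => w _; rewrite cmM exprD.
Qed.

HB.instance Definition _ := monalg.isMultiplicative.Build {cmonom V} A mon_eval mon_eval_mmorphism.

HB.instance Definition _ := GRing.RMorphism.copy (mev F)
  (mmap (in_alg A) mon_eval).

Fact mev_is_scalable : scalable (mev F).
Proof. by move=> c p; rewrite -[RHS]mulr_algl; exact: (@mmapZ _ _ _ (in_alg A) mon_eval). Qed.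

HB.instance Definition _ := GRing.isScalable.Build K (mpol K V) A *:%R (mev F) mev_is_scalable.

Lemma mevU u : mev F << u >> = \prod_v F v ^+ u v.
Proof. by rewrite [LHS](@mmapU _ _ _ (in_alg A) mon_eval) /= scale1r mul1r. Qed.

Lemma mevV v : mev F 'V_v = F v.
Proof.
rewrite mevU (bigD1 v) //= cmUU expr1 big1 ?mulr1 // => w wv.
by rewrite cmU eq_sym (negPf wv).
Qed.

Lemma mevE p : mev F p = \sum_(u <- msupp p) p@_u *: mev F << u >>.
Proof.
by rewrite {1}[p]monalgE raddf_sum; apply: eq_bigr => u _; rewrite -linearZ -mUZ.
Qed.

Lemma alg_gen_mev (S : A -> Prop) : (forall v, alg_gen S (F v)) -> forall p, alg_gen S (mev F p).
Proof.
move=> SF p; rewrite mevE; apply: alg_gen_sum => u; apply: alg_genZ.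
by rewrite mevU; apply: alg_gen_prod => v; exact: alg_gen_exp.
Qed.

Lemma alg_gen_image p : alg_gen (fun q => exists v, q = F v) p <-> exists P, p = mev F P.
Proof.
split=> [|[P ->]]; last first.
  by apply: alg_gen_mev => v; apply: alg_genS; exists v.
elim=> [c|_ [v ->]|_ _ _ [P ->] _ [Q ->]|_ _ _ [P ->] _ [Q ->]].
- by exists (c%:A); rewrite linearZ rmorph1.
- by exists 'V_v; rewrite mevV.
- by exists (P + Q); rewrite rmorphD.
- by exists (P * Q); rewrite rmorphM.
Qed.

End Evaluation.

Section Mpol.
Variables (K : fieldType) (V : finType).
Implicit Types (p q : mpol K V) (u v : {cmonom V}).

Lemma mU1 : << mone >> = 1 :> mpol K V. Proof. by []. Qed.

Lemma mUM u v : << u ** v >> = << u >> * << v >> :> mpol K V.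
Proof.
by apply/esym/(etrans (fgmulUU _ _ _ _)); rewrite mulr1.
Qed.

Lemma mUX u k : << expcmn u k >> = << u >> ^+ k :> mpol K V.
Proof.
elim: k => [|k IHk]; first by rewrite expr0 -mU1.
rewrite exprS -IHk -mUM; congr << _ >>; apply: cmonomP => x.
by rewrite cmM !expcmnE mulSn.
Qed.

Lemma mU_prod I (s : seq I) (f : I -> {cmonom V}) :
  << \big[mmul/mone]_(i <- s) f i >> = \prod_(i <- s) << f i >> :> mpol K V.
Proof. exact: (big_morph (fun u => << u >> : mpol K V) mUM mU1). Qed.

Lemma mU_neq0 u : << u >> != 0 :> mpol K V.
Proof. by rewrite monalgU_eq0 oner_eq0. Qed.

Lemma in_msuppU u v : (u \in msupp (<< v >> : mpol K V)) = (u == v).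
Proof. by rewrite msuppU1 in_fset1. Qed.

Lemma msuppD_or p q u : u \in msupp (p + q) -> (u \in msupp p) || (u \in msupp q).
Proof. by have /fsubsetP/(_ u) := msuppD_le p q; rewrite in_fsetU. Qed.

Lemma msuppZ_in c p u : u \in msupp (c *: p) -> u \in msupp p.
Proof. by have /fsubsetP := msuppZ_le c p; apply. Qed.

Lemma mcoeff_sumZ (I : Type) (s : seq I) (P : pred I) (c : I -> K) (F : I -> mpol K V) u :
  (\sum_(i <- s | P i) c i *: F i)@_u = \sum_(i <- s | P i) c i * (F i)@_u.
Proof.
elim: s => [|i s IHs]; first by rewrite !big_nil mcoeff0.
by rewrite !big_cons; case: (P i); rewrite // mcoeffD mcoeffZ IHs.
Qed.

Lemma msupp_sum (I : eqType) (s : seq I) (F : I -> mpol K V) u :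
  u \in msupp (\sum_(i <- s) F i) -> exists2 i, i \in s & u \in msupp (F i).
Proof.
elim: s => [|i s IHs]; first by rewrite big_nil msupp0.
rewrite big_cons => /msuppD_or/orP[ui|/IHs[j js uj]]; first by exists i; rewrite ?mem_head.
by exists j; rewrite // inE js orbT.
Qed.

End Mpol.

Lemma mev_monE (K : fieldType) (V W : finType) (f : V -> {cmonom W}) u :
  mev (fun v => << f v >> : mpol K W) << u >> = << msub f u >>.
Proof. by rewrite mevU mU_prod; apply: eq_bigr => v _; rewrite mUX. Qed.

Lemma msupp_mev_mon (K : fieldType) (V W : finType) (f : V -> {cmonom W}) (p : mpol K V) u :
  u \in msupp (mev (fun v => << f v >> : mpol K W) p) ->
  exists2 v, v \in msupp p & u = msub f v.
Proof.
rewrite mevE => /msupp_sum[v vp]; rewrite mev_monE => /msuppZ_in.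
by rewrite in_msuppU => /eqP ->; exists v.
Qed.

(** * Initial monomials and tails *)

Section InitialMonomial.
Variables (K : fieldType) (V : finType) (le : rel {cmonom V}).
Hypothesis le_mo : monomial_order le.
Implicit Types (p q : mpol K V) (u v : {cmonom V}).

Let tot : total le. Proof. by case: le_mo => -[]. Qed.
Let anti u v : le u v -> le v u -> u = v.
Proof. by case: le_mo => -[_ + _ _] uv vu; apply; rewrite uv. Qed.
Let tr : transitive le. Proof. by case: le_mo => -[]. Qed.
Let min u : le mone u. Proof. by case: le_mo => _ []. Qed.
Let co u v w : le (u ** w) (v ** w) = le u v.
Proof. by case: (monomial_order_cmp le_mo). Qed.
Let refl u : le u u. Proof. by case/orP: (tot u u). Qed.

Let maxm (s : seq {cmonom V}) := \big[(fun u v => if le u v then v else u)/mone]_(u <- s) u.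

Lemma max_of_seq (s : seq {cmonom V}) :
  (s != [::] -> maxm s \in s) /\ forall u, u \in s -> le u (maxm s).
Proof.
rewrite /maxm; elim: s => [|v s [IH1 IH2]]; first by split.
rewrite big_cons -/(maxm s) in IH1 IH2 *; split=> [_|u]; rewrite inE.
  case: (eqVneq s [::]) IH1 => [-> _|_ IH1].
    by rewrite /maxm big_nil; case: ifP => [vm|_]; [rewrite (anti vm (min v)) eqxx | rewrite eqxx].
  by case: ifP => _; rewrite ?eqxx // IH1 ?orbT.
case/orP=> [/eqP ->|/IH2 us]; case: ifP => //.
by move=> /negbT vs; apply: tr us _; case/orP: (tot v (maxm s)) vs => ->.
Qed.

Lemma inmP p : p != 0 -> inm le p \in msupp p /\ forall u, u \in msupp p -> le u (inm le p).
Proof.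
move=> p0; have [H1 H2] := max_of_seq (enum_fset (msupp p)); split; last exact: H2.
by apply: H1; apply: contraNneq p0 => sE; rewrite [p]monalgE sE big_nil.
Qed.

Lemma inm_supp p : p != 0 -> inm le p \in msupp p.
Proof. by case/inmP. Qed.

Lemma inm_coef p : p != 0 -> p@_(inm le p) != 0.
Proof. by rewrite mcoeff_neq0; exact: inm_supp. Qed.

Lemma inm_max p u : u \in msupp p -> le u (inm le p).
Proof.
move=> up; have p0 : p != 0 by apply: contraTneq up => ->; rewrite msupp0.
by have [_] := inmP p0; apply.
Qed.

Lemma inm_eq p u : u \in msupp p -> (forall v, v \in msupp p -> le v u) ->
  inm le p = u.
Proof.
move=> up pu; apply: anti; last exact: inm_max.
by apply/pu/inm_supp; apply: contraTneq up => ->; rewrite msupp0.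
Qed.

Lemma inmU u : inm le (<< u >> : mpol K V) = u.
Proof.
by apply: inm_eq => [|v]; rewrite in_msuppU // => /eqP ->.
Qed.

Lemma le_mulmm u v u' v' : le u u' -> le v v' -> le (u ** v) (u' ** v').
Proof.
move=> uu' vv'; apply: (@tr (u' ** v)); first by rewrite co.
by rewrite ![u' ** _]mulmC co.
Qed.

Lemma le_mulmm_eq u v u' v' : le u u' -> le v v' -> u ** v = u' ** v' -> u = u' /\ v = v'.
Proof.
move=> uu' vv' e.
have uE : u = u'.
  apply: anti => //; rewrite -(co _ _ v) e ![u' ** _]mulmC co //.
by split=> //; move: e; rewrite uE ![u' ** _]mulmC => /mmulI.
Qed.

(** The product of the two leading terms cannot cancel: by [le_mulmm_eq] no other pair of support
    monomials has the same product, and the coefficients lie in a field. *)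
Lemma inmM p q : p != 0 -> q != 0 -> p * q != 0 /\ inm le (p * q) = inm le p ** inm le q.
Proof.
move=> p0 q0.
have cE : (p * q)@_(inm le p ** inm le q) = p@_(inm le p) * q@_(inm le q).
  rewrite mcoeffMl (bigD1_seq (inm le p)) ?inm_supp ?fset_uniq //=.
  rewrite (bigD1_seq (inm le q)) ?inm_supp ?fset_uniq //= eqxx mulr1n.
  rewrite [X in _ + X + _]big_seq_cond [X in _ + X + _]big1 ?addr0; last first.
    move=> v /andP[vq vN]; case: eqP => // e.
    by have [_ vE] := le_mulmm_eq (refl _) (inm_max vq) e; rewrite vE eqxx in vN.
  rewrite [X in _ + X]big_seq_cond [X in _ + X]big1 ?addr0 //.
  move=> u /andP[up uN]; rewrite big_seq big1 // => v vq; case: eqP => // e.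
  by have [uE _] := le_mulmm_eq (inm_max up) (inm_max vq) e; rewrite uE eqxx in uN.
have c0 : (p * q)@_(inm le p ** inm le q) != 0 by rewrite cE mulf_neq0 ?inm_coef.
split; first by apply: contraNneq c0 => ->; rewrite mcoeff0.
apply: inm_eq; first by rewrite -mcoeff_neq0.
by move=> w /msuppM_le[u [v [up vq ->]]]; apply: le_mulmm; exact: inm_max.
Qed.

Lemma inmX p k : p != 0 -> p ^+ k != 0 /\ inm le (p ^+ k) = expcmn (inm le p) k.
Proof.
move=> p0; elim: k => [|k [IH0 IHk]]; first by rewrite expr0 oner_eq0 -mU1 inmU.
rewrite exprS; have [-> ->] := inmM p0 IH0; split=> //.
by rewrite IHk; apply: cmonomP => x; rewrite cmM !expcmnE mulSn.
Qed.

Lemma inm_prod I (s : seq I) (F : I -> mpol K V) : (forall i, F i != 0) ->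
  \prod_(i <- s) F i != 0 /\
  inm le (\prod_(i <- s) F i) = \big[mmul/mone]_(i <- s) inm le (F i).
Proof.
move=> F0; elim: s => [|i s [IH0 IHs]]; first by rewrite !big_nil oner_eq0 -mU1 inmU.
by rewrite !big_cons; have [-> ->] := inmM (F0 i) IH0; rewrite IHs.
Qed.

Lemma inm_mev (U : finType) (F : U -> mpol K V) (u : {cmonom U}) : (forall x, F x != 0) ->
  mev F << u >> != 0 /\ inm le (mev F << u >>) = msub (fun x => inm le (F x)) u.
Proof.
move=> F0; rewrite mevU.
have [|-> ->] := @inm_prod _ (index_enum U) (fun x => F x ^+ u x).
  by move=> x; have [] := inmX (u x) (F0 x).
split=> //; apply: eq_bigr => x _.
by have [] := inmX (u x) (F0 x).
Qed.

(* Equality of the degrees is what makes reduction terminate below: there are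
   only finitely many monomials of a given degree. *)
Definition tail_of u (h : mpol K V) : Prop :=
  forall v, v \in msupp h -> [/\ le v u, v != u & mdeg v = mdeg u].

Lemma tail_of0 u : tail_of u 0.
Proof. by move=> v; rewrite msupp0. Qed.

Lemma tail_ofD u h h' : tail_of u h -> tail_of u h' -> tail_of u (h + h').
Proof.
move=> Hh Hh' v /msuppD_or/orP[/Hh|/Hh'] //.
Qed.

Lemma tail_ofZ u c h : tail_of u h -> tail_of u (c *: h).
Proof. by move=> Hh v /msuppZ_in/Hh. Qed.

Lemma tail_of_sum u I (s : seq I) (P : pred I) (F : I -> mpol K V) :
  (forall i, P i -> tail_of u (F i)) -> tail_of u (\sum_(i <- s | P i) F i).
Proof. by move=> H; apply: big_ind => //; [exact: tail_of0 | exact: tail_ofD]. Qed.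

Lemma tail_ofU u v : le v u -> v != u -> mdeg v = mdeg u -> tail_of u << v >>.
Proof. by move=> vu vN d w; rewrite in_msuppU => /eqP ->. Qed.

Lemma tail_ofM u w h : tail_of u h -> tail_of (u ** w) (h * << w >>).
Proof.
move=> Hh v /msuppM_le[v1 [v2 [/Hh[vu vN d]]]]; rewrite in_msuppU => /eqP-> ->.
rewrite co vu !mdegM d; split=> //.
by apply: contraNneq vN => /mmulI ->.
Qed.

Lemma tail_ofMM u v h k : tail_of u h -> tail_of v k ->
  exists2 l, (<< u >> + h) * (<< v >> + k) = << u ** v >> + l & tail_of (u ** v) l.
Proof.
move=> hT kT; exists (h * << v >> + << u >> * k + h * k).
  rewrite mUM; move: << u >> << v >> => x y; rewrite mulrDl !mulrDr; ring.
apply: tail_ofD; first apply: tail_ofD; first exact: tail_ofM.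
  by rewrite mulrC mulmC; exact: tail_ofM.
move=> w /msuppM_le[w1 [w2 [/hT[le1 ne1 d1] /kT[le2 ne2 d2] ->]]].
split; [exact: le_mulmm | | by rewrite !mdegM d1 d2].
by apply: contraNneq ne1 => /(le_mulmm_eq le1 le2)[-> _].
Qed.

Lemma inm_tail u h : tail_of u h -> << u >> + h != 0 /\ inm le (<< u >> + h) = u.
Proof.
move=> Hh; have cu : (<< u >> + h)@_u = 1.
  rewrite mcoeffD mcoeffUU mcoeff_outdom ?addr0 //.
  by apply/negP => /Hh[]; rewrite eqxx.
have us : u \in msupp (<< u >> + h) by rewrite -mcoeff_neq0 cu oner_eq0.
split; first by apply: contraTneq us => ->; rewrite msupp0.
apply: inm_eq => // v /msuppD_or; rewrite in_msuppU.
by move=> /orP[/eqP -> //|/Hh[]].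
Qed.

(** The largest initial monomial with nonzero coefficient survives in the sum. Besides linear
    independence, the lower bound by a prescribed [inm le (F i0)] is recorded, because it is what
    pins down the coefficient of the meet-join product later. *)
Lemma sum_inm_distinct (I : finType) (P : pred I) (F : I -> mpol K V) (c : I -> K) i0 :
  (forall i, P i -> F i != 0) ->
  {in P &, injective (fun i => inm le (F i))} -> P i0 -> c i0 != 0 ->
  exists u, u \in msupp (\sum_(i | P i) c i *: F i) /\ le (inm le (F i0)) u.
Proof.
move=> F0 Finj Pi0 ci0; set Q := fun i => P i && (c i != 0).
pose s := [seq inm le (F i) | i <- enum Q].
have Qi0 : i0 \in Q by rewrite unfold_in /Q Pi0.
have [i1 Qi1 i1max] : exists2 i1, Q i1 & forall i, Q i -> le (inm le (F i)) (inm le (F i1)).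
  have : i0 \in enum Q by rewrite mem_enum.
  suff H (t : seq I) : i0 \in t ->
      exists2 i1, i1 \in t & forall i, i \in t -> le (inm le (F i)) (inm le (F i1)).
    move/H => [i1]; rewrite mem_enum => Qi1 H1; exists i1 => // i Qi.
    by apply: H1; rewrite mem_enum.
  elim: t i0 {Pi0 ci0 Qi0} => // j [|k t] IH i0.
    by move=> _; exists j; rewrite ?mem_head // => i; rewrite !inE => /eqP ->.
  move=> _; have [i1 i1t i1m] := IH k (mem_head _ _).
  case/orP: (tot (inm le (F i1)) (inm le (F j))) => H.
    exists j; rewrite ?mem_head // => i; rewrite inE => /orP[/eqP-> //|/i1m H'].
    exact: tr H' H.
  exists i1; first by rewrite inE i1t orbT.
  by move=> i; rewrite inE => /orP[/eqP-> //|/i1m].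
exists (inm le (F i1)); split; last exact: i1max.
have [Pi1 ci1] := andP Qi1.
rewrite -mcoeff_neq0 mcoeff_sumZ (bigD1 i1) //=.
rewrite big1 ?addr0 ?mulf_neq0 ?inm_coef ?F0 // => i /andP[Pi ii1].
case: (eqVneq (c i) 0) => [->|ci]; first by rewrite mul0r.
rewrite mcoeff_outdom ?mulr0 //; apply/negP => /inm_max H.
have e : inm le (F i1) = inm le (F i).
  by apply: anti => //; apply: i1max; rewrite /Q Pi.
by move/(Finj _ _ Pi1 Pi): e ii1 => ->; rewrite eqxx.
Qed.

End InitialMonomial.

(** * Degenerations to monomial algebras *)

Lemma count_lt (T : eqType) (a b : pred T) (s : seq T) x :
  (forall y, a y -> b y) -> x \in s -> b x -> ~~ a x -> (count a s < count b s)%N.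
Proof.
move=> ab xs bx ax; rewrite -[X in (_ < X)%N]size_filter -(count_predC a (filter b s)) !count_filter.
rewrite (@eq_count _ (predI a b) a) => [|y]; last by have := ab y; rewrite /=; case: (a y) => // ->.
rewrite -addn1 leq_add2l -has_count; apply/hasP; exists x => //.
by rewrite /= ax.
Qed.

Section ToricDegeneration.
Variables (K : fieldType) (V W : finType) (F : V -> mpol K W).
Variables (leV : rel {cmonom V}) (leW : rel {cmonom W}).
Hypothesis leV_mo : monomial_order leV.
Hypothesis leW_mo : monomial_order leW.
Hypothesis F_neq0 : forall v, F v != 0.

Let psi := msub (fun v => inm leW (F v)).

Hypothesis psi_le : forall u v, leV u v -> leW (psi u) (psi v).

Let psiE u : inm leW (mev F << u >>) = psi u.
Proof. by have [] := inm_mev leW_mo u F_neq0. Qed.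

(** These monomials are the candidates for a basis modulo the kernel: none of them can be the
    initial monomial of an element of the kernel. *)
Definition fiber_min u := forall v, psi v = psi u -> leV u v.

Let anti u v : leV u v -> leV v u -> u = v.
Proof. by case: leV_mo => -[_ + _ _] uv vu; apply; rewrite uv. Qed.

(** If another monomial [v] of [P] contributed to the coefficient of [psi u], monotonicity of [psi]
    would force [psi v = psi u], and minimality of [u] in its fiber would contradict its maximality
    in [P]. *)
Lemma inm_mev_fiber_min P : P != 0 -> fiber_min (inm leV P) ->
  mev F P != 0 /\ inm leW (mev F P) = psi (inm leV P).
Proof.
move=> P0 uM; set u := inm leV P in uM *.
have le_u v w : v \in msupp P -> w \in msupp (mev F << v >>) -> leW w (psi v) /\ leW (psi v) (psi u).
  move=> vP wv; split; first by rewrite -psiE; exact: (inm_max leW_mo).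
  by apply/psi_le/(inm_max leV_mo).
have [anW trW] : antisymmetric leW /\ transitive leW by case: leW_mo => -[].
have cE : (mev F P)@_(psi u) = P@_u * (mev F << u >>)@_(psi u).
  rewrite mevE mcoeff_sumZ (bigD1_seq u) ?fset_uniq ?(inm_supp leV_mo) //=.
  rewrite big_seq_cond big1 ?addr0 // => v /andP[vP vu].
  rewrite [X in _ * X]mcoeff_outdom ?mulr0 //; apply/negP => /(le_u _ _ vP)[uv vu'].
  have e : psi v = psi u by apply: anW; rewrite uv vu'.
  by move/eqP: vu; apply; apply: anti; [exact: (inm_max leV_mo) | exact: uM].
have c0 : (mev F P)@_(psi u) != 0.
  rewrite cE mulf_neq0 ?(inm_coef leV_mo) //.
  rewrite -psiE; have [u0 _] := inm_mev leW_mo u F_neq0.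
  exact: (inm_coef leW_mo).
split; first by apply: contraNneq c0 => ->; rewrite mcoeff0.
apply: (inm_eq leW_mo) => [|w]; first by rewrite -mcoeff_neq0.
rewrite mevE => /msupp_sum[v vP] /msuppZ_in /(le_u _ _ vP)[].
exact: trW.
Qed.

(** The combinatorial input: a monomial that is not first in its fiber is divisible by the leading
    monomial of some element of [G] with leading coefficient 1. *)
Variable G : mpol K V -> Prop.
Hypothesis G_ker : forall g, G g -> mev F g = 0.
Hypothesis G_lead : forall u, fiber_min u \/
  exists v w h, [/\ G (<< v >> + h), tail_of leV v h & u = v ** w].

Lemma initial_ideal_ker p :
  initial_ideal leV (fun p => mev F p = 0) p <-> initial_ideal leV G p.
Proof.
split; last first.
  apply: ideal_gen_sub => _ [g [/G_ker gK g0 ->]].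
  by apply: ideal_genS; exists g.
apply: ideal_gen_sub => _ [g [gK g0 ->]].
have [uM|[v [w [h [Gh hT uE]]]]] := G_lead (inm leV g).
  by have [] := (inm_mev_fiber_min g0 uM); rewrite gK eqxx.
have [h0 hE] := inm_tail leV_mo hT.
rewrite uE mUM mulrC; apply/ideal_genM/ideal_genS.
by exists (<< v >> + h); rewrite hE.
Qed.

Definition reducible p := exists P,
  ideal_gen G (p - P) /\ forall v, v \in msupp P -> fiber_min v.

Lemma reducible_sum (t : seq {cmonom V}) (c : {cmonom V} -> K) :
  (forall u, u \in t -> reducible << u >>) -> reducible (\sum_(u <- t) c u *: << u >>).
Proof.
elim: t => [_|x t IHt tP].
  exists 0; rewrite big_nil subrr; split; first exact: ideal_gen0.
  by move=> v; rewrite msupp0.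
have [|N [NG NM]] := IHt; first by move=> y yt; apply: tP; rewrite inE yt orbT.
have [P [PG PM]] := tP x (mem_head _ _).
exists (c x *: P + N); split.
  rewrite big_cons opprD addrACA -scalerBr; apply: ideal_genD => //.
  by rewrite -mulr_algl; exact: ideal_genM.
by move=> v' /msuppD_or/orP[/msuppZ_in/PM|/NM].
Qed.

Lemma reducible_supp p : (forall u, u \in msupp p -> reducible << u >>) -> reducible p.
Proof.
have {2}-> : p = \sum_(u <- msupp p) p@_u *: << u >>.
  by rewrite {1}[p]monalgE; apply: eq_bigr => u _; rewrite mUZ.
exact: reducible_sum.
Qed.

Lemma reducible_mon u : reducible << u >>.
Proof.
have [s sP] := mdeg_monomials V (mdeg u).
(* [s] contains all monomials of the common degree, so the number of its entries below [u] is finite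
   and drops on passing to a monomial of the tail. *)
pose below (u v : {cmonom V}) := leV v u && (v != u).
have [k] := ubnP (count (below u) s).
have : mdeg u = mdeg u by [].
move: {-2}(mdeg u) sP => d sP du.
elim: k u du => // k IHk u du uk.
case: (G_lead u) => [uM|[v [w [h [Gh hT uE]]]]].
  exists << u >>; rewrite subrr; split; first exact: ideal_gen0.
  by move=> v; rewrite in_msuppU => /eqP ->.
have hwT : tail_of leV u (h * << w >>) by rewrite uE; exact: (tail_ofM leV_mo).
have [N [NG NM]] : reducible (h * << w >>).
  apply: reducible_supp => x /hwT[xu xN xd]; apply: IHk; first by rewrite xd.
  have trV : transitive leV by case: leV_mo => -[].
  rewrite -ltnS; apply: leq_trans uk; rewrite ltnS.
  have sub y : below x y -> below u y.
    move=> /andP[yx yN]; apply/andP; split; first exact: trV yx xu.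
    by apply: contraNneq xN => yu; apply/eqP/anti; rewrite // -yu.
  apply: (count_lt sub) (_ : x \in s) _ _; first by rewrite sP // xd.
    by rewrite /below xu.
  by rewrite /below eqxx andbF.
(* The leading monomial is congruent to minus its tail, hence the sign. *)
exists (- N); split; last by move=> v'; rewrite msuppN; exact: NM.
have -> : << u >> - - N = << w >> * (<< v >> + h) - (h * << w >> - N).
  have -> : << u >> = << v >> * << w >> :> mpol K V by rewrite uE mUM.
  by move: << v >> << w >> => a b; rewrite mulrDr; ring.
rewrite -[- (_ - N)]mulN1r; apply: ideal_genD; apply: ideal_genM => //.
exact: ideal_genS.
Qed.

Lemma normal_form p : reducible p.
Proof. by apply: reducible_supp => u _; exact: reducible_mon. Qed.

Lemma ideal_gen_ker p : ideal_gen G p -> mev F p = 0.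
Proof.
elim=> [|q /G_ker //|q q' _ Hq _ Hq'|q q' _ Hq]; first exact: rmorph0.
- by rewrite rmorphD /= Hq Hq' addr0.
- by rewrite rmorphM /= Hq mulr0.
Qed.

Lemma ker_ideal_gen p : mev F p = 0 -> ideal_gen G p.
Proof.
move=> pK; have [P [PG PM]] := normal_form p.
suff P0 : P = 0 by move: PG; rewrite P0 subr0.
have PK : mev F P = 0.
  by move: (ideal_gen_ker PG); rewrite rmorphB /= pK sub0r => /eqP; rewrite oppr_eq0 => /eqP.
apply/eqP/contraT => P0.
by have [] := inm_mev_fiber_min P0 (PM _ (inm_supp leV_mo P0)); rewrite PK eqxx.
Qed.

Lemma inm_image p : mev F p != 0 -> exists u, inm leW (mev F p) = psi u.
Proof.
have [P [PG PM]] := normal_form p.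
have -> : mev F p = mev F P.
  by apply/eqP; rewrite -subr_eq0 -rmorphB; apply/eqP/ideal_gen_ker.
move=> P0; have {}P0 : P != 0 by apply: contraNneq P0 => ->; rewrite rmorph0.
by have [_ ->] := inm_mev_fiber_min P0 (PM _ (inm_supp leV_mo P0)); eexists.
Qed.

Lemma alg_gen_psi u : alg_gen (fun q => exists v, q = << inm leW (F v) >>) (<< psi u >> : mpol K W).
Proof. by rewrite -mev_monE; apply/alg_gen_image; eexists. Qed.

Lemma initial_algebra_image (A : mpol K W -> Prop) :
  (forall p, A p <-> exists P, p = mev F P) ->
  same_set (initial_algebra leW A) (alg_gen (fun q => exists v, q = << inm leW (F v) >>)).
Proof.
move=> AP p; split.
  apply: alg_gen_sub => _ [q [/AP[P ->] P0 ->]].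
  by have [u ->] := inm_image P0; exact: alg_gen_psi.
apply: alg_gen_sub => _ [v ->]; apply: alg_genS; exists (F v); split=> //.
by apply/AP; exists 'V_v; rewrite mevV.
Qed.

End ToricDegeneration.

(** * The straightening law *)

Section ColumnIndices.
Variables n m : nat.
Implicit Types (a b e g : colidx n m).

Lemma increasingP a : reflect (forall k l : 'I_n, (k < l)%N -> (a k < a l)%N) (increasing a).
Proof.
apply: (iffP forallP) => [H k l kl|H k]; first by have /forallP/(_ l)/implyP := H k; apply.
by apply/forallP => l; apply/implyP/H.
Qed.

Lemma increasing_leq a (k l : 'I_n) : increasing a -> (k <= l)%N -> (a k <= a l)%N.
Proof.
move=> /increasingP aP; rewrite leq_eqVlt => /orP[/eqP/val_inj -> //|/aP/ltnW //].
Qed.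

Lemma col_leP a b : reflect (forall k, (a k <= b k)%N) (col_le a b).
Proof. exact: forallP. Qed.

Lemma col_le_trans a b e : col_le a b -> col_le b e -> col_le a e.
Proof. by move=> /col_leP ab /col_leP be; apply/col_leP => k; apply: leq_trans (be k). Qed.

Lemma col_le_anti a b : col_le a b -> col_le b a -> a = b.
Proof.
move=> /col_leP ab /col_leP ba; apply/ffunP => k; apply/val_inj/anti_leq.
by rewrite ab ba.
Qed.

Lemma sum_codom e (F : 'I_m -> nat) : (\sum_(x <- codom e) F x = \sum_k F (e k))%N.
Proof. by rewrite codomE big_map big_enum. Qed.

(** Testing multisets against all weights makes one hypothesis usable both for counting entries
    below a bound and for summing entries. *)
Lemma perm_sumP (s1 s2 : seq 'I_m) :
  perm_eq s1 s2 <-> forall F : 'I_m -> nat, (\sum_(x <- s1) F x = \sum_(x <- s2) F x)%N.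
Proof.
split=> [p F|H]; first exact: perm_big.
by apply/seq.permP => P; rewrite -!sum1_count big_mkcond [RHS]big_mkcond; exact: H.
Qed.

Lemma content_sumP a b e g : perm_eq (codom e ++ codom g) (codom a ++ codom b) <->
  forall F : 'I_m -> nat,
    (\sum_k F (e k) + \sum_k F (g k) = \sum_k F (a k) + \sum_k F (b k))%N.
Proof.
split=> [/perm_sumP H F|H]; first by have := H F; rewrite !big_cat !sum_codom.
by apply/perm_sumP => F; rewrite !big_cat !sum_codom; exact: H.
Qed.

Lemma sum_ltn_ord k : (k <= n)%N -> (\sum_(l < n) (l < k)%N = k)%N.
Proof.
by move=> kn; rewrite -big_mkcond /= -(big_ord_widen_cond _ predT (fun=> 1%N)) // sum1_card card_ord.
Qed.

Lemma count_geq a (k : 'I_n) v : increasing a -> (a k <= v)%N ->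
  (k < \sum_(l < n) (a l <= v)%N)%N.
Proof.
move=> aI av; rewrite -[X in (X < _)%N]/(k : nat) -[X in (X <= _)%N](sum_ltn_ord (ltn_ord k)).
apply: leq_sum => l _; case: (ltnP l k.+1) => // lk.
by rewrite (leq_trans (increasing_leq aI lk) av).
Qed.

Lemma count_leq a (k : 'I_n) v : increasing a -> (v < a k)%N ->
  (\sum_(l < n) (a l <= v)%N <= k)%N.
Proof.
move=> aI av; rewrite -[X in (_ <= X)%N](sum_ltn_ord (ltnW (ltn_ord k))).
apply: leq_sum => l _; case: (ltnP l k) => [_|kl]; first exact: leq_b1.
by rewrite [(a l <= v)%N]leqNgt (leq_trans av (increasing_leq aI kl)).
Qed.

(** For an increasing tuple, entry [k] is at most [v] exactly when more than [k] entries are; the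
    counting functions therefore determine the componentwise order. *)
Lemma count_col_le a e : increasing a -> increasing e ->
  (forall v : nat, \sum_(l < n) (a l <= v) <= \sum_(l < n) (e l <= v))%N -> col_le e a.
Proof.
move=> aI eI H; apply/col_leP => k; rewrite leqNgt; apply/negP => ek.
have := leq_trans (count_geq aI (leqnn (a k))) (H (a k)).
by rewrite ltnNge (count_leq eI ek).
Qed.

Lemma increasing_perm_eq a e : increasing a -> increasing e ->
  perm_eq (codom e) (codom a) -> e = a.
Proof.
move=> aI eI /perm_sumP H; apply: col_le_anti; apply: count_col_le => // v;
  by have := H (fun x => (x <= v)%N : nat); rewrite !sum_codom => ->.
Qed.

Lemma increasing_meet a b : increasing a -> increasing b -> increasing (col_meet a b).
Proof.
move=> /increasingP aI /increasingP bI; apply/increasingP => k l kl; rewrite !ffunE.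
have := aI _ _ kl; have := bI _ _ kl; rewrite !minEle !leEord.
by do 2!case: ifP => ?; lia.
Qed.

Lemma increasing_join a b : increasing a -> increasing b -> increasing (col_join a b).
Proof.
move=> /increasingP aI /increasingP bI; apply/increasingP => k l kl; rewrite !ffunE.
have := aI _ _ kl; have := bI _ _ kl; rewrite !maxEle !leEord.
by do 2!case: ifP => ?; lia.
Qed.

Lemma meet_join_sum a b (F : 'I_n -> 'I_m -> nat) :
  (\sum_k F k (col_meet a b k) + \sum_k F k (col_join a b k) =
   \sum_k F k (a k) + \sum_k F k (b k))%N.
Proof.
rewrite -!big_split /=; apply: eq_bigr => k _; rewrite !ffunE minEle maxEle.
by case: ifP => _; rewrite // addnC.
Qed.

Lemma col_meet_le a b : col_le (col_meet a b) a /\ col_le (col_meet a b) b.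
Proof.
by split; apply/col_leP => k; rewrite ffunE minEle leEord; case: ifP => ?; lia.
Qed.

Lemma col_join_ge a b : col_le a (col_join a b) /\ col_le b (col_join a b).
Proof.
by split; apply/col_leP => k; rewrite ffunE maxEle leEord; case: ifP => ?; lia.
Qed.

End ColumnIndices.

(** The easy half of the Frobenius-König theorem: a permutation cannot map [P] into the complement
    of [Q], which is too small, so every term of the Leibniz formula has a factor in the zero
    block. *)
Lemma det_zero_block (A : comNzRingType) N (M : 'M[A]_N) (P Q : {set 'I_N}) :
  (forall i j, i \in P -> j \in Q -> M i j = 0) -> (N < #|P| + #|Q|)%N -> \det M = 0.
Proof.
move=> M0 PQ; rewrite /determinant big1 // => s _.
have [i iP siQ] : exists2 i, i \in P & s i \in Q.
  apply/exists_inP; apply: contraLR PQ; rewrite negb_exists_in => /forall_inP H.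
  rewrite -leqNgt -[N in (_ <= N)%N]card_ord -cardsT -(setUCr Q) -[#|P|](card_imset _ (@perm_inj _ s)).
  rewrite cardsU setICr cards0 subn0 addnC leq_add2l; apply/subset_leq_card/subsetP => _ /imsetP[i /H iP ->].
  by rewrite inE.
by rewrite (bigD1 i) //= M0 // mul0r mulr0.
Qed.

Lemma det_rowsum (A : comNzRingType) N (U V : 'M[A]_N) :
  \det (U + V) = \sum_(S : {set 'I_N}) \det (\matrix_(i, j) if i \in S then U i j else V i j).
Proof.
rewrite /determinant exchange_big /=; apply: eq_bigr => s _; rewrite -mulr_sumr; congr (_ * _).
under eq_bigr do rewrite mxE; rewrite bigA_distr /=; apply: eq_bigr => S _.
by apply: eq_bigr => i _; rewrite mxE.
Qed.

(** The integer is 0 for a repeated column and the sign of the sorting permutation otherwise. It is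
    chosen before the ring and the matrix, which keeps the later identities universal. *)
Lemma maxminor_sort n m (e : colidx n m) : exists (k : int) (e' : colidx n m),
  (k != 0 -> increasing e' /\ perm_eq (codom e') (codom e)) /\
  forall (A : comNzRingType) (X : 'M[A]_(n, m)), maxminor X e = maxminor X e' *~ k.
Proof.
case: (boolP (injectiveb e)) => [/injectiveP eI|/injectivePn[k1 [k2 k12 ek]]]; last first.
  exists 0, e; split=> // A X; rewrite /maxminor mulr0z -det_tr.
  by apply: (determinant_alternate k12) => k; rewrite !mxE ek.
have sz : size (sort (relpre val leq) (codom e)) == n by rewrite size_sort size_codom card_ord.
set t := Tuple sz; pose e' : colidx n m := [ffun k => tnth t k].
have te : perm_eq t (codom e) by rewrite perm_sort.
have [p pE] : exists p : 'S_n, codom e = [tuple tnth t (p i) | i < n].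
  by apply/tuple_permP; rewrite perm_sym.
have epE k : e k = e' (p k).
  by move: pE; rewrite codomE /= => /eq_in_map/(_ k); rewrite mem_enum ffunE; apply.
exists ((-1) ^+ p), e'; split=> [_|A X]; last first.
  have -> : maxminor X e = \det (col_perm p (colsub e' X)).
    by congr (\det _); apply/matrixP => i j; rewrite !mxE epE.
  by rewrite col_permE det_mulmx det_perm odd_permV -mulrzr rmorphXn rmorphN1.
split.
  apply/increasingP => k l kl; rewrite !ffunE.
  have srt : sorted ltn (map val t).
    rewrite ltn_sorted_uniq_leq map_inj_uniq; last exact: val_inj.
    rewrite (perm_uniq te) sorted_map; apply/andP; split; last by apply: sort_sorted => x y; exact: leq_total.
    by rewrite codomE map_inj_uniq ?enum_uniq.
  have := sorted_ltn_nth ltn_trans 0%N srt; move/(_ k l).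
  rewrite !inE size_map (eqP sz) !ltn_ord => /(_ isT isT kl).
  by rewrite !(nth_map (e k)) ?(eqP sz) // -!(tnth_nth _ t).
suff -> : codom e' = t by [].
by rewrite codomE (eq_map (ffunE _)) map_tnth_enum.
Qed.


Lemma enum_set_inj N n (S : {set 'I_N}) : #|S| = n -> exists f : 'I_n -> 'I_N,
  [/\ injective f, forall k, f k \in S & forall F : 'I_N -> nat, (\sum_k F (f k) = \sum_(q in S) F q)%N].
Proof.
move<-; exists enum_val; split=> [||F]; [exact: enum_val_inj|exact: enum_valP|].
by rewrite [RHS]big_enum_val.
Qed.

(** * Exchange relations between products of maximal minors *)

Section Exchange.
Variables (n m : nat) (a b : colidx n m) (i0 : 'I_n).
Hypotheses (aI : increasing a) (bI : increasing b) (ba : (b i0 < a i0)%N).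

(** Rows of a [2n x 2n] matrix are indexed by the columns of [a] followed by those of [b]. The left
    half keeps all of [a] and [b_k] for [k <= i0]; the right half keeps all of [b] and [a_k] for
    [k >= i0]. The rows kept in both halves are [b_0, ..., b_i0, a_i0, ..., a_(n-1)], the [n + 1]
    columns of a classical Plücker exchange. *)
Let z (q : 'I_(n + n)) : 'I_m := match split q with inl k => a k | inr k => b k end.
Let top (q : 'I_(n + n)) : bool := if split q is inr k then (k <= i0)%N else true.
Let bot (q : 'I_(n + n)) : bool := if split q is inl k then (i0 <= k)%N else true.
Let S0 : {set 'I_(n + n)} := [set q | if split q is inl _ then true else false].

Let splitl (k : 'I_n) : split (lshift n k) = inl k.
Proof. exact: (unsplitK (inl k)). Qed.
Let splitr (k : 'I_n) : split (rshift n k) = inr k.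
Proof. exact: (unsplitK (inr k)). Qed.

Let card_inl : #|S0| = n.
Proof.
rewrite -sum1dep_card big_mkcond big_split_ord /= [X in (_ + X)%N]big1 ?addn0 => [|k _].
  by rewrite (eq_bigr (fun=> 1%N)) ?sum1_card ?card_ord // => k _; rewrite splitl.
by rewrite splitr.
Qed.

Let card_inr : #|[set q : 'I_(n + n) | if split q is inr _ then true else false]| = n.
Proof.
rewrite -sum1dep_card big_mkcond big_split_ord /= big1 ?add0n => [|k _].
  by rewrite (eq_bigr (fun=> 1%N)) ?sum1_card ?card_ord // => k _; rewrite splitr.
by rewrite splitl.
Qed.

Section Matrix.
Variables (A : comNzRingType) (X : 'M[A]_(n, m)).

Let P : 'M[A]_(n + n, n) := \matrix_(q, i) if top q then X i (z q) else 0.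
Let Q : 'M[A]_(n + n, n) := \matrix_(q, i) if bot q then X i (z q) else 0.

Definition exchange_mx (S : {set 'I_(n + n)}) : 'M[A]_(n + n) :=
  \matrix_(q, j) if q \in S then row_mx P 0 q j else row_mx 0 Q q j.

(* The sum is the expansion of [\det (row_mx P Q)] along the splitting of each
   row into its two halves.  The [n + 1] rows [q] with [top q && bot q] have
   equal halves, so that subtracting the left half from the right one leaves
   [n] columns with at most [n - 1] nonzero rows. *)
Lemma det_exchange_sum : \sum_S \det (exchange_mx S) = 0.
Proof.
rewrite -det_rowsum add_row_mx addr0 add0r.
have <- : \det (row_mx P Q *m block_mx 1%:M (- 1%:M) 0 1%:M) = \det (row_mx P Q).
  by rewrite det_mulmx det_ublock !det1 !mulr1.
rewrite mul_row_block !mulmx1 mulmx0 addr0 mulmxN mulmx1.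
apply: (@det_zero_block _ _ _ [set q | top q && bot q] [set q | if split q is inr _ then true else false]).
  move=> q j; rewrite !inE => /andP[tq bq].
  case: (splitP j) => // k jk _; have -> : j = rshift n k by apply: val_inj.
  by rewrite row_mxEr !mxE tq bq addNr.
rewrite card_inr addnC ltn_add2l -sum1dep_card big_mkcond big_split_ord /= -big_split /=.
rewrite (eq_bigr (fun k : 'I_n => (1 + (k == i0))%N)) => [|k _].
  by rewrite big_split /= sum1_card card_ord -addn1 leq_add2l (bigD1 i0) //= eqxx.
rewrite /top /bot splitl splitr andbT /= -(inj_eq val_inj) /=.
by case: (ltngtP i0 k).
Qed.

Lemma det_exchange_row (S : {set 'I_(n + n)}) q :
  (if q \in S then ~~ top q else ~~ bot q) -> \det (exchange_mx S) = 0.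
Proof.
move=> qS; apply: (@det_zero_block _ _ _ [set q] setT); last first.
  by rewrite cards1 cardsT card_ord.
move=> _ j /set1P -> _; rewrite mxE; case: ifP qS => qS qN; rewrite !mxE.
  by case: (split j) => k; rewrite mxE // (negPf qN).
by case: (split j) => k; rewrite mxE // (negPf qN).
Qed.

(** Rows in [S] live in the left [n] columns and the others in the right ones; unless both groups
    have [n] rows, one of them is too large for its columns. *)
Lemma det_exchange_card (S : {set 'I_(n + n)}) : #|S| != n -> \det (exchange_mx S) = 0.
Proof.
rewrite neq_ltn => /orP[Sn|nS].
  apply: (@det_zero_block _ _ _ (~: S) [set q | if split q is inl _ then true else false]).
    move=> q j; rewrite !inE mxE => /negPf ->; rewrite mxE.
    by case: (split j) => // k _; rewrite mxE.
  rewrite card_inl cardsCs setCK card_ord; lia.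
apply: (@det_zero_block _ _ _ S [set q | if split q is inr _ then true else false]).
  move=> q j; rewrite !inE mxE => ->; rewrite mxE.
  by case: (split j) => // k _; rewrite mxE.
by rewrite card_inr; lia.
Qed.

Lemma det_exchange_diag : \det (exchange_mx S0) = maxminor X a * maxminor X b.
Proof.
rewrite /maxminor -(det_tr (colsub a X)) -(det_tr (colsub b X)) -(@det_ublock _ _ _ _ 0).
congr (\det _); apply/matrixP => i j; rewrite !mxE inE.
case E: (split i) => [k|k]; rewrite !mxE; case: (split j) => l; rewrite !mxE /top /bot /z ?E //.
Qed.

End Matrix.

(** Listing the rows of [S] first makes the matrix block diagonal. The sign is that of this
    rearrangement, so it depends only on the enumerations [f] and [f']. *)
Lemma det_exchange_blocks (S : {set 'I_(n + n)}) (f f' : 'I_n -> 'I_(n + n)) :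
  (forall q, if q \in S then top q else bot q) ->
  injective f -> injective f' -> (forall k, f k \in S) -> (forall k, f' k \notin S) ->
  exists s : bool, forall e g : colidx n m,
    (forall k, e k = z (f k)) -> (forall k, g k = z (f' k)) ->
  forall (A : comNzRingType) (X : 'M[A]_(n, m)),
  \det (exchange_mx X S) = maxminor X e * maxminor X g *~ (-1) ^+ s.
Proof.
move=> Sok fI f'I fS f'S.
pose h q := match split q with inl k => f k | inr k => f' k end.
have hI : injective h.
  move=> q q'; rewrite /h -[q]splitK -[q']splitK !unsplitK.
  case: (split q) (split q') => k [] k' => [/fI -> //|e|e|/f'I -> //].
    by have := f'S k'; rewrite -e fS.
  by have := f'S k; rewrite e fS.
exists (perm hI : bool) => e g eE gE A X.
have -> : maxminor X e * maxminor X g = \det (row_perm (perm hI) (exchange_mx X S)).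
  rewrite /maxminor -(det_tr (colsub e X)) -(det_tr (colsub g X)) -(@det_ublock _ _ _ _ 0).
  congr (\det _); apply/matrixP => i j; rewrite !mxE permE /h.
  case: (splitP i) => k ik; rewrite mxE.
    rewrite fS; case: (split j) => l; rewrite !mxE //.
    by have := Sok (f k); rewrite fS => ->; rewrite eE.
  rewrite (negPf (f'S k)); case: (split j) => l; rewrite !mxE //.
  by have := Sok (f' k); rewrite (negPf (f'S k)) => ->; rewrite gE.
by rewrite row_permE det_mulmx det_perm -mulrzr rmorphXn rmorphN1 mulrAC -expr2 sqrr_sign mul1r.
Qed.


(** Going from [S0] to [S] replaces some [a_k] with [k >= i0] by equally many [b_k] with [k <= i0].
    Every entering column is at most [b_i0], every leaving one at least [a_i0], and [b_i0 < a_i0].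
    The counts give the bound by [a], the strict drop of the sum drives the induction of the
    straightening. *)
Lemma exchange_dominated (S : {set 'I_(n + n)}) :
  (forall q, if q \in S then top q else bot q) -> #|S| = n -> S != S0 ->
  (forall v : nat, \sum_(q in S0) (z q <= v) <= \sum_(q in S) (z q <= v))%N /\
  (\sum_(q in S) z q < \sum_(q in S0) z q)%N.
Proof.
move=> Sok Sn SS0.
have DD : #|S :\: S0| = #|S0 :\: S|.
  by apply/eqP; rewrite -(eqn_add2l #|S :&: S0|) cardsID setIC cardsID Sn card_inl.
have D0 : (0 < #|S :\: S0|)%N.
  rewrite lt0n; apply: contraNneq SS0 => D0; rewrite eqEsubset -!setD_eq0 -!cards_eq0.
  by rewrite -DD D0.
have zD q : q \in S :\: S0 -> (z q <= b i0)%N.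
  rewrite !inE => /andP[+ qS]; have := Sok q; rewrite qS /top /z.
  by case: (split q) => // k ki0 _; exact: increasing_leq.
have zD' q : q \in S0 :\: S -> (a i0 <= z q)%N.
  rewrite !inE => /andP[qS]; have := Sok q; rewrite (negPf qS) /bot /z.
  by case: (split q) => // k ki0 _; exact: increasing_leq.
have splitS F : (\sum_(q in S) F q = \sum_(q in S :&: S0) F q + \sum_(q in S :\: S0) F q)%N.
  exact: big_setID.
have splitS0 F : (\sum_(q in S0) F q = \sum_(q in S :&: S0) F q + \sum_(q in S0 :\: S) F q)%N.
  by rewrite setIC; exact: big_setID.
split=> [v|]; rewrite splitS splitS0 ?leq_add2l ?ltn_add2l.
  case: (leqP (b i0) v) => [bv|vb].
    rewrite [X in (_ <= X)%N](eq_bigr (fun=> 1%N)) => [|q /zD qb]; last by rewrite (leq_trans qb).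
    by rewrite sum1_card DD -sum1_card; apply: leq_sum => q _; exact: leq_b1.
  rewrite big1 // => q /zD' qa; apply/eqP; rewrite eqb0 -ltnNge.
  exact: leq_trans (ltn_trans vb ba) qa.
apply: (@leq_ltn_trans (#|S :\: S0| * b i0)%N); first by rewrite -sum_nat_const; exact: leq_sum.
apply: (@leq_trans (#|S0 :\: S| * a i0)%N); first by rewrite -DD ltn_pmul2l.
by rewrite -sum_nat_const; exact: leq_sum.
Qed.

Lemma sum_z (F : 'I_m -> nat) : (\sum_q F (z q) = \sum_k F (a k) + \sum_k F (b k))%N.
Proof.
by rewrite big_split_ord /=; congr (_ + _)%N; apply: eq_bigr => k _; rewrite /z (splitl, splitr).
Qed.

Lemma sum_z0 (F : 'I_m -> nat) : (\sum_(q in S0) F (z q) = \sum_k F (a k))%N.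
Proof.
rewrite big_mkcond big_split_ord /= [X in (_ + X)%N]big1 ?addn0 => [|k _].
  by apply: eq_bigr => k _; rewrite inE /z splitl.
by rewrite inE splitr.
Qed.

(** Coefficient and pair are bundled into one existential so that finite choice over all [S]
    applies; vanishing determinants receive the coefficient 0 and the dummy pair [(a, b)]. *)
Lemma exchange_term (S : {set 'I_(n + n)}) : exists t : int * (colidx n m * colidx n m),
  (S != S0 -> t.1 != 0 -> [/\ increasing t.2.1, increasing t.2.2, col_le t.2.1 a,
     (\sum_k t.2.1 k < \sum_k a k)%N & perm_eq (codom t.2.1 ++ codom t.2.2) (codom a ++ codom b)]) /\
  forall (A : comNzRingType) (X : 'M[A]_(n, m)),
    \det (exchange_mx X S) = maxminor X t.2.1 * maxminor X t.2.2 *~ t.1.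
Proof.
have zero : (forall (A : comNzRingType) (X : 'M[A]_(n, m)), \det (exchange_mx X S) = 0) ->
  exists t : int * (colidx n m * colidx n m),
  (S != S0 -> t.1 != 0 -> [/\ increasing t.2.1, increasing t.2.2, col_le t.2.1 a,
     (\sum_k t.2.1 k < \sum_k a k)%N & perm_eq (codom t.2.1 ++ codom t.2.2) (codom a ++ codom b)]) /\
  forall (A : comNzRingType) (X : 'M[A]_(n, m)),
    \det (exchange_mx X S) = maxminor X t.2.1 * maxminor X t.2.2 *~ t.1.
  by move=> H; exists (0, (a, b)); split=> //= A X; rewrite H mulr0z.
case: (boolP [forall q, if q \in S then top q else bot q]) => [/forallP Sok|]; last first.
  rewrite negb_forall => /existsP[q qS]; apply: zero => A X.
  apply: (@det_exchange_row A X S q); by case: ifP qS.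
case: (eqVneq #|S| n) => [Sn|SN]; last by apply: zero => A X; exact: det_exchange_card.
have CSn : #|~: S| = n by rewrite cardsCs setCK card_ord Sn; lia.
have [f [fI fS fE]] := enum_set_inj Sn; have [f' [f'I f'S f'E]] := enum_set_inj CSn.
have {}f'S k : f' k \notin S by have := f'S k; rewrite inE.
pose e : colidx n m := [ffun k => z (f k)]; pose g : colidx n m := [ffun k => z (f' k)].
have eE (F : 'I_m -> nat) : (\sum_k F (e k) = \sum_(q in S) F (z q))%N.
  by rewrite -(fE (fun q => F (z q))); apply: eq_bigr => k _; rewrite ffunE.
have gE (F : 'I_m -> nat) : (\sum_k F (g k) = \sum_(q in ~: S) F (z q))%N.
  by rewrite -(f'E (fun q => F (z q))); apply: eq_bigr => k _; rewrite ffunE.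
have [ke [e' [e'P e'E]]] := maxminor_sort e; have [kg [g' [g'P g'E]]] := maxminor_sort g.
have [s /(_ e g (fun k => ffunE _ k) (fun k => ffunE _ k)) sE] := det_exchange_blocks Sok fI f'I fS f'S.
exists (ke * kg * (-1) ^+ s, (e', g')); split=> /= [SS0|A X]; last first.
  by rewrite sE e'E g'E mulrzAl mulrzAr -!mulrzA; congr (_ *~ _); ring.
rewrite !mulf_eq0 !negb_or => /andP[/andP[/e'P[e'I e'p] /g'P[g'I g'p]] _].
have e'S (F : 'I_m -> nat) : (\sum_k F (e' k) = \sum_(q in S) F (z q))%N.
  by rewrite -eE -!sum_codom; have /perm_sumP := e'p; apply.
have g'S (F : 'I_m -> nat) : (\sum_k F (g' k) = \sum_(q in ~: S) F (z q))%N.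
  by rewrite -gE -!sum_codom; have /perm_sumP := g'p; apply.
have [dom lt] := exchange_dominated Sok Sn SS0; split=> //.
- apply: count_col_le => // v; rewrite (e'S (fun x => x <= v)%N) -(sum_z0 (fun x => x <= v)%N).
  exact: dom.
- by rewrite (e'S val) -(sum_z0 val).
- apply/content_sumP => F; rewrite e'S g'S -sum_z [RHS](bigID [in S]) /=; congr (_ + _)%N.
  by apply: eq_bigl => q; rewrite inE.
Qed.

Lemma exchange : exists t : {set 'I_(n + n)} -> int * (colidx n m * colidx n m),
  (forall S, (t S).1 != 0 -> [/\ increasing (t S).2.1, increasing (t S).2.2, col_le (t S).2.1 a,
     (\sum_k (t S).2.1 k < \sum_k a k)%N &
     perm_eq (codom (t S).2.1 ++ codom (t S).2.2) (codom a ++ codom b)]) /\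
  forall (A : comNzRingType) (X : 'M[A]_(n, m)),
    maxminor X a * maxminor X b = \sum_S maxminor X (t S).2.1 * maxminor X (t S).2.2 *~ (t S).1.
Proof.
have [t tP] := fin_all_exists exchange_term.
(* The term of [S0] is the product to be rewritten: it moves to the other side, which cancels it
   here and negates the rest. *)
exists (fun S => if S == S0 then (0, (a, b)) else (- (t S).1, (t S).2)); split=> [S|A X].
  have [H _] := tP S; case: (eqVneq S S0) H => //= SS0 H k0; apply: H => //.
  by apply: contraNneq k0 => ->.
apply/eqP; rewrite -subr_eq0; apply/eqP.
rewrite -det_exchange_diag -[RHS](det_exchange_sum X) [RHS](bigD1 S0) //=; congr (_ + _).
rewrite (bigD1 S0) //= eqxx mulr0z add0r -sumrN; apply: eq_bigr => S SS0.
by rewrite (negPf SS0) /= mulrNz opprK; have [_ ->] := tP S.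
Qed.

End Exchange.

(** Induction on the sum of the entries of the first factor. An exchange controls the first factor
    only, so the bound obtained here is by [a] and not yet by the meet. *)
Lemma straighten_left n m (a b : colidx n m) : increasing a -> increasing b ->
  exists mu : colidx n m * colidx n m -> int,
  (forall t, mu t != 0 -> [/\ increasing t.1, increasing t.2, col_le t.1 t.2, col_le t.1 a &
     perm_eq (codom t.1 ++ codom t.2) (codom a ++ codom b)]) /\
  forall (A : comNzRingType) (X : 'M[A]_(n, m)),
    maxminor X a * maxminor X b = \sum_t maxminor X t.1 * maxminor X t.2 *~ mu t.
Proof.
have [k] := ubnP (\sum_i (a i : nat))%N; elim: k a b => // k IHk a b ak aI bI.
case: (boolP (col_le a b)) => [ab|].
  exists (fun t => (t == (a, b))%:R); split=> [t|A X].
    by case: (eqVneq t (a, b)) => [->|]; rewrite ?eqxx // => _; split=> //=; apply/col_leP.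
  by rewrite (bigD1 (a, b)) //= eqxx big1 ?addr0 // => t /negPf ->.
rewrite negb_forall => /existsP[i0]; rewrite -ltnNge => ba.
have [t [tP tE]] := exchange aI bI ba.
have /fin_all_exists[mu muP] : forall S, exists mu : colidx n m * colidx n m -> int,
    (forall u, mu u != 0 -> [/\ increasing u.1, increasing u.2, col_le u.1 u.2, col_le u.1 a &
      perm_eq (codom u.1 ++ codom u.2) (codom a ++ codom b)]) /\
    forall (A : comNzRingType) (X : 'M[A]_(n, m)),
    maxminor X (t S).2.1 * maxminor X (t S).2.2 *~ (t S).1 = \sum_u maxminor X u.1 * maxminor X u.2 *~ mu u.
  move=> S; case: (eqVneq (t S).1 0) => [->|t0].
    by exists (fun=> 0); split=> [u|A X]; rewrite ?eqxx // big1 // => u _; rewrite mulr0z.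
  have [eI gI ea lt pE] := tP _ t0.
  have [|mu [muP muE]] := IHk _ _ _ eI gI; first by rewrite -ltnS; apply: leq_trans ak.
  exists (fun u => mu u * (t S).1); split=> [u|A X]; last first.
    by rewrite muE mulrz_suml; apply: eq_bigr => u _; rewrite mulrzA.
  rewrite mulf_eq0 negb_or => /andP[/muP[H1 H2 H3 H4 H5] _]; split=> //.
    exact: col_le_trans ea.
  exact: perm_trans pE.
exists (fun u => \sum_S mu S u); split=> [u mu0|A X].
  have [S mS] : exists S, mu S u != 0.
    apply/existsP; apply: contraR mu0; rewrite negb_exists => /forallP mu0.
    by rewrite big1 // => S _; apply/eqP; have := mu0 S; rewrite negbK.
  by have [H _] := muP S; exact: H.
rewrite tE (eq_bigr _ (fun S _ => (muP S).2 A X)) exchange_big /=.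
by apply: eq_bigr => u _; rewrite -mulrz_sumr.
Qed.

(** * Initial monomials of the minors of a ladder matrix *)

Lemma monomial_order_lex (V : finType) (gt : rel V) (rk : V -> nat) :
  (forall x y, gt x y = (rk x < rk y)%N) -> injective rk -> monomial_order (lex_le gt).
Proof.
move=> gtE rkI; apply: monomial_orderI.
- exact: lex_cmp_order gtE rkI.
- by move=> u v uv vu; exact: (lex_le_anti gtE rkI uv vu).
- by move=> u; exact: lex_le_min gtE rkI u.
Qed.

Lemma prod_ucmE (V : finType) (f : V -> nat) x :
  (\big[mmul/mone]_y expcmn (ucm y) (f y)) x = f x.
Proof.
rewrite mprodE (eq_bigr (fun y => if y == x then f y else 0%N)) => [|y _].
  by rewrite -big_mkcond big_pred1_eq.
by rewrite expcmnE cmU; case: (y == x); rewrite (muln1, muln0).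
Qed.

Section LadderOrders.
Variables (n m : nat) (L : {set 'I_n * 'I_m}).

Definition xrank (x : xvar L) : nat := (val x).1 * m + (val x).2.

Lemma xrankE (x y : xvar L) : (((val x).1 < (val y).1)%N ||
  ((val x).1 == (val y).1) && ((val x).2 < (val y).2)%N) = (xrank x < xrank y)%N.
Proof.
rewrite /xrank; case: (val x) (val y) => i j [i' j'] /=.
have := ltn_ord j; have := ltn_ord j' => jm jm'; rewrite -(inj_eq val_inj) /=.
case: (ltngtP i i') => [ii'|ii'|->] /=; rewrite ?ltn_add2l //; apply/esym.
  have : (i.+1 * m <= i' * m)%N by rewrite leq_mul2r ii' orbT.
  by rewrite mulSn; lia.
have : (i'.+1 * m <= i * m)%N by rewrite leq_mul2r ii' orbT.
by rewrite mulSn; lia.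
Qed.

Lemma xrank_inj : injective xrank.
Proof.
move=> x y xy; have := xrankE x y; have := xrankE y x; rewrite xy ltnn.
move=> /negbT yx /negbT xy'; apply: val_inj; move: (val x) (val y) xy' yx => [i j] [i' j'] /=.
rewrite !negb_or !negb_and -!leqNgt => /andP[ii' jj'] /andP[i'i j'j].
have ii : i = i' by apply/val_inj/anti_leq; rewrite ii' i'i.
subst i'; rewrite eqxx /= in jj' j'j.
by congr (_, _); apply/val_inj/anti_leq; rewrite jj' j'j.
Qed.

Lemma tau_order : monomial_order (tau : rel {cmonom xvar L}).
Proof. exact: monomial_order_lex xrankE xrank_inj. Qed.

Lemma tau_ltI (u v : {cmonom xvar L}) x :
  (u x < v x)%N -> (forall y, (xrank y < xrank x)%N -> u y = v y) -> tau u v /\ u != v.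
Proof.
move=> ux uvx; split; last by apply: contraTneq ux => ->; rewrite ltnn.
by apply: (lex_leI ux) => y; rewrite xrankE; exact: uvx.
Qed.

Variable r : nat.

Lemma xpartE (w : {cmonom xtvar L r}) x : xpart w x = w (inl x).
Proof. exact: prod_ucmE. Qed.

Lemma tpartE (w : {cmonom xtvar L r}) i : tpart w i = w (inr i).
Proof. exact: prod_ucmE. Qed.

Lemma xpartM : {morph @xpart n m L r : u v / u ** v >-> u ** v}.
Proof. by move=> u v; apply: cmonomP => x; rewrite cmM !xpartE cmM. Qed.

Lemma tpartM : {morph @tpart n m L r : u v / u ** v >-> u ** v}.
Proof. by move=> u v; apply: cmonomP => x; rewrite cmM !tpartE cmM. Qed.

Lemma xtpart_inj (u v : {cmonom xtvar L r}) : xpart u = xpart v -> tpart u = tpart v -> u = v.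
Proof.
move=> xE tE; apply: cmonomP => -[x|i]; first by rewrite -!xpartE xE.
by rewrite -!tpartE tE.
Qed.

(** The rank decreases with the index because the reverse lexicographic comparison starts from the
    last [t]. *)
Lemma tgtE (i j : 'I_r) : (j < i)%N = (r - i < r - j)%N.
Proof. by have := ltn_ord i; have := ltn_ord j; lia. Qed.

Lemma trank_inj : injective (fun i : 'I_r => (r - i)%N).
Proof. by move=> i j; have := ltn_ord i; have := ltn_ord j => ? ? ?; apply: val_inj => /=; lia. Qed.

Let tdelta : rel {cmonom 'I_r} := grevlex_le (fun i j : 'I_r => (i < j)%N).

Let tdelta_anti u v : tdelta u v -> tdelta v u -> u = v.
Proof. by move=> uv vu; exact: (grevlex_anti tgtE trank_inj uv vu). Qed.

(** Antisymmetry of the order on the [t]-parts turns the case distinction on their equality into a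
    lexicographic composition of preorders. *)
Lemma tau'E (u v : {cmonom xtvar L r}) : tau' u v =
  lex_comp (fun u v => tdelta (tpart u) (tpart v)) (fun u v => tau (xpart u) (xpart v)) u v.
Proof.
rewrite /tau' /lex_comp -/tdelta; case: eqP => [->|uv].
  by have [tot _ _] := grevlex_cmp_order tgtE trank_inj; have := tot (tpart v) (tpart v);
    rewrite orbb -/tdelta => ->.
case: (boolP (tdelta (tpart u) (tpart v))) => //= H.
by case: (boolP (tdelta _ _)) => //= H'; case: uv; apply: tdelta_anti.
Qed.

Lemma tau'_order : monomial_order (tau' : rel {cmonom xtvar L r}).
Proof.
have cmp_tau : cmp_order (tau : rel {cmonom xvar L}) := monomial_order_cmp tau_order.
apply: monomial_orderI.
- apply: eq_cmp_order (fun u v => esym (tau'E u v)) _; apply: cmp_order_lex.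
    exact: cmp_order_pull tpartM (grevlex_cmp_order tgtE trank_inj).
  exact: cmp_order_pull xpartM cmp_tau.
- move=> u v; rewrite !tau'E /lex_comp => /andP[uv uv'] /andP[vu vu'].
  have [[_ anti _] _] := tau_order.
  apply: xtpart_inj; last exact: tdelta_anti.
  by apply: anti; rewrite (implyP uv') // (implyP vu').
- move=> u; rewrite tau'E /lex_comp.
  have -> : tpart (mone : {cmonom xtvar L r}) = mone by apply: cmonomP => i; rewrite tpartE !cm1.
  have -> : xpart (mone : {cmonom xtvar L r}) = mone by apply: cmonomP => i; rewrite xpartE !cm1.
  have [_ [-> _]] := tau_order; rewrite implybT andbT; exact: grevlex_min.
Qed.

End LadderOrders.

Lemma card_ltn_ord n k : (k <= n)%N -> #|[set l : 'I_n | l < k]%N| = k.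
Proof.
move=> kn; rewrite -[RHS](sum_ltn_ord kn) -sum1dep_card big_mkcond.
by apply: eq_bigr => l _; case: ifP.
Qed.

Section Diagonals.
Variables (n m : nat) (L : {set 'I_n * 'I_m}).

(* Omitting the factors outside the ladder makes [rowmonE] unconditional. *)
Definition rowmon (e : 'I_n -> 'I_m) : {cmonom xvar L} :=
  \big[mmul/mone]_i (if insub (i, e i) is Some x then ucm x else mone).

Lemma rowmonE e (x : xvar L) : rowmon e x = (e (val x).1 == (val x).2).
Proof.
rewrite mprodE (bigD1 (val x).1) //= big1 ?addn0 => [|i ix].
  case: insubP => [y yL yE|yL].
    rewrite cmU -(inj_eq val_inj) yE; congr nat_of_bool.
    by apply/eqP/eqP => [<- //|->]; rewrite -surjective_pairing.
  by rewrite cm1; case: eqP yL => // -> ; rewrite -surjective_pairing (valP x).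
case: insubP => [y yL yE|_]; last by rewrite cm1.
rewrite cmU -(inj_eq val_inj) yE; case: eqP => // e'.
by move: ix; rewrite -e' eqxx.
Qed.

Definition in_ladder (e : 'I_n -> 'I_m) : bool := [forall i, (i, e i) \in L].

Lemma mdeg_rowmon e : in_ladder e -> mdeg (rowmon e) = n.
Proof.
move=> /forallP eL; rewrite /rowmon mdeg_prod.
rewrite (eq_bigr (fun=> 1%N)) ?sum1_card ?card_ord // => i _.
by case: insubP => [y _ _|]; rewrite ?eL // mdegU.
Qed.

Lemma prod_ladder_mx (K : fieldType) (e : 'I_n -> 'I_m) :
  \prod_i ladder_mx K L i (e i) = if in_ladder e then << rowmon e >> else 0.
Proof.
case: ifP => [/forallP eL|/negbT/forallPn[i eL]].
  rewrite mU_prod; apply: eq_bigr => i _.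
  by rewrite mxE; case: insubP => [y _ _|]; rewrite ?eL.
by rewrite (bigD1 i) //= mxE insubN // mul0r.
Qed.

Lemma lminor_sum (K : fieldType) (a : colidx n m) : lminor K L a =
  \sum_(s : 'S_n) (-1) ^+ s *: (if in_ladder (fun i => a (s i)) then << rowmon (fun i => a (s i)) >> else 0).
Proof.
apply: eq_bigr => s _; rewrite -prod_ladder_mx -mulr_algl; congr (_ * _).
  by rewrite -[RHS]/(in_alg _ _) rmorph_sign.
by apply: eq_bigr => i _; rewrite !mxE.
Qed.

(** Take the first moved index: smaller values are already taken by fixed points. In the Leibniz
    sum, row [i] of the term of [s] then uses the column [a_(s i) > a_i], so [x_(i,a_i)] is the
    variable that makes the diagonal larger. *)
Lemma perm_ltn_diag (s : 'S_n) : s != 1%g ->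
  exists i : 'I_n, (i < s i)%N /\ forall k : 'I_n, (k < i)%N -> s k = k.
Proof.
move=> s1; have [i0 si0] : exists i, s i != i.
  apply/existsP; apply: contraR s1; rewrite negb_exists => /forallP s1; apply/eqP/permP => i.
  by rewrite perm1; apply/eqP; have := s1 i; rewrite negbK.
case: (arg_minnP (P := fun i => s i != i) (fun i => i : nat) si0) => i si imin.
have sk (k : 'I_n) : (k < i)%N -> s k = k.
  by move=> ki; apply/eqP; apply: contraLR ki => /imin; rewrite -leqNgt.
exists i; split=> //; rewrite ltn_neqAle eq_sym si leqNgt; apply/negP => /sk.
by move/perm_inj => sii; rewrite sii eqxx in si.
Qed.

Lemma lminor_tail (K : fieldType) (a : colidx n m) : increasing a -> in_ladder a ->
  exists h, lminor K L a = << rowmon a >> + h /\ tail_of tau (rowmon a) h.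
Proof.
move=> /increasingP aI aL; rewrite lminor_sum (bigD1 (1%g : 'S_n)) //= perm.odd_perm1 scale1r.
have -> : in_ladder (fun i => a ((1%g : 'S_n) i)).
  by apply/forallP => i; rewrite perm1; exact: forallP aL i.
have -> : rowmon (fun i => a ((1%g : 'S_n) i)) = rowmon a.
  by apply: cmonomP => x; rewrite !rowmonE perm1.
eexists; split; first by []; apply: tail_of_sum => s /perm_ltn_diag[i [si sk]].
apply: tail_ofZ; case: ifP => [sL|_]; last exact: tail_of0.
have iL : (i, a i) \in L by exact: forallP aL i.
have [] // := @tau_ltI _ _ L (rowmon (fun i => a (s i))) (rowmon a) (exist _ (i, a i) iL).
- rewrite !rowmonE /= eqxx; case: eqP => // asi.
  by have := aI _ _ si; rewrite asi ltnn.
- case=> -[k l] kl; rewrite -xrankE !rowmonE /= => /orP[ki|/andP[/eqP -> li]]; first by rewrite sk.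
  have := aI _ _ si => asi; rewrite -!(inj_eq val_inj) /=.
  by rewrite !gtn_eqF // (ltn_trans li).
- by move=> lt ne; apply: tail_ofU => //; rewrite !mdeg_rowmon.
Qed.

Lemma inm_lminor (K : fieldType) (a : colidx n m) : increasing a -> in_ladder a ->
  lminor K L a != 0 /\ inm tau (lminor K L a) = rowmon a.
Proof. by move=> aI aL; have [h [-> hT]] := lminor_tail K aI aL; exact: (inm_tail (tau_order L)). Qed.

(* A transversal of the columns [a] inside the ladder can be uncrossed: some
   index [<= i] is sent to one [>= i] and conversely, and the ladder contains
   the rectangle between the two corresponding entries. *)
Lemma ladder_diag (K : fieldType) (a : colidx n m) : ladder L -> increasing a ->
  lminor K L a != 0 -> in_ladder a.
Proof.
move=> ladL aI a0; have [s sL] : exists s : 'S_n, in_ladder (fun i => a (s i)).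
  apply/existsP; apply: contraNT a0; rewrite negb_exists => /forallP sN.
  by rewrite lminor_sum big1 // => s _; rewrite (negPf (sN s)) scaler0.
apply/forallP => i.
(* Pigeonhole: [s] cannot map the [i + 1] indices up to [i] into the [i] indices below it. The dual
   count gives [k']. *)
have [k ki ik] : exists2 k : 'I_n, (k <= i)%N & (i <= s k)%N.
  apply/exists_inP; apply: contraT; rewrite negb_exists_in => /forall_inP H.
  have : (#|s @: [set k : 'I_n | k <= i]%N| <= #|[set k : 'I_n | k < i]%N|)%N.
    apply/subset_leq_card/subsetP => _ /imsetP[k + ->]; rewrite !inE => /H.
    by rewrite -ltnNge.
  rewrite card_imset; last exact: perm_inj.
  rewrite (card_ltn_ord (ltn_ord i)) (card_ltn_ord (ltnW (ltn_ord i))).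
  by rewrite ltnn.
have [k' ik' k'i] : exists2 k : 'I_n, (i <= k)%N & (s k <= i)%N.
  apply/exists_inP; apply: contraT; rewrite negb_exists_in => /forall_inP H.
  have : (#|s @: ~: [set j : 'I_n | j < i]%N| <= #|~: [set j : 'I_n | j <= i]%N|)%N.
    apply/subset_leq_card/subsetP => _ /imsetP[j + ->]; rewrite !inE -leqNgt => /H.
    by [].
  rewrite card_imset; last exact: perm_inj.
  rewrite -(leq_add2l #|[set k : 'I_n | k <= i]%N|) cardsC -(cardsC [set k : 'I_n | k < i]%N) leq_add2r.
  rewrite (card_ltn_ord (ltn_ord i)) (card_ltn_ord (ltnW (ltn_ord i))).
  by rewrite ltnn.
apply: (ladL k k' (a (s k)) (a (s k'))); rewrite ?(forallP sL) ?ki ?ik' //.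
- exact: leq_trans ik'.
- exact: leq_trans (increasing_leq aI k'i) (increasing_leq aI ik).
- by rewrite !increasing_leq.
Qed.

Lemma colsetE (K : fieldType) (a : colidx n m) : ladder L ->
  (a \in colset K L) = increasing a && in_ladder a.
Proof.
move=> ladL; rewrite inE; apply: andb_id2l => aI.
apply/idP/idP => [|aL]; first exact: ladder_diag.
by have [] := inm_lminor K aI aL.
Qed.

End Diagonals.

(** * Straightening below the meet *)

Lemma sum_deltaZ (R : nzRingType) (M : lmodType R) (I : finType) (P : pred I) (G : I -> M) i0 :
  P i0 -> \sum_(i | P i) (i == i0)%:R *: G i = G i0.
Proof.
move=> Pi0; rewrite (bigD1 i0) //= eqxx scale1r big1 ?addr0 // => i /andP[_ /negPf ->].
by rewrite scale0r.
Qed.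

Section Straightening.
Variables (n m : nat).
Implicit Types (a b c d e g : colidx n m).

(** The deciding variable is [x_(i,d_i)]: the rows before [i] agree, and in row [i] only [d_i] has
    been replaced, by a larger column. Only this variable has to belong to the ladder; the diagonals
    of [e] and [g] may leave it. *)
Lemma tau_row_pair_lt (L : {set 'I_n * 'I_m}) c d e g (i : 'I_n) :
  (i, d i) \in L -> (forall k : 'I_n, (k < i)%N -> e k = c k /\ g k = d k) -> e i = c i -> (d i < g i)%N ->
  tau (rowmon L e ** rowmon L g) (rowmon L c ** rowmon L d) /\
  rowmon L e ** rowmon L g != rowmon L c ** rowmon L d.
Proof.
move=> iL lti ei gi; apply: (@tau_ltI _ _ L _ _ (exist _ (i, d i) iL)).
  by rewrite !cmM !rowmonE /= ei eqxx ltn_add2l -(inj_eq val_inj) gtn_eqF.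
case=> -[k l] kl; rewrite -xrankE !cmM !rowmonE /= => /orP[ki|/andP[/eqP -> li]].
  by have [-> ->] := lti _ ki.
have -> : (d i == l) = false by rewrite -(inj_eq val_inj) gtn_eqF.
by rewrite ei -[g i == l](inj_eq val_inj) gtn_eqF // (ltn_trans li).
Qed.

Lemma rowmon_meet_join (L : {set 'I_n * 'I_m}) a b :
  rowmon L (col_meet a b) ** rowmon L (col_join a b) = rowmon L a ** rowmon L b.
Proof.
apply: cmonomP => x; rewrite !cmM !rowmonE !ffunE minEle maxEle.
by case: ifP => _; rewrite // addnC.
Qed.

Lemma content_meet_join a b :
  perm_eq (codom (col_meet a b) ++ codom (col_join a b)) (codom a ++ codom b).
Proof. by apply/content_sumP => F; exact: (meet_join_sum a b (fun _ x => F x)). Qed.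

(* If [e i < c i], count the entries [<= e i] of both pairs; if [g i < d i],
   count the entries [<= g i]. *)
Lemma standard_pair_first_diff c d e g :
  increasing c -> increasing d -> increasing e -> increasing g ->
  col_le c d -> col_le e c -> e != c ->
  perm_eq (codom e ++ codom g) (codom c ++ codom d) ->
  exists i : 'I_n, [/\ forall k : 'I_n, (k < i)%N -> e k = c k /\ g k = d k, e i = c i & (d i < g i)%N].
Proof.
move=> cI dI eI gI /col_leP cd /col_leP ec ne /content_sumP cont.
have [i0 i0P] : exists i, (e i != c i) || (g i != d i).
  apply/existsP; apply: contraR ne; rewrite negb_exists => /forallP H; apply/eqP/ffunP => i.
  by have := H i; rewrite negb_or negbK => /andP[/eqP].
case: (arg_minnP (P := fun i => (e i != c i) || (g i != d i)) (fun i => i : nat) i0P) => i iP imin.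
have lti (k : 'I_n) : (k < i)%N -> e k = c k /\ g k = d k.
  move=> ki; have : ~~ ((e k != c k) || (g k != d k)) by apply: contraL ki => /imin; rewrite -leqNgt.
  by rewrite negb_or !negbK => /andP[/eqP -> /eqP ->].
have cnt v : (\sum_k (e k <= v)%N + \sum_k (g k <= v)%N = \sum_k (c k <= v)%N + \sum_k (d k <= v)%N)%N.
  exact: (cont (fun x => (x <= v)%N : nat)).
have sum_ge (x y : colidx n m) (v : nat) : increasing y -> (v < y i)%N ->
    (forall k : 'I_n, (k < i)%N -> x k = y k) -> (\sum_k (y k <= v)%N <= \sum_k (x k <= v)%N)%N.
  move=> yI yv xy; apply: leq_sum => k _; case: (ltnP k i) => [/xy -> //|ik].
  by rewrite [(y k <= v)%N]leqNgt (leq_trans yv (increasing_leq yI ik)).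
have ei : e i = c i.
  apply/val_inj/anti_leq; rewrite ec /= leqNgt; apply/negP => eci.
  have h1 := count_geq eI (leqnn (e i)); have h2 := count_leq cI eci.
  have h3 : (\sum_k (d k <= e i)%N <= \sum_k (g k <= e i)%N)%N.
    by apply: sum_ge => // [|k /lti[]//]; exact: leq_trans eci (cd i).
  by have := leq_add (leq_ltn_trans h2 h1) h3; rewrite addSn -cnt ltnn.
exists i; split=> //; rewrite ltnNge; apply/negP => gdi.
have {}gdi : (g i < d i)%N.
  by move: iP; rewrite ei eqxx /= => gd; rewrite ltn_neqAle gd.
have h1 := count_geq gI (leqnn (g i)); have h2 := count_leq dI gdi.
have h3 : (\sum_k (c k <= g i)%N <= \sum_k (e k <= g i)%N)%N.
  by apply: leq_sum => k _; case: (leqP (c k) (g i)) => // ck; rewrite (leq_trans (ec k) ck).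
by have := leq_add (leq_ltn_trans h2 h1) h3; rewrite addSn addnC -cnt addnC ltnn.
Qed.

(** The product of the diagonals of [a] and [b] is that of their meet and join, and a vibration
    first departs from the latter by raising an entry of the join. This is why the join is the tuple
    required to lie in the ladder. *)
Lemma vibration_lt (L : {set 'I_n * 'I_m}) a b e g : increasing a -> increasing b ->
  vibration a b e g -> in_ladder L (col_join a b) ->
  tau (rowmon L e ** rowmon L g) (rowmon L a ** rowmon L b) /\
  rowmon L e ** rowmon L g != rowmon L a ** rowmon L b.
Proof.
move=> aI bI /and5P[eI gI ec gd /andP[/col_leP egc cont]] dL.
have [|||i [lti ei gi]] := standard_pair_first_diff (increasing_meet aI bI)
  (increasing_join aI bI) eI gI _ _ ec.
- apply/col_leP => k; have [/col_leP h1 _] := col_meet_le a b; have [/col_leP h2 _] := col_join_ge a b.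
  exact: leq_trans (h1 k) (h2 k).
- apply/col_leP => k; apply: leq_trans (egc k) _.
  by have [_ /col_leP] := col_meet_le g (col_meet a b); apply.
- by rewrite (perm_trans cont) // perm_sym content_meet_join.
rewrite -(rowmon_meet_join L a b).
exact: (tau_row_pair_lt (forallP dL i) lti ei gi).
Qed.

Lemma pair_count_inj (x y x' y' : nat) : (x <= y)%N -> (x' <= y')%N ->
  (forall l, (x == l) + (y == l) = (x' == l) + (y' == l))%N -> x = x' /\ y = y'.
Proof.
have low u v u' v' : (u' <= v')%N ->
    (forall l, (u == l) + (v == l) = (u' == l) + (v' == l))%N -> (u' <= u)%N.
  move=> uv' /(_ u); rewrite eqxx.
  by case: (eqVneq u' u) => [->//|_]; case: (eqVneq v' u) uv' => [->//|_ _]; case: (v == u).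
move=> xy xy' H; have xx' : x = x'.
  by apply/anti_leq; rewrite (low _ _ _ _ xy (fun l => esym (H l))) (low _ _ _ _ xy' H).
split=> //; have := H y; rewrite xx' eqxx => /addnI.
by case: (eqVneq y' y) => [->|].
Qed.

(** Integer coefficients are identified on the generic matrix over [rat]: the full ladder [setT]
    makes all diagonals available, and the integers embed into [rat]. *)
Let std (t : colidx n m * colidx n m) := [&& increasing t.1, increasing t.2 & col_le t.1 t.2].
Let F (t : colidx n m * colidx n m) : mpol rat (xvar [set: 'I_n * 'I_m]) :=
  lminor rat setT t.1 * lminor rat setT t.2.

Let in_setT_ladder (e : 'I_n -> 'I_m) : in_ladder setT e.
Proof. by apply/forallP => i; rewrite inE. Qed.

Let F_lead t : std t -> F t != 0 /\ inm tau (F t) = rowmon setT t.1 ** rowmon setT t.2.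
Proof.
case/and3P => t1 t2 _.
have [n1 <-] := inm_lminor rat t1 (in_setT_ladder t.1).
have [n2 <-] := inm_lminor rat t2 (in_setT_ladder t.2).
have := inmM (tau_order setT) n1 n2; rewrite -/(F t); exact.
Qed.

(** Row [i] of the initial monomial records the multiset of [e_i] and [g_i], and [e_i <= g_i] tells
    which is which. *)
Let F_inj : {in std &, injective (fun t => inm tau (F t))}.
Proof.
move=> [e g] [e' g'] st st' FF.
have := etrans (esym (proj2 (F_lead st))) (etrans FF (proj2 (F_lead st'))).
case/and3P: st st' {FF} => /= _ _ /col_leP eg /and3P[_ _ /col_leP eg'] /eqP/cmP H.
have H' i : e i = e' i /\ g i = g' i.
  have [||l|h1 h2] := @pair_count_inj (e i) (g i) (e' i) (g' i) => //; last by split; apply: val_inj.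
  case: (ltnP l m) => [lm|ml]; last by rewrite !ltn_eqF // (leq_trans _ ml).
  have := H (exist _ (i, Ordinal lm) (in_setT _)).
  by rewrite !cmM !rowmonE /= -!(inj_eq val_inj).
by congr (_, _); apply/ffunP => i; case: (H' i).
Qed.

Let expand (mu : colidx n m * colidx n m -> int) : (forall t, mu t != 0 -> std t) ->
  \sum_t F t *~ mu t = \sum_(t | std t) (mu t)%:~R *: F t.
Proof.
move=> H; rewrite [RHS]big_mkcond; apply: eq_bigr => t _; rewrite scaler_int.
by case: ifPn => // st; case: (eqVneq (mu t) 0) => [->|/H]; rewrite ?mulr0z // (negPf st).
Qed.

(* Standard products are linearly independent, so that straightening [[b][a]]
   gives the same coefficients: the first factors are bounded by [a] and [b]. *)
Lemma straighten_meet a b : increasing a -> increasing b ->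
  exists mu : colidx n m * colidx n m -> int,
  (forall t, mu t != 0 -> [/\ increasing t.1, increasing t.2, col_le t.1 t.2,
     col_le t.1 (col_meet a b) & perm_eq (codom t.1 ++ codom t.2) (codom a ++ codom b)]) /\
  forall (A : comNzRingType) (X : 'M[A]_(n, m)),
    maxminor X a * maxminor X b = \sum_t maxminor X t.1 * maxminor X t.2 *~ mu t.
Proof.
move=> aI bI; have [mu [muP muE]] := straighten_left aI bI.
have [mu' [mu'P mu'E]] := straighten_left bI aI.
have stdP t : mu t != 0 -> std t by case/muP => *; apply/and3P; split.
have stdP' t : mu' t != 0 -> std t by case/mu'P => *; apply/and3P; split.
have mumu' : mu =1 mu'.
  move=> t; apply/eqP; rewrite -subr_eq0; apply: wlog_neg => nz.
  have st : std t.
    case: (eqVneq (mu t) 0) => [m0|/stdP //]; case: (eqVneq (mu' t) 0) => [m0'|/stdP' //].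
    by rewrite m0 m0' subr0 eqxx in nz.
  have e1 : \sum_(t | std t) (mu t)%:~R *: F t = lminor rat setT a * lminor rat setT b.
    exact: etrans (esym (expand stdP)) (esym (muE _ (ladder_mx rat setT))).
  have e2 : \sum_(t | std t) (mu' t)%:~R *: F t = lminor rat setT b * lminor rat setT a.
    exact: etrans (esym (expand stdP')) (esym (mu'E _ (ladder_mx rat setT))).
  have [|u [+ _]] := sum_inm_distinct (tau_order setT) (P := std)
    (c := fun t => (mu t - mu' t)%:~R : rat)
    (fun t st => proj1 (F_lead st)) F_inj st.
    by rewrite intr_eq0.
  rewrite (eq_bigr (fun t => (mu t)%:~R *: F t - (mu' t)%:~R *: F t)); last first.
    by move=> t' _; rewrite rmorphB scalerBl.
  by rewrite sumrB [X in X - _]e1 [X in _ - X]e2 [X in _ - X]mulrC subrr msupp0.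
exists mu; split=> // t mt; have [t1 t2 t12 ta cont] := muP _ mt.
have [|_ _ _ tb _] := mu'P t; first by rewrite -mumu'.
split=> //; apply/col_leP => k; rewrite ffunE minEle.
by case: ifP => _; [exact: (col_leP _ _ ta) | exact: (col_leP _ _ tb)].
Qed.

Lemma straightening a b : increasing a -> increasing b ->
  exists lam : colidx n m -> colidx n m -> int,
  forall (A : comNzRingType) (X : 'M[A]_(n, m)),
    maxminor X a * maxminor X b - maxminor X (col_meet a b) * maxminor X (col_join a b)
    + \sum_(t | vibration a b t.1 t.2) maxminor X t.1 * maxminor X t.2 *~ lam t.1 t.2 = 0.
Proof.
move=> aI bI; have [mu [muP muE]] := straighten_meet aI bI.
set c := col_meet a b; set d := col_join a b.
have cI : increasing c := increasing_meet aI bI.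
have dI : increasing d := increasing_join aI bI.
have stdP t : mu t != 0 -> std t by case/muP => *; apply/and3P; split.
have std_cd : std (c, d).
  apply/and3P; split=> //=; apply/col_leP => k.
  have [/col_leP h1 _] := col_meet_le a b; have [/col_leP h2 _] := col_join_ge a b.
  exact: leq_trans (h1 k) (h2 k).
(* The products of [a, b] and of [c, d] share their initial monomial, with coefficient 1, so their
   difference has only smaller monomials. A coefficient other than 1 would leave in it a monomial at
   least as large as that initial monomial. *)
have mu_cd : mu (c, d) = 1.
  apply/eqP; rewrite -subr_eq0; apply: wlog_neg => nz.
  have e1 : \sum_(t | std t) (mu t)%:~R *: F t = lminor rat setT a * lminor rat setT b.
    exact: etrans (esym (expand stdP)) (esym (muE _ (ladder_mx rat setT))).
  have e2 : \sum_(t | std t) (t == (c, d))%:R *: F t = lminor rat setT c * lminor rat setT d.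
    exact: (sum_deltaZ F std_cd).
  have [|u [+ Hu]] := sum_inm_distinct (tau_order setT) (P := std)
    (c := fun t => (mu t - (t == (c, d))%:R)%:~R : rat)
    (fun t st => proj1 (F_lead st)) F_inj std_cd.
    by rewrite intr_eq0 eqxx.
  rewrite (eq_bigr (fun t => (mu t)%:~R *: F t - (t == (c, d))%:R *: F t)); last first.
    by move=> t' _; rewrite rmorphB rmorph_nat scalerBl.
  rewrite sumrB [X in X - _]e1 [X in _ - X]e2.
  have [ha [aE haT]] := lminor_tail rat aI (in_setT_ladder a).
  have [hb [bE hbT]] := lminor_tail rat bI (in_setT_ladder b).
  have [hc [cE hcT]] := lminor_tail rat cI (in_setT_ladder c).
  have [hd [dE hdT]] := lminor_tail rat dI (in_setT_ladder d).
  have [h hE hT] := tail_ofMM (tau_order setT) haT hbT.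
  have [h' h'E h'T] := tail_ofMM (tau_order setT) hcT hdT.
  rewrite aE bE cE dE hE h'E rowmon_meet_join opprD addrACA subrr add0r => uH.
  have {uH}[uM uN] : tau u (rowmon setT a ** rowmon setT b) /\
      u != rowmon setT a ** rowmon setT b.
    rewrite rowmon_meet_join in h'T; case/msuppD_or/orP: uH => [/hT[]|]; first by [].
    by rewrite msuppN => /h'T[].
  have [_ FE] := F_lead std_cd; rewrite FE /= rowmon_meet_join in Hu.
  have [[_ anti _] _] := tau_order ([set: 'I_n * 'I_m]).
  by case/eqP: uN; apply: anti; rewrite uM Hu.
exists (fun e g => - mu (e, g)) => A X.
rewrite muE (bigD1 (c, d)) //= mu_cd mulr1z [X in X - _]addrC addrK.
rewrite [X in X + _](bigID (fun t => vibration a b t.1 t.2)) /= [X in _ + X + _]big1 ?addr0; last first.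
  move=> t /andP[tcd tv]; case: (eqVneq (mu t) 0) => [->|/muP[t1 t2 t12 tc cont]].
    by rewrite mulr0z.
  have contcd : perm_eq (codom t.1 ++ codom t.2) (codom c ++ codom d).
    by rewrite (perm_trans cont) // perm_sym content_meet_join.
  (* Equal contents make one factor determine the other, so a standard pair other than [(c, d)]
     differs from it in both factors, as a vibration must. *)
  have e1 : t.1 = c -> t.2 = d.
    by move=> e1; apply: increasing_perm_eq => //; rewrite e1 perm_cat2l in contcd.
  have e2 : t.2 = d -> t.1 = c.
    by move=> e2; apply: increasing_perm_eq => //; rewrite e2 perm_cat2r in contcd.
  case/negP: tv; apply/and5P; split=> //; last (apply/andP; split=> //).
  - by apply: contraNneq tcd => h; rewrite [t]surjective_pairing h e1.
  - by apply: contraNneq tcd => h; rewrite [t]surjective_pairing h e2.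
  - apply/col_leP => k; rewrite ffunE minEle; case: ifP => _; first exact: (col_leP _ _ t12).
    exact: (col_leP _ _ tc).
rewrite -[RHS](subrr (\sum_(t | vibration a b t.1 t.2) maxminor X t.1 * maxminor X t.2 *~ mu t)).
congr (_ + _); last by rewrite -sumrN; apply: eq_bigr => t _; rewrite -surjective_pairing mulrNz.
apply: eq_bigl => t; apply: andb_idl => /and5P[_ _ + _ _].
by apply: contraNneq => ->.
Qed.

End Straightening.

(** * The monomial order on the presentation ring *)

Lemma sum_mul_eq (V : finType) (f : V -> nat) x : (\sum_y f y * (y == x) = f x)%N.
Proof.
rewrite (eq_bigr (fun y => if y == x then f y else 0%N)) => [|y _].
  by rewrite -big_mkcond big_pred1_eq.
by case: eqP; rewrite (muln1, muln0).
Qed.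

Lemma eq_msub (V W : finType) (f g : V -> {cmonom W}) : f =1 g -> msub f =1 msub g.
Proof. by move=> fg u; apply: eq_bigr => v _; rewrite fg. Qed.

Lemma eq_mev (K : fieldType) (V : finType) (A : comAlgType K) (F G : V -> A) : F =1 G -> mev F =1 mev G.
Proof.
move=> FG p; rewrite !mevE; apply: eq_bigr => u _; rewrite !mevU.
by congr (_ *: _); apply: eq_bigr => v _; rewrite FG.
Qed.

Lemma mev_comp (K : fieldType) (V W : finType) (A : comAlgType K) (F : W -> A) (G : V -> mpol K W) p :
  mev F (mev G p) = mev (fun v => mev F (G v)) p.
Proof.
rewrite [mev G p]mevE [RHS]mevE linear_sum; apply: eq_bigr => u _.
rewrite linearZ !mevU rmorph_prod; congr (_ *: _).
by apply: eq_bigr => v _; rewrite rmorphXn.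
Qed.

Section Relabel.
Variables (V W : finType) (e : V -> W).
Hypothesis eI : injective e.

Lemma msub_ucmE u x : msub (fun v => ucm (e v)) u (e x) = u x.
Proof.
rewrite msubE -[RHS]sum_mul_eq; apply: eq_bigr => y _.
by rewrite cmU (inj_eq eI).
Qed.

Lemma msub_ucm0 u w : (forall v, e v != w) -> msub (fun v => ucm (e v)) u w = 0%N.
Proof. by move=> H; rewrite msubE big1 // => v _; rewrite cmU (negPf (H v)) muln0. Qed.

Lemma msub_ucm_inj : injective (msub (fun v => ucm (e v))).
Proof. by move=> u v uv; apply: cmonomP => x; rewrite -!msub_ucmE uv. Qed.

Lemma mdeg_msub_ucm u : mdeg (msub (fun v => ucm (e v)) u) = mdeg u.
Proof.
rewrite !mdegT; under eq_bigr do rewrite msubE; rewrite exchange_big /=.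
apply: eq_bigr => v _; rewrite -big_distrr /= -[RHS]muln1; congr (_ * _)%N.
by rewrite -mdegT mdegU.
Qed.

End Relabel.

Section ReesOrder.
Variables (K : fieldType) (n m : nat) (L : {set 'I_n * 'I_m}) (r : nat).
Hypothesis ladL : ladder L.
Local Notation X := (xvar L).
Local Notation XT := (xtvar L r).
Local Notation T := (Tvar K L r).
Local Notation RT := (xTvar K L r).

Definition injx : {cmonom X} -> {cmonom XT} := msub (fun x => ucm (inl x : XT)).

Let inlXT_inj : injective (fun x : X => inl x : XT). Proof. by move=> x y []. Qed.

Lemma injxl u x : injx u (inl x) = u x.
Proof. exact: (msub_ucmE inlXT_inj). Qed.

Lemma injxr u i : injx u (inr i) = 0%N.
Proof. by apply: msub_ucm0. Qed.

Lemma xpart_injx u : xpart (injx u) = u.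
Proof. by apply: cmonomP => x; rewrite xpartE injxl. Qed.

Lemma tpart_injx u : tpart (injx u) = mone.
Proof. by apply: cmonomP => x; rewrite tpartE injxr cm1. Qed.

Lemma tau'_injx u v : tau' (injx u) (injx v) = tau u v.
Proof. by rewrite /tau' !tpart_injx eqxx !xpart_injx. Qed.

Lemma injxM u v : injx (u ** v) = injx u ** injx v.
Proof. exact: msubM. Qed.

(** An instance of the degeneration argument for an inclusion of variables: there [psi] is
    injective, so every monomial is alone in its fiber. *)
Lemma inm_R_to_Rt (f : mpol K X) : f != 0 ->
  @R_to_Rt K n m L r f != 0 /\ inm tau' (@R_to_Rt K n m L r f) = injx (inm tau f).
Proof.
move=> f0; pose F (x : X) : mpol K XT := 'V_(inl x : XT).
have psiE : msub (fun x => inm tau' (F x)) =1 injx.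
  by apply: eq_msub => x; exact: (inmU K (tau'_order L r)).
rewrite -psiE; apply: (inm_mev_fiber_min (tau_order L) (tau'_order L r)) => //.
- by move=> x; exact: mU_neq0.
- by move=> u v; rewrite !psiE tau'_injx.
- move=> v; rewrite !psiE => /(msub_ucm_inj inlXT_inj) ->.
  by have [[tot _ _] _] := tau_order L; have := tot (inm tau f) (inm tau f); rewrite orbb.
Qed.

Definition rees_gen (w : RT) : mpol K XT :=
  match w with
  | inl x => 'V_(inl x : XT)
  | inr v => R_to_Rt r (lminor K L (val v).1) * t_ K L (val v).2
  end.

Lemma colset_mem (v : T) : increasing (val v).1 /\ in_ladder L (val v).1.
Proof. by apply/andP; rewrite -(colsetE K _ ladL) (valP v). Qed.

(** The initial monomials of the generators in explicit form, which makes the exponents of [psi]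
    computable. *)
Definition lead (w : RT) : {cmonom XT} :=
  match w with
  | inl x => ucm (inl x : XT)
  | inr v => injx (rowmon L (val v).1) ** ucm (inr (val v).2 : XT)
  end.

Lemma inm_rees_gen w : rees_gen w != 0 /\ inm tau' (rees_gen w) = lead w.
Proof.
case: w => [x|v] /=; first by rewrite mU_neq0 (inmU K (tau'_order L r)).
have [vI vL] := colset_mem v; have [l0 lE] := inm_lminor K vI vL.
have [R0 RE] := inm_R_to_Rt l0.
have [-> ->] := inmM (tau'_order L r) R0 (mU_neq0 K (ucm (inr (val v).2 : XT))).
by split=> //; rewrite RE lE (inmU K (tau'_order L r)).
Qed.

Definition psi : {cmonom RT} -> {cmonom XT} := msub lead.

Lemma psi_lead : msub (fun w => inm tau' (rees_gen w)) =1 psi.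
Proof. by apply: eq_msub => w; case: (inm_rees_gen w). Qed.

Lemma psiM u v : psi (u ** v) = psi u ** psi v. Proof. exact: msubM. Qed.
Lemma psiU w : psi (ucm w) = lead w. Proof. exact: msubU. Qed.
Lemma psi1 : psi mone = mone. Proof. exact: msub1. Qed.

Lemma psil u x : psi u (inl x) =
  (u (inl x) + \sum_(v : T) u (inr v) * ((val v).1 (val x).1 == (val x).2))%N.
Proof.
rewrite /psi msubE big_sumType /=; congr (_ + _)%N.
  rewrite -[RHS](sum_mul_eq (fun y => u (inl y))); apply: eq_bigr => y _.
  by rewrite cmU (inj_eq inlXT_inj).
by apply: eq_bigr => v _; rewrite cmM injxl rowmonE cmU addn0.
Qed.

Lemma psir u i : psi u (inr i) = (\sum_(v : T) u (inr v) * ((val v).2 == i))%N.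
Proof.
rewrite /psi msubE big_sumType /= big1 ?add0n => [|x _]; last by rewrite cmU muln0.
apply: eq_bigr => v _; rewrite cmM injxr add0n cmU.
by congr (_ * nat_of_bool _)%N.
Qed.

Definition tdeg (u : {cmonom RT}) : nat := \sum_(v : T) u (inr v).

(** Each [T]-variable contributes exactly one [t], so the number of [T]-variables is constant on the
    fibers of [psi]. With [wt_le] this bounds the weight along reductions. *)
Lemma tdeg_psi u : tdeg u = (\sum_i psi u (inr i))%N.
Proof.
under eq_bigr do rewrite psir; rewrite exchange_big /=; apply: eq_bigr => v _.
rewrite -big_distrr /= -[LHS]muln1; congr (_ * _)%N.
by rewrite -(sum_mul_eq (fun=> 1%N) (val v).2); apply: eq_bigr => i _; rewrite mul1n eq_sym.
Qed.

Definition height (p : colidx n m * 'I_r) : nat := \sum_k p.1 k + p.2.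

Lemma height_le p : (height p <= n * m + r)%N.
Proof.
rewrite leq_add ?(ltnW (ltn_ord _)) //.
rewrite -[n in (n * _)%N]card_ord -sum_nat_const; apply: leq_sum => k _.
exact: ltnW (ltn_ord _).
Qed.

(* [(n m + r - h)^2] is strictly decreasing and strictly convex in the height
   [h], so that the weight increases both when a column index is lowered and
   when two incomparable column indices are replaced by their meet and join. *)
Definition twt (v : T) : nat := (n * m + r - height (val v)) ^ 2.

Definition wt (u : {cmonom RT}) : nat := \sum_(v : T) u (inr v) * twt v.

Lemma wtM u v : wt (u ** v) = (wt u + wt v)%N.
Proof. by rewrite /wt -big_split /=; apply: eq_bigr => x _; rewrite cmM mulnDl. Qed.

Lemma wtUl x : wt (ucm (inl x)) = 0%N.
Proof. by rewrite /wt big1 // => v _; rewrite cmU. Qed.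

Lemma wtUr v : wt (ucm (inr v)) = twt v.
Proof.
rewrite /wt -[RHS](sum_mul_eq twt); apply: eq_bigr => w _.
by rewrite cmU mulnC eq_sym.
Qed.

Lemma wt_le u : (wt u <= tdeg u * (n * m + r) ^ 2)%N.
Proof.
rewrite /wt /tdeg big_distrl /=; apply: leq_sum => v _; rewrite leq_mul2l.
by apply/orP; right; rewrite leq_exp2r // leq_subr.
Qed.

(** Reversing the weight puts heavier monomials lower within a fiber; the unit monomial stays least
    because its fiber is a singleton. *)
Lemma psi_eq1 u : psi u = mone -> u = mone.
Proof.
move=> /eqP/cmP H; apply: cmonomP => -[x|v]; rewrite cm1.
  by have := H (inl x); rewrite psil cm1 => /eqP; rewrite addn_eq0 => /andP[/eqP].
have := H (inr (val v).2); rewrite psir cm1 => /eqP; rewrite sum_nat_eq0 => /forallP/(_ v).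
by rewrite eqxx muln1 => /eqP.
Qed.

(** The last, lexicographic, comparison only breaks the ties left by [psi] and [wt], to make the
    order antisymmetric. *)
Definition omega' : rel {cmonom RT} :=
  lex_comp (fun u v => tau' (psi u) (psi v))
    (lex_comp (fun u v => wt v <= wt u)%N
       (lex_le (fun x y : RT => (enum_rank x < enum_rank y)%N))).

Lemma omega'_order : monomial_order omega'.
Proof.
have enumI : injective (fun x : RT => enum_rank x : nat) by move=> x y /val_inj/enum_rank_inj.
have lexo := monomial_order_lex (gt := fun x y : RT => (enum_rank x < enum_rank y)%N) (fun x y => erefl) enumI.
have [[_ anti' _] [min' _]] := tau'_order L r.
have [[tot anti _] [min _]] := lexo.
apply: monomial_orderI.
- apply: cmp_order_lex.
    exact: cmp_order_pull psiM (monomial_order_cmp (tau'_order L r)).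
  apply: cmp_order_lex; last exact: monomial_order_cmp lexo.
  exact: cmp_order_rev (cmp_order_nat wtM).
- move=> u v; rewrite /omega' /lex_comp => /andP[uv /implyP uv'] /andP[vu /implyP vu'].
  have /andP[w1 /implyP l1] := uv' vu; have /andP[w2 /implyP l2] := vu' uv.
  by apply: anti; rewrite l1 // l2.
- move=> u; rewrite /omega' /lex_comp psi1 min' /=; apply/implyP => u1.
  have /psi_eq1 -> : psi u = mone by apply: anti'; rewrite u1 min'.
  by rewrite leqnn /=; have := tot mone mone; rewrite orbb.
Qed.

Lemma omega'_psi u v : omega' u v -> tau' (psi u) (psi v).
Proof. by case/andP. Qed.

Lemma omega'_lt_psi u v : tau' (psi u) (psi v) -> psi u != psi v -> omega' u v /\ u != v.
Proof.
move=> uv ne; split; last by apply: contraNneq ne => ->.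
rewrite /omega' /lex_comp uv /=; apply/implyP => vu.
have [[_ anti' _] _] := tau'_order L r.
by move/eqP: ne; case; apply: anti'; rewrite uv vu.
Qed.

Lemma omega'_lt_wt u v : psi u = psi v -> (wt v < wt u)%N -> omega' u v /\ u != v.
Proof.
move=> uv lt; split; last by apply: contraTneq lt => ->; rewrite ltnn.
rewrite /omega' /lex_comp uv (ltnW lt) leqNgt lt /=.
have [[tot _ _] _] := tau'_order L r; have := tot (psi v) (psi v); rewrite orbb => ->.
by [].
Qed.

End ReesOrder.

(** * Reduced monomials *)

Lemma min_max_comm r (A : Type) (f : 'I_r -> 'I_r -> A) (i j : 'I_r) :
  (forall k l, f k l = f l k) -> f (Order.min i j) (Order.max i j) = f i j.
Proof. by move=> fC; rewrite minEle maxEle; case: ifP. Qed.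

Lemma ltn_sum_le (I : finType) (f g : I -> nat) i0 :
  (forall i, f i <= g i)%N -> (f i0 < g i0)%N -> (\sum_i f i < \sum_i g i)%N.
Proof.
move=> fg fg0; rewrite (bigD1 i0) //= [X in (_ < X)%N](bigD1 i0) //= -addSn.
by apply: leq_add => //; apply: leq_sum.
Qed.

Lemma ord_min_le r (i j : 'I_r) : (Order.min i j <= i)%N /\ (Order.min i j <= j)%N.
Proof.
rewrite minEle -[(i <= j)%O]/(i <= j)%N; case: (leqP i j) => ij; split=> //; exact: ltnW.
Qed.

Section PsiProducts.
Variables (K : fieldType) (n m : nat) (L : {set 'I_n * 'I_m}) (r : nat).
Local Notation XT := (xtvar L r).
Local Notation RT := (xTvar K L r).

Lemma mmulACA (V : choiceType) (s t u v : {cmonom V}) : (s ** t) ** (u ** v) = (s ** u) ** (t ** v).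
Proof. by apply: cmonomP => y; rewrite !cmM; lia. Qed.

Lemma psi_xT (x : xvar L) (p : Tvar K L r) : psi (ucm (inl x) ** ucm (inr p) : {cmonom RT}) =
  injx r (ucm x ** rowmon L (val p).1) ** ucm (inr (val p).2 : XT).
Proof.
apply: etrans (psiM _ _) _; apply: etrans (congr2 _ (psiU _) (psiU _)) _.
apply: etrans (mulmA _ _ _) _; congr (_ ** _); apply: etrans _ (esym (injxM _ _ _)).
by congr (_ ** _); apply/esym; exact: msubU.
Qed.

Lemma psi_TT (p q : Tvar K L r) : psi (ucm (inr p) ** ucm (inr q) : {cmonom RT}) =
  injx r (rowmon L (val p).1 ** rowmon L (val q).1) **
  (ucm (inr (val p).2 : XT) ** ucm (inr (val q).2 : XT)).
Proof.
apply: etrans (psiM _ _) _; apply: etrans (congr2 _ (psiU _) (psiU _)) _.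
by apply: etrans (mmulACA _ _ _ _) _; congr (_ ** _); exact: esym (injxM _ _ _).
Qed.

Lemma wt_lt (s t u v w : {cmonom RT}) i j k l :
  wt s = i -> wt t = j -> wt u = k -> wt v = l -> (i + j < k + l)%N -> (wt (s ** t ** w) < wt (u ** v ** w))%N.
Proof. by rewrite !wtM ltn_add2r => -> -> -> ->. Qed.

End PsiProducts.

Section Reduction.
Variables (K : fieldType) (n m : nat) (L : {set 'I_n * 'I_m}) (r : nat).
Hypothesis ladL : ladder L.
Local Notation X := (xvar L).
Local Notation XT := (xtvar L r).
Local Notation T := (Tvar K L r).
Local Notation RT := (xTvar K L r).
Implicit Types (u v w : {cmonom RT}) (p q : T).

Definition comparable_T p q : bool := pair_le (val p) (val q) || pair_le (val q) (val p).

(* [x_(i,j)] can replace [x_(i,a_i)] in the diagonal of [a], lowering [a]. *)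
Definition lowers (x : X) p : bool :=
  ((val x).2 < (val p).1 (val x).1)%N &&
  [forall k : 'I_n, (k < (val x).1)%N ==> ((val p).1 k < (val x).2)%N].

Definition reduced u : bool :=
  [forall p, forall q, (0 < u (inr p))%N ==> (0 < u (inr q))%N ==> comparable_T p q] &&
  [forall p, forall x, (0 < u (inr p))%N ==> (0 < u (inl x))%N ==> ~~ lowers x p].

Lemma reducedP u : reflect
  ((forall p q, (0 < u (inr p))%N -> (0 < u (inr q))%N -> comparable_T p q) /\
   (forall p x, (0 < u (inr p))%N -> (0 < u (inl x))%N -> ~~ lowers x p)) (reduced u).
Proof.
apply: (iffP andP) => -[/= H1 H2]; split.
- by move=> p q pu qu; have /forallP/(_ q)/implyP/(_ pu)/implyP := forallP H1 p; apply.
- by move=> p x pu xu; have /forallP/(_ x)/implyP/(_ pu)/implyP := forallP H2 p; apply.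
- by apply/forallP => p; apply/forallP => q; apply/implyP => pu; apply/implyP; exact: H1.
- by apply/forallP => p; apply/forallP => q; apply/implyP => pu; apply/implyP; exact: H2.
Qed.

Lemma not_reducedP u : ~~ reduced u ->
  (exists p q w, ~~ comparable_T p q /\ u = ucm (inr p) ** ucm (inr q) ** w) \/
  (exists p x w, lowers x p /\ u = ucm (inl x) ** ucm (inr p) ** w).
Proof.
rewrite negb_and => /orP[]; rewrite negb_forall => /existsP[p]; rewrite negb_forall.
  move=> /existsP[q]; rewrite !negb_imply => /and3P[pu qu pq]; left.
  have pq' : (inr p : RT) != inr q.
    apply: contraNneq pq => -[->]; apply/orP; left; apply/andP; split=> //.
    by apply/forallP.
  have [w uE] := ucm2_dvd pq' pu qu.
  by exists p, q, w.
move=> /existsP[x]; rewrite !negb_imply andbT => /and3P[pu xu xp]; right.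
have xp' : (inl x : RT) != inr p by [].
by have [w uE] := ucm2_dvd xp' xu pu; exists p, x, w.
Qed.

Lemma colset_sub (e : colidx n m) (i : 'I_r) : increasing e -> in_ladder L e -> exists p : T, val p = (e, i).
Proof.
move=> eI eL; have eC : e \in colset K L by rewrite colsetE ?eI.
by exists (exist _ (e, i) eC).
Qed.

Lemma in_ladder_meet_join (a b : colidx n m) : in_ladder L a -> in_ladder L b ->
  in_ladder L (col_meet a b) /\ in_ladder L (col_join a b).
Proof.
move=> /forallP aL /forallP bL; split; apply/forallP => i; rewrite ffunE ?minEle ?maxEle;
  by case: ifP => _.
Qed.

Definition set_col (a : colidx n m) (i : 'I_n) (j : 'I_m) : colidx n m :=
  [ffun k => if k == i then j else a k].

Lemma lowers_set_col x p : lowers x p ->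
  increasing (set_col (val p).1 (val x).1 (val x).2) /\ in_ladder L (set_col (val p).1 (val x).1 (val x).2).
Proof.
have [/increasingP pI /forallP pL] := colset_mem ladL p.
case/andP => lt /forallP gt; split.
  apply/increasingP => k l kl; rewrite !ffunE; case: eqP => [kE|_]; case: eqP => [lE|_].
  - by move: kl; rewrite kE lE ltnn.
  - by rewrite kE in kl; exact: ltn_trans lt (pI _ _ kl).
  - by rewrite lE in kl; exact: (implyP (gt k)).
  - exact: pI.
by apply/forallP => k; rewrite ffunE; case: eqP => [->|_]; rewrite -?surjective_pairing ?(valP x).
Qed.

Lemma lower_psi (x x' : X) (p p' : T) : lowers x p ->
  val p' = (set_col (val p).1 (val x).1 (val x).2, (val p).2) -> val x' = ((val x).1, (val p).1 (val x).1) ->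
  psi (ucm (inl x') ** ucm (inr p') : {cmonom RT}) = psi (ucm (inl x) ** ucm (inr p)) /\
  (twt p < twt p')%N.
Proof.
move=> xp p'E x'E; split.
  have cE (z : X) (e : 'I_n -> 'I_m) y : (ucm z ** rowmon L e) y = ((z == y) + (e (val y).1 == (val y).2))%N.
    by rewrite cmM rowmonE cmU.
  apply: etrans (psi_xT _ _) (etrans _ (esym (psi_xT _ _))); rewrite p'E.
  apply: congr2 (congr1 (injx r) _) erefl; apply: cmonomP => y.
  apply: etrans (cE _ _ _) (etrans _ (esym (cE _ _ _))).
  have pE (s t : 'I_n * 'I_m) : (s == t) = (s.1 == t.1) && (s.2 == t.2) by case: s t => [? ?] [].
  rewrite ffunE -[x' == y](inj_eq val_inj) -[x == y](inj_eq val_inj) x'E !pE [(val y).1 == _]eq_sym /=.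
  by case: (eqVneq (val x).1 (val y).1) => [->|_] //=; rewrite addnC.
rewrite /twt ltn_sqr p'E.
have lt : (height (set_col (val p).1 (val x).1 (val x).2, (val p).2) < height (val p))%N.
  case/andP: xp => lt _; rewrite /height /= ltn_add2r; apply: (ltn_sum_le (i0 := (val x).1)) => [k|].
    by rewrite ffunE; case: eqP => // ->; exact: ltnW.
  by rewrite ffunE eqxx.
by have := height_le (val p); lia.
Qed.

Lemma meet_join_psi (p q p' q' : T) :
  val p' = (col_meet (val p).1 (val q).1, Order.min (val p).2 (val q).2) ->
  val q' = (col_join (val p).1 (val q).1, Order.max (val p).2 (val q).2) ->
  ~~ comparable_T p q ->
  psi (ucm (inr p') ** ucm (inr q') : {cmonom RT}) = psi (ucm (inr p) ** ucm (inr q)) /\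
  (twt p + twt q < twt p' + twt q')%N.
Proof.
move=> p'E q'E pq.
have te : ucm (inr (Order.min (val p).2 (val q).2) : XT) ** ucm (inr (Order.max (val p).2 (val q).2) : XT) =
    ucm (inr (val p).2 : XT) ** ucm (inr (val q).2 : XT).
  by apply: (min_max_comm (f := fun i j => ucm (inr i : XT) ** ucm (inr j : XT))) => i j; exact: mulmC.
split.
  apply: etrans (psi_TT _ _) (etrans _ (esym (psi_TT _ _))); rewrite p'E q'E.
  by apply: congr2 (congr1 (injx r) (rowmon_meet_join _ _ _)) te.
have sumE : (height (val p') + height (val q') = height (val p) + height (val q))%N.
  rewrite /height p'E q'E /= [LHS]addnACA [RHS]addnACA.
  rewrite (meet_join_sum (val p).1 (val q).1 (fun _ x => x : nat)); congr (_ + _)%N.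
  exact: (min_max_comm (f := fun i j : 'I_r => (i + j)%N) _ _ (fun i j => addnC i j)).
(* The meet is strictly lower than both variables: otherwise it would equal one of them, which would
   then be comparable to the other. *)
have lt (s t : T) : (s = p /\ t = q) \/ (s = q /\ t = p) -> (height (val p') < height (val s))%N.
  move=> st; have [le1 le2] : col_le (val p').1 (val s).1 /\ ((val p').2 <= (val s).2)%N.
    rewrite p'E; have [h1 h2] := col_meet_le (val p).1 (val q).1.
    have [h3 h4] := ord_min_le (val p).2 (val q).2.
    by case: st => [[-> _]|[-> _]]; [exact: (conj h1 h3) | exact: (conj h2 h4)].
  rewrite ltnNge; apply/negP => le.
  have sumle : (\sum_k (val p').1 k <= \sum_k (val s).1 k)%N.
    by apply: leq_sum => k _; exact: (col_leP _ _ le1).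
  have e2 : (val p').2 = (val s).2.
    apply/val_inj/anti_leq; rewrite le2 -(leq_add2l (\sum_k (val s).1 k)).
    by apply: leq_trans le _; rewrite leq_add2r.
  have e1 : (val p').1 = (val s).1.
    apply/ffunP => k; apply/val_inj/anti_leq; rewrite (col_leP _ _ le1) /= leqNgt; apply/negP => lt.
    have : (\sum_k (val p').1 k < \sum_k (val s).1 k)%N.
      exact: (ltn_sum_le (fun l => col_leP _ _ le1 l) lt).
    by move: le; rewrite /height e2 leq_add2r leqNgt => /negP.
  have st' : pair_le (val s) (val t).
    apply/andP; rewrite -e1 -e2 p'E; have [h1 h2] := col_meet_le (val p).1 (val q).1.
    have [h3 h4] := ord_min_le (val p).2 (val q).2.
    by case: st => [[_ ->]|[_ ->]]; [exact: (conj h2 h4) | exact: (conj h1 h3)].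
  case: st => -[ps qt]; subst; case/negP: pq; rewrite /comparable_T st' ?orbT //.
have lt1 := lt p q (or_introl (conj erefl erefl)); have lt2 := lt q p (or_intror (conj erefl erefl)).
have := height_le (val p); have := height_le (val q); have := height_le (val p'); have := height_le (val q').
rewrite /twt; move: (n * m + r)%N lt1 lt2 sumE => B.
move: (height (val p)) (height (val q)) (height (val p')) (height (val q')) => hp hq hp' hq'.
move=> lt1 lt2 sumE H1 H2 H3 H4.
(* With these parameters the four distances to the bound are [x + y + z] and [z] for the new pair,
   [y + z] and [x + z] for the old one; the sums of squares differ by [2xy]. *)
have [x xE] : exists x, hp = (hp' + x)%N by exists (hp - hp')%N; rewrite (subnKC (ltnW lt1)).
have [y yE] : exists y, hq = (hp' + y)%N by exists (hq - hp')%N; rewrite (subnKC (ltnW lt2)).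
have [z zE] : exists z, B = (hq' + z)%N by exists (B - hq')%N; rewrite subnKC.
have -> : hq' = (hp' + x + y)%N by lia.
have e3 : hq' = (hp' + x + y)%N by lia.
subst hp hq hq' B.
rewrite [X in (X - (hp' + x))%N](_ : _ = hp' + x + (y + z))%N; last lia.
rewrite [X in (X - (hp' + y))%N](_ : _ = hp' + y + (x + z))%N; last lia.
rewrite [X in (X - hp')%N](_ : _ = hp' + (x + y + z))%N; last lia.
rewrite !addKn; have x0 : (0 < x)%N by lia. have y0 : (0 < y)%N by lia.
nia.
Qed.

Lemma reduce_step u : ~~ reduced u -> exists v, psi v = psi u /\ (wt u < wt v)%N.
Proof.
case/not_reducedP => [[p [q [w [pq ->]]]]|[p [x [w [xp ->]]]]].
  have [pI pL] := colset_mem ladL p; have [qI qL] := colset_mem ladL q.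
  have [mL jL] := in_ladder_meet_join pL qL.
  have [p' p'E] := colset_sub (Order.min (val p).2 (val q).2) (increasing_meet pI qI) mL.
  have [q' q'E] := colset_sub (Order.max (val p).2 (val q).2) (increasing_join pI qI) jL.
  have [e lt] := meet_join_psi p'E q'E pq.
  exists (ucm (inr p') ** ucm (inr q') ** w); split.
    exact: etrans (psiM _ _) (etrans (congr1 (mmul^~ _) e) (esym (psiM _ _))).
  exact: (wt_lt w (wtUr p) (wtUr q) (wtUr p') (wtUr q') lt).
have [sI sL] := lowers_set_col xp; have [p' p'E] := colset_sub (val p).2 sI sL.
have [pI pL] := colset_mem ladL p.
have [x' x'E] : exists x' : X, val x' = ((val x).1, (val p).1 (val x).1).
  by exists (exist _ ((val x).1, (val p).1 (val x).1) (forallP pL (val x).1)).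
have [e lt] := lower_psi xp p'E x'E.
exists (ucm (inl x') ** ucm (inr p') ** w); split.
  exact: etrans (psiM _ _) (etrans (congr1 (mmul^~ _) e) (esym (psiM _ _))).
exact: (wt_lt w (wtUl K r x) (wtUr p) (wtUl K r x') (wtUr p') lt).
Qed.

Lemma reduce u : exists v, [/\ reduced v, psi v = psi u & omega' v u].
Proof.
have [k] := ubnP (tdeg u * (n * m + r) ^ 2 - wt u)%N.
elim: k u => // k IHk u uk; case: (boolP (reduced u)) => [uR|/reduce_step[v [vu lt]]].
  exists u; split=> //; have [[tot _ _] _] := omega'_order K L r.
  by have := tot u u; rewrite orbb.
have tE : tdeg v = tdeg u by rewrite !tdeg_psi vu.
have [|w [wR wv le]] := IHk v; first by have := wt_le v; rewrite tE; lia.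
exists w; split; rewrite ?wv // ; have [[_ _ tr] _] := omega'_order K L r.
by apply: tr le _; have [] := omega'_lt_wt vu lt.
Qed.

(** Among pairwise comparable variables one of least height is the least: anything below it has the
    same height and hence coincides with it. *)
Lemma min_support u : reduced u -> (0 < tdeg u)%N -> exists p, (0 < u (inr p))%N /\
  forall q, (0 < u (inr q))%N -> pair_le (val p) (val q).
Proof.
move=> /reducedP[uR _]; rewrite lt0n sum_nat_eq0 negb_forall => /existsP[p0].
rewrite negb_imply /= -lt0n => p0u.
case: (arg_minnP (P := fun p => 0 < u (inr p))%N (fun p => height (val p)) p0u) => p pu pmin.
exists p; split=> // q qu; case/orP: (uR p q pu qu) => // /andP[/col_leP le1 le2].
have := pmin _ qu; rewrite /height => H.
have sle : (\sum_k (val q).1 k <= \sum_k (val p).1 k)%N by apply: leq_sum => k _; exact: le1.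
apply/andP; split; last first.
  by rewrite -(leq_add2l (\sum_k (val p).1 k)); apply: leq_trans H _; rewrite leq_add2r.
apply/col_leP => k; rewrite leqNgt; apply/negP => lt.
have : (\sum_k (val q).1 k < \sum_k (val p).1 k)%N := ltn_sum_le le1 lt.
rewrite ltnNge -(leq_add2r (val p).2) => /negP; apply.
by apply: leq_trans H _; rewrite leq_add2l.
Qed.

Lemma psi_t_gt0 u p : (0 < u (inr p))%N -> (0 < psi u (inr (val p).2))%N.
Proof. by move=> pu; rewrite psir (bigD1 p) //= eqxx muln1 addn_gt0 pu. Qed.

Lemma psi_t_gt0E u i : (0 < psi u (inr i))%N -> exists2 p, (0 < u (inr p))%N & (val p).2 = i.
Proof.
rewrite psir lt0n sum_nat_eq0 negb_forall => /existsP[p]; rewrite -lt0n muln_gt0 => /andP[pu].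
by case: eqP => // pi _; exists p.
Qed.

Lemma psi_x_gt0E u x : (0 < psi u (inl x))%N -> (0 < u (inl x))%N \/
  exists2 p, (0 < u (inr p))%N & (val p).1 (val x).1 = (val x).2.
Proof.
rewrite psil addn_gt0 => /orP[]; first by left.
rewrite lt0n sum_nat_eq0 negb_forall => /existsP[p]; rewrite -lt0n muln_gt0 => /andP[pu].
by case: eqP => // pi _; right; exists p.
Qed.

Lemma psi_x_gt0 u p x : (0 < u (inr p))%N -> (val p).1 (val x).1 = (val x).2 -> (0 < psi u (inl x))%N.
Proof. by move=> pu px; rewrite psil (bigD1 p) //= px eqxx muln1 !addn_gt0 pu orbT. Qed.

(** The greedy step. The variable [x_(k,p_k)] divides the common image, so in [v] it comes from a
    [T]-variable, which is at least [q], or from an [x]-variable, which must not lower [q]. *)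
Lemma min_support_le u v p q (k : 'I_n) : reduced v -> psi u = psi v ->
  (0 < u (inr p))%N -> (forall q', (0 < v (inr q'))%N -> pair_le (val q) (val q')) -> (0 < v (inr q))%N ->
  (forall l : 'I_n, (l < k)%N -> (val p).1 l = (val q).1 l) -> ((val q).1 k <= (val p).1 k)%N.
Proof.
move=> /reducedP[_ vR] uv pu qmin qv pq.
have [/increasingP pI /forallP pL] := colset_mem ladL p.
pose x : X := exist _ (k, (val p).1 k) (pL k).
have : (0 < psi v (inl x))%N by rewrite -uv; exact: (@psi_x_gt0 u p x pu erefl).
case/psi_x_gt0E => [xv|[q' q'v /= e]]; last first.
  by have /andP[/col_leP le1 _] := qmin _ q'v; rewrite -e; exact: le1.
rewrite leqNgt; apply/negP => lt; have /negP := vR _ _ qv xv; apply.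
by apply/andP; split=> //; apply/forallP => l; apply/implyP => lk; rewrite -pq // pI.
Qed.

(* The smallest [T]-variable of a reduced monomial is determined greedily, row
   by row, by the image of the monomial under [psi]. *)
Lemma min_support_eq u v p q : reduced u -> reduced v -> psi u = psi v ->
  (0 < u (inr p))%N -> (forall q', (0 < u (inr q'))%N -> pair_le (val p) (val q')) ->
  (0 < v (inr q))%N -> (forall q', (0 < v (inr q'))%N -> pair_le (val q) (val q')) -> p = q.
Proof.
move=> uR vR uv pu pmin qv qmin; apply: val_inj.
have e2 : (val p).2 = (val q).2.
  apply/val_inj/anti_leq/andP; split.
    have : (0 < psi u (inr (val q).2))%N by rewrite uv; exact: psi_t_gt0.
    by case/psi_t_gt0E => p' /pmin/andP[_ +] <-.
  have : (0 < psi v (inr (val p).2))%N by rewrite -uv; exact: psi_t_gt0.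
  by case/psi_t_gt0E => p' /qmin/andP[_ +] <-.
have e1 : forall d (k : 'I_n), (k < d)%N -> (val p).1 k = (val q).1 k.
  elim=> // d IHd k; rewrite ltnS => kd; apply/val_inj/anti_leq/andP; split.
    apply: (min_support_le uR (esym uv) qv pmin pu) => l lk; apply/esym/IHd.
    exact: leq_trans lk kd.
  apply: (min_support_le vR uv pu qmin qv) => l lk; apply: IHd.
  exact: leq_trans lk kd.
rewrite [val p]surjective_pairing [val q]surjective_pairing e2; congr (_, _).
by apply/ffunP => k; apply: (e1 n).
Qed.

Lemma reduced_dvd u w : reduced (u ** w) -> reduced w.
Proof.
move=> /reducedP[H1 H2]; apply/reducedP; split=> [p q pw qw|p x pw xw].
  by apply: H1; rewrite cmM addn_gt0 ?pw ?qw orbT.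
by apply: H2; rewrite cmM addn_gt0 ?pw ?xw orbT.
Qed.

(** The common smallest [T]-variable is cancelled from both sides; once no [T]-variable is left,
    [psi] merely renames the [x]-variables. *)
Lemma reduced_inj u v : reduced u -> reduced v -> psi u = psi v -> u = v.
Proof.
have [k] := ubnP (tdeg u); elim: k u v => // k IHk u v uk uR vR uv.
have tE : tdeg u = tdeg v by rewrite !tdeg_psi uv.
case: (posnP (tdeg u)) => [u0|u_gt0].
  have T0 w : tdeg w = 0%N -> forall p, w (inr p) = 0%N.
    by move=> /eqP; rewrite sum_nat_eq0 => /forallP w0 p; apply/eqP; exact: w0.
  have x0 w x : tdeg w = 0%N -> psi w (inl x) = w (inl x).
    by move=> w0; rewrite psil big1 ?addn0 // => p _; rewrite T0.
  apply: cmonomP => -[x|p]; last by rewrite !T0 -?tE.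
  by rewrite -(x0 u) // -(x0 v) -?tE // uv.
have [p [pu pmin]] := min_support uR u_gt0.
have [|q [qv qmin]] := min_support vR; first by rewrite -tE.
have pq := min_support_eq uR vR uv pu pmin qv qmin; subst q.
have [u' uE] := ucm_dvd pu; have [v' vE] := ucm_dvd qv.
rewrite uE vE; congr (_ ** _); apply: IHk.
- move: uk; rewrite uE /tdeg; under eq_bigr do rewrite cmM; rewrite big_split /= (bigD1 p) //= cmUU.
  by rewrite -addnA add1n ltnS => /(leq_trans _); apply; rewrite ltnS leq_addl.
- by move: uR; rewrite uE; exact: reduced_dvd.
- by move: vR; rewrite vE; exact: reduced_dvd.
- by move: uv; rewrite uE vE !psiM ![psi (ucm _) ** _]mulmC => /mmulI.
Qed.

(** Any [v] in the fiber reduces to a reduced monomial that is not larger, and by injectivity this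
    monomial is [u]. *)
Lemma reduced_min u : reduced u -> forall v, psi v = psi u -> omega' u v.
Proof.
move=> uR v vu; have [v' [v'R v'v le]] := reduce v.
by rewrite (reduced_inj uR v'R) // v'v vu.
Qed.

End Reduction.

(** * Lifting the reductions to relations *)

Lemma tail_of_sign (K : fieldType) (V : finType) (le : rel {cmonom V}) u (h : mpol K V) k :
  tail_of le u h -> tail_of le u ((-1) ^+ k * h).
Proof.
move=> hT; elim: k => [|k IHk]; first by rewrite expr0 mul1r.
by rewrite exprS -mulrA mulN1r -scaleN1r; exact: tail_ofZ.
Qed.

(** Laplace expansion along the first row of the square matrix that repeats row [i] on top of the
    chosen columns. *)
Lemma sum_cofactor_row (A : comNzRingType) n m (X : 'M[A]_(n, m)) (c : {ffun 'I_n.+1 -> 'I_m}) (i : 'I_n) :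
  \sum_(j < n.+1) (-1) ^+ (i + j) * X i (c j) * maxminor X (col_del c j) = 0.
Proof.
pose M : 'M[A]_n.+1 := \matrix_(k, l) X (odflt i (unlift ord0 k)) (c l).
have M0 : \det M = 0.
  apply: (@determinant_alternate _ _ _ ord0 (lift ord0 i)) => [|l]; first exact: neq_lift.
  by rewrite !mxE unlift_none liftK.
transitivity ((-1) ^+ i * \det M); last by rewrite M0 mulr0.
rewrite (expand_det_row M ord0) mulr_sumr.
apply: eq_bigr => j _; rewrite exprD mxE unlift_none /= /cofactor add0n.
have -> : row' ord0 (col' j M) = colsub (col_del c j) X.
  by apply/matrixP => k l; rewrite !mxE liftK ffunE.
by rewrite -!mulrA; congr (_ * _); rewrite mulrCA.
Qed.

Lemma mdegUU (V : choiceType) (x y : V) : mdeg (ucm x ** ucm y) = 2.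
Proof. exact: etrans (mdegM _ _) (congr2 addn (mdegU _) (mdegU _)). Qed.

Lemma rmorph_comb3 (R S : comNzRingType) (f : {rmorphism R -> S}) (x y z : R) (t : S) :
  x - y + z = 0 -> f x * t + (- (f y * t) + f z * t) = 0.
Proof. by move=> xyz; rewrite -mulNr -!mulrDl -rmorphN -!rmorphD addrA xyz rmorph0 mul0r. Qed.

Lemma rmorph_mul_comb (Q R S : comNzRingType) (g : {rmorphism Q -> S}) (f : {rmorphism R -> S})
  (x y : R) (x' y' : Q) (t : S) : g x' = f x -> g y' = f y * t -> g (x' * y') = f (x * y) * t.
Proof. by move=> gx gy; rewrite !rmorphM gx gy mulrA. Qed.

Lemma rmorph_sign_comb (Q R S : comNzRingType) (g : {rmorphism Q -> S}) (f : {rmorphism R -> S})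
  (x y : R) (x' y' : Q) (t : S) k : g x' = f x -> g y' = f y * t ->
  g ((-1) ^+ k * x' * y') = f ((-1) ^+ k * x * y) * t.
Proof. by move=> gx gy; rewrite !rmorphM !rmorphXn !rmorphN1 gx gy mulrA. Qed.

Lemma sign_addnn (R : nzRingType) k : (-1) ^+ (k + k) = 1 :> R.
Proof. by rewrite exprD -expr2 sqrr_sign. Qed.

Section Morphisms.
Variables (K : fieldType) (n m : nat) (L : {set 'I_n * 'I_m}) (r : nat).

HB.instance Definition _ := GRing.RMorphism.copy (@R_to_Rt K n m L r)
  (mev (fun x => 'V_(inl x : xtvar L r))).
HB.instance Definition _ := GRing.RMorphism.copy (@R_to_RT K n m L r)
  (mev (fun x => 'V_(inl x : xTvar K L r))).
HB.instance Definition _ := GRing.RMorphism.copy (@KT_to_RT K n m L r)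
  (mev (fun v => 'V_(inr v : xTvar K L r))).
HB.instance Definition _ := GRing.RMorphism.copy (@fiber_map K n m L r)
  (mev (fun v : Tvar K L r => R_to_Rt r (lminor K L (val v).1) * t_ K L (val v).2)).
HB.instance Definition _ := GRing.RMorphism.copy (@rees_map K n m L r) (mev (@rees_gen K n m L r)).

End Morphisms.

Section Relations.
Variables (K : fieldType) (n m : nat) (L : {set 'I_n * 'I_m}) (r : nat).
Hypothesis ladL : ladder L.
Local Notation X := (xvar L).
Local Notation XT := (xtvar L r).
Local Notation T := (Tvar K L r).
Local Notation RT := (xTvar K L r).
Implicit Types (p q : T).

Definition iT : {cmonom T} -> {cmonom RT} := msub (fun v => ucm (inr v : RT)).

Let inrRT_inj : injective (fun v : T => inr v : RT). Proof. by move=> x y []. Qed.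

Lemma iTM : {morph iT : u v / u ** v >-> u ** v}. Proof. exact: msubM. Qed.

Lemma iT_inj : injective iT. Proof. exact: msub_ucm_inj inrRT_inj. Qed.

Lemma iTU p : iT (ucm p) = ucm (inr p : RT). Proof. exact: msubU. Qed.

Lemma iTUU p q : iT (ucm p ** ucm q) = ucm (inr p) ** ucm (inr q).
Proof. exact: etrans (iTM _ _) (congr2 mmul (iTU _) (iTU _)). Qed.

(** Pulling back [omega'] makes the leading monomials of the Plücker type relations the same in
    [K[T]] and in [R[T]]. *)
Definition omega : rel {cmonom T} := fun u v => omega' (iT u) (iT v).

Lemma omega_order : monomial_order omega.
Proof.
have [[_ anti _] [min _]] := omega'_order K L r.
apply: monomial_orderI.
- exact: cmp_order_pull iTM (monomial_order_cmp (omega'_order K L r)).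
- by move=> u v uv vu; apply: iT_inj; apply: anti; apply/andP; split; [exact: uv | exact: vu].
- by move=> u; rewrite /omega /iT msub1; exact: min.
Qed.

Lemma KT_to_RT_mon u : KT_to_RT (<< u >> : mpol K T) = << iT u >>.
Proof. exact: mev_monE. Qed.

Lemma tail_of_KT_to_RT u (h : mpol K T) : tail_of omega u h -> tail_of (@omega' K n m L r) (iT u) (KT_to_RT h).
Proof.
move=> hT w /msupp_mev_mon[v /hT[le ne d] ->]; split; first exact: le.
- by apply: contraNneq ne => /iT_inj ->.
- by rewrite !mdeg_msub_ucm // d.
Qed.

Lemma rees_map_KT_to_RT (q : mpol K T) : rees_map (KT_to_RT q) = fiber_map q.
Proof. by rewrite /rees_map mev_comp; apply: eq_mev => v; rewrite mevV. Qed.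

Lemma rees_map_R_to_RT (f : mpol K X) : rees_map (R_to_RT r f) = R_to_Rt r f.
Proof. by rewrite /rees_map mev_comp; apply: eq_mev => v; rewrite mevV. Qed.

Lemma T_val p : T_ K L (val p).1 (val p).2 = 'V_p.
Proof. by rewrite /T_ -surjective_pairing valK. Qed.

Lemma T_cases (a : colidx n m) (i : 'I_r) :
  T_ K L a i = 0 \/ exists p, val p = (a, i) /\ T_ K L a i = 'V_p.
Proof.
by rewrite /T_; case: insubP => [p _ pE|_]; [right; exists p | left].
Qed.

Lemma fiber_map_T (a : colidx n m) (i : 'I_r) : increasing a ->
  fiber_map (T_ K L a i) = R_to_Rt r (lminor K L a) * t_ K L i.
Proof.
move=> aI; rewrite /T_; case: insubP => [p _ pE|]; first by rewrite /fiber_map mevV pE.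
rewrite inE aI negbK => /eqP ->.
by rewrite !rmorph0 mul0r.
Qed.

Lemma fiber_map_TT (a b : colidx n m) (i j : 'I_r) : increasing a -> increasing b ->
  fiber_map (T_ K L a i * T_ K L b j) =
  R_to_Rt r (lminor K L a * lminor K L b) * (t_ K L i * t_ K L j).
Proof.
move=> aI bI; apply: etrans (rmorphM _ _ _) _.
apply: etrans (congr2 *%R (fiber_map_T _ aI) (fiber_map_T _ bI)) _.
by rewrite [R_to_Rt r (_ * _)]rmorphM; exact: mulrACA.
Qed.

Lemma tail_TT p q p' q' : omega' (ucm (inr p') ** ucm (inr q')) (ucm (inr p) ** ucm (inr q)) /\
  ucm (inr p') ** ucm (inr q') != ucm (inr p) ** ucm (inr q) :> {cmonom RT} ->
  tail_of omega (ucm p ** ucm q) ('V_p' * 'V_q' : mpol K T).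
Proof.
move=> [le ne]; rewrite -mUM; apply: tail_ofU.
- have e1 := congr2 (@omega' K n m L r) (iTUU p' q') (iTUU p q).
  by rewrite /omega; apply: etrans e1 _.
- apply: contraNneq ne => e; apply/eqP.
  exact: etrans (esym (iTUU p' q')) (etrans (congr1 iT e) (iTUU p q)).
- exact: etrans (mdegUU p' q') (esym (mdegUU p q)).
Qed.

Lemma tau'_injx_mul (u v : {cmonom X}) (w : {cmonom XT}) : tau u v -> u != v ->
  tau' (injx r u ** w) (injx r v ** w) /\ injx r u ** w != injx r v ** w.
Proof.
move=> uv ne; have [_ _ ->] := monomial_order_cmp (tau'_order L r); rewrite tau'_injx; split=> //.
apply: contraNneq ne => /mmulI e; apply/eqP/cmonomP => x.
by rewrite -(injxl r u) e injxl.
Qed.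

(** Two different reasons place the tail below [T_p T_q]: the meet-join term has the same image
    under [psi] but larger weight, while each surviving vibration has a strictly smaller image. *)
Lemma plucker_rel p q : ~~ comparable_T p q -> exists P h,
  [/\ plucker P, fiber_map P = 0, P = << ucm p ** ucm q >> + h & tail_of omega (ucm p ** ucm q) h].
Proof.
move=> pq; have [aI aL] := colset_mem ladL p; have [bI bL] := colset_mem ladL q.
have [cL dL] := in_ladder_meet_join aL bL.
set a := (val p).1 in aI aL cL dL *; set b := (val q).1 in bI bL cL dL *.
have [cI dI] := (increasing_meet aI bI, increasing_join aI bI).
have [lam lamE] := straightening aI bI.
(* The universal identity is carried along a ring morphism and multiplied by [t], ready for use with
   the ladder matrix and [t_i1 t_i2]. *)
have imE (A B : comNzRingType) (f : {rmorphism A -> B}) (Y : 'M[A]_(n, m)) t :=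
  rmorph_comb3 f t (lamE A Y).
set i1 := (val p).2; set i2 := (val q).2.
pose h := - (T_ K L (col_meet a b) (Order.min i1 i2) * T_ K L (col_join a b) (Order.max i1 i2)) +
  \sum_(eg : colidx n m * colidx n m | vibration a b eg.1 eg.2)
    (T_ K L eg.1 (Order.min i1 i2) * T_ K L eg.2 (Order.max i1 i2)) *~ lam eg.1 eg.2.
exists (T_ K L a i1 * T_ K L b i2 + h), h; split.
- exists a, b, i1, i2, lam; split; first exact: valP p.
  + exact: valP q.
  + by rewrite -negb_or.
  + move=> Y; rewrite -[RHS](lamE _ Y); congr (_ + _); apply: eq_bigr => eg _.
    by rewrite mulrzz mulrC.
  + by rewrite addrA.
- pose tt := t_ K L i1 * t_ K L i2.
  have ttE : t_ K L (Order.min i1 i2) * t_ K L (Order.max i1 i2) = tt.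
    by apply: (min_max_comm (f := fun i j => t_ K L i * t_ K L j)) => i j; exact: mulrC.
  have TTE e g : increasing e -> increasing g ->
      fiber_map (T_ K L e (Order.min i1 i2) * T_ K L g (Order.max i1 i2)) =
      R_to_Rt r (lminor K L e * lminor K L g) * tt.
    move=> eI gI; apply: etrans (fiber_map_TT (Order.min i1 i2) (Order.max i1 i2) eI gI) _.
    by apply: f_equal2; [by [] | exact: ttE].
  have sumE : fiber_map (\sum_(eg : colidx n m * colidx n m | vibration a b eg.1 eg.2)
      (T_ K L eg.1 (Order.min i1 i2) * T_ K L eg.2 (Order.max i1 i2)) *~ lam eg.1 eg.2) =
      R_to_Rt r (\sum_(eg | vibration a b eg.1 eg.2) lminor K L eg.1 * lminor K L eg.2 *~ lam eg.1 eg.2) * tt.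
    rewrite [LHS](rmorph_sum (@fiber_map K n m L r)) (rmorph_sum (@R_to_Rt K n m L r)) mulr_suml.
    apply: eq_bigr => eg /and5P[eI gI _ _ _].
    rewrite [LHS](rmorphMz (@fiber_map K n m L r)) (rmorphMz (@R_to_Rt K n m L r)) mulrzAl.
    by apply: f_equal2; [exact: TTE | by []].
  apply: etrans (rmorphD _ _ _) _.
  apply: etrans (congr2 +%R (fiber_map_TT i1 i2 aI bI) (rmorphD _ _ _)) _.
  apply: etrans (congr2 +%R erefl (congr2 +%R (etrans (rmorphN _ _) (congr1 -%R (TTE _ _ cI dI))) sumE)) _.
  pose f : {rmorphism mpol K X -> mpol K XT} := @R_to_Rt K n m L r.
  by apply: etrans _ (imE _ _ f (ladder_mx K L) tt).
- apply: f_equal2; last by [].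
  by apply: etrans (f_equal2 _ (T_val p) (T_val q)) (esym (mUM K (ucm p) (ucm q))).
- apply: tail_ofD.
    rewrite -scaleN1r; apply: tail_ofZ.
    case: (T_cases (col_meet a b) (Order.min i1 i2)) => [->|[p' [p'E ->]]].
      by rewrite mul0r; exact: tail_of0.
    case: (T_cases (col_join a b) (Order.max i1 i2)) => [->|[q' [q'E ->]]].
      by rewrite mulr0; exact: tail_of0.
    apply: tail_TT; have [e lt] := meet_join_psi p'E q'E pq.
    apply: (omega'_lt_wt e).
    have wE (s t : T) : wt (ucm (inr s) ** ucm (inr t) : {cmonom RT}) = (twt s + twt t)%N.
      exact: etrans (wtM _ _) (congr2 addn (wtUr _) (wtUr _)).
    by apply: etrans (congr2 (fun k l => (k < l)%N) (wE _ _) (wE _ _)) _.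
  apply: tail_of_sum => -[e g] /= vib; rewrite -scaler_int; apply: tail_ofZ.
  case: (T_cases e (Order.min i1 i2)) => [->|[p' [p'E ->]]].
    by rewrite mul0r; exact: tail_of0.
  case: (T_cases g (Order.max i1 i2)) => [->|[q' [q'E ->]]].
    by rewrite mulr0; exact: tail_of0.
  have [le ne] := vibration_lt aI bI vib dL.
  have [le' ne'] := tau'_injx_mul (ucm (inr i1 : XT) ** ucm (inr i2 : XT)) le ne.
  have ttE : ucm (inr (val p').2 : XT) ** ucm (inr (val q').2 : XT) = ucm (inr i1 : XT) ** ucm (inr i2 : XT).
    rewrite p'E q'E /=.
    by apply: (min_max_comm (f := fun i j => ucm (inr i : XT) ** ucm (inr j : XT))) => i j; exact: mulmC.
  have e1 : psi (ucm (inr p') ** ucm (inr q') : {cmonom RT}) =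
      injx r (rowmon L e ** rowmon L g) ** (ucm (inr i1 : XT) ** ucm (inr i2 : XT)).
    by apply: etrans (psi_TT p' q') _; rewrite ttE p'E q'E.
  have e2 := psi_TT p q.
  apply: tail_TT; apply: omega'_lt_psi.
    exact: etrans (congr2 tau' e1 e2) le'.
  by apply: contraNneq ne' => e3; apply/eqP; exact: etrans (esym e1) (etrans e3 e2).
Qed.

Lemma R_to_RT_ladder (i : 'I_n) (j : 'I_m) : R_to_RT r (ladder_mx K L i j) = 0 \/
  exists x : X, val x = (i, j) /\ R_to_RT r (ladder_mx K L i j) = 'V_(inl x : RT).
Proof.
rewrite mxE; case: insubP => [x _ xE|_]; last by left; rewrite rmorph0.
by right; exists x; split=> //; exact: mevV.
Qed.

Lemma KT_to_RT_T (a : colidx n m) (i : 'I_r) : KT_to_RT (T_ K L a i) = 0 \/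
  exists p, val p = (a, i) /\ KT_to_RT (T_ K L a i) = 'V_(inr p : RT).
Proof.
case: (T_cases a i) => [->|[p [pE ->]]]; first by left; rewrite rmorph0.
by right; exists p; split=> //; exact: mevV.
Qed.

Section EagonNorthcott.
Variables (p : T) (x : X).
Hypothesis xp : lowers x p.

Let a := (val p).1.
Let i := (val x).1.
Let jx := (val x).2.
Let j0 : 'I_n.+1 := widen_ord (leqnSn n) i.
(* The columns of [a] and the column [jx], which is the [i]-th one. *)
Let c : {ffun 'I_n.+1 -> 'I_m} := [ffun l => if unlift j0 l is Some k then a k else jx].

Let aI : increasing a. Proof. by have [] := colset_mem ladL p. Qed.
Let aL : in_ladder L a. Proof. by have [] := colset_mem ladL p. Qed.

Let cj0 : c j0 = jx. Proof. by rewrite ffunE unlift_none. Qed.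
Let clift k : c (lift j0 k) = a k. Proof. by rewrite ffunE liftK. Qed.

Let delE j k : col_del c j k = c (lift j k). Proof. exact: ffunE. Qed.

Let del_j0 : col_del c j0 = a. Proof. by apply/ffunP => k; rewrite delE clift. Qed.

Let clt (l : 'I_n.+1) (k : 'I_n) : (l < j0)%N -> l = k :> nat -> c l = a k.
Proof.
move=> li lk; rewrite -clift; congr (c _); apply: val_inj; rewrite /= /bump lk leqNgt.
by rewrite -lk li.
Qed.

Let cgt (l : 'I_n.+1) (k : 'I_n) : (j0 < l)%N -> l = k.+1 :> nat -> c l = a k.
Proof.
move=> li lk; rewrite -clift; congr (c _); apply: val_inj; rewrite /= /bump lk.
by move: li; rewrite lk ltnS => ->.
Qed.

Let cI (k l : 'I_n.+1) : (k < l)%N -> (c k < c l)%N.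
Proof.
case/andP: (xp) => lt /forallP gt; move/increasingP: (aI) => aI'.
case: (unliftP j0 k) => [k' ->|->]; case: (unliftP j0 l) => [l' ->|->]; rewrite ?clift ?cj0 /=.
- by rewrite ltnNge leq_bump2 -ltnNge; exact: aI'.
- rewrite /bump; case: (leqP i k') => h1 h2; last exact: (implyP (gt k')).
  by have := leq_trans h2 h1; rewrite ltnNge leqnSn.
- rewrite /bump; case: (leqP i l') => h1 h2; first exact: leq_trans lt (increasing_leq aI h1).
  by have := ltn_trans h1 h2; rewrite ltnn.
- by rewrite ltnn.
Qed.

Let delI j : increasing (col_del c j).
Proof.
apply/increasingP => k l kl; rewrite !delE; apply: cI.
by rewrite /= ltnNge leq_bump2 -ltnNge.
Qed.

Let rowE (z : X) (e : 'I_n -> 'I_m) y : (ucm z ** rowmon L e) y = ((z == y) + (e (val y).1 == (val y).2))%N.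
Proof. by rewrite cmM rowmonE cmU. Qed.

Let valE (y z : X) : (y == z) = ((val y).1 == (val z).1) && ((val y).2 == (val z).2).
Proof. by rewrite -(inj_eq val_inj); case: (val y) (val z) => [? ?] []. Qed.

Let del_lt (j : 'I_n.+1) (k : 'I_n) : (k < j)%N -> (k < i)%N -> col_del c j k = a k.
Proof.
move=> kj ki; have lE : lift j k = k :> nat by rewrite /= /bump leqNgt kj.
by rewrite delE; apply: clt; rewrite ?lE.
Qed.

(** Deleting a column before position [i] pushes row [j] of the diagonal to a larger column, so
    [x_(j,a_j)] decides. *)
Lemma en_before (j : 'I_n.+1) (y : X) : (j < j0)%N -> val y = (i, c j) ->
  tau (ucm y ** rowmon L (col_del c j)) (ucm x ** rowmon L a) /\
  ucm y ** rowmon L (col_del c j) != ucm x ** rowmon L a.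
Proof.
move=> ji yE; have jn : (j < n)%N := ltn_trans ji (ltn_ord i).
pose k0 := Ordinal jn; have k0i : k0 != i by rewrite -(inj_eq val_inj) /= ltn_eqF.
have delk0 : (a k0 < col_del c j k0)%N.
  by rewrite -(@clt j k0) // delE cI //= /bump leqnn.
apply: (@tau_ltI _ _ L _ _ (exist _ (k0, a k0) (forallP aL k0))).
  rewrite !rowE !valE yE /= -/i ![i == _]eq_sym (negPf k0i) eqxx.
  by rewrite /= -[col_del c j k0 == _](inj_eq val_inj) (gtn_eqF delk0).
case=> -[k l] kl; rewrite -xrankE !rowE !valE yE /= -/i.
move=> /orP[kj|/andP[/eqP -> lj]].
  have ki : (k < i)%N := ltn_trans kj ji.
  have -> : (i == k) = false by rewrite -(inj_eq val_inj) (gtn_eqF ki).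
  by rewrite /= del_lt.
rewrite ![i == _]eq_sym (negPf k0i) /= -[a k0 == l](inj_eq val_inj) (gtn_eqF lj).
by rewrite -(inj_eq val_inj) (gtn_eqF (ltn_trans lj delk0)).
Qed.

(** Row [i] now holds [jx] from the diagonal and [c_j > a_i] from the extra variable, instead of
    [jx] and [a_i]; hence [x_(i,a_i)] decides. *)
Lemma en_after (j : 'I_n.+1) (y : X) : (i.+1 < j)%N -> val y = (i, c j) ->
  tau (ucm y ** rowmon L (col_del c j)) (ucm x ** rowmon L a) /\
  ucm y ** rowmon L (col_del c j) != ucm x ** rowmon L a.
Proof.
move=> ij yE; case/andP: (xp) => lt _.
have acj : (a i < c j)%N.
  by rewrite -(@cgt (lift j0 i) i) ?cI //= /bump leqnn.
have deli : col_del c j i = jx.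
  rewrite delE -cj0; congr (c _); apply: val_inj; rewrite /= /bump leqNgt.
  by rewrite (ltn_trans (ltnSn i) ij).
apply: (@tau_ltI _ _ L _ _ (exist _ (i, a i) (forallP aL i))).
  rewrite !rowE !valE yE /= deli eqxx /= -[c j == _](inj_eq val_inj) (gtn_eqF acj).
  by rewrite -(inj_eq val_inj) (ltn_eqF lt) addn_gt0 eqxx orbT.
case=> -[k l] kl; rewrite -xrankE !rowE !valE yE /= -/i.
move=> /orP[ki|/andP[/eqP -> lj]].
  have -> : (i == k) = false by rewrite -(inj_eq val_inj) (gtn_eqF ki).
  rewrite /= del_lt //.
  by apply: ltn_trans ki _; exact: ltn_trans (ltnSn i) ij.
rewrite eqxx /= deli -[c j == _](inj_eq val_inj) (gtn_eqF (ltn_trans lj acj)).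
by rewrite -[a i == _](inj_eq val_inj) (gtn_eqF lj) addn0.
Qed.

(** This term is the lowering move itself: [jx] and [a_i] trade places between the variable and the
    diagonal. *)
Lemma en_next (j : 'I_n.+1) : j = i.+1 :> nat -> c j = a i /\ col_del c j = set_col a i jx.
Proof.
move=> ji; split; first by apply: cgt; rewrite /= ?ji.
have sE k : set_col a i jx k = if k == i then jx else a k by exact: ffunE.
apply/ffunP => k; rewrite delE sE; case: (ltngtP k i) => ki.
- rewrite ifN; last by rewrite -(inj_eq val_inj) ltn_eqF.
  rewrite -delE; apply: del_lt => //.
  by rewrite ji ltnS ltnW.
- rewrite ifN; last by rewrite -(inj_eq val_inj) gtn_eqF.
  apply: (@cgt (lift j k) k); rewrite /= /bump ji ki // add1n ltnS.
  exact: ltnW.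
- have -> : k = i by apply: val_inj.
  rewrite eqxx -cj0; congr (c _); apply: val_inj; rewrite /= /bump ji.
  by rewrite ltnn.
Qed.

(* The terms [i] and [i + 1] of the relation have the same image under [psi],
   and the weight prefers the latter; the other terms have smaller images. *)
Lemma en_rel : exists P h, [/\ eagon_northcott P, rees_map P = 0,
  P = << ucm (inl x) ** ucm (inr p) >> + h & tail_of (@omega' K n m L r) (ucm (inl x) ** ucm (inr p)) h].
Proof.
pose t (j : 'I_n.+1) : mpol K RT := (-1) ^+ (i + j) *
  R_to_RT r (ladder_mx K L i (c j)) * KT_to_RT (T_ K L (col_del c j) (val p).2).
exists (\sum_j t j), (\sum_(j | j != j0) t j); split.
- exists c, i, (val p).2; split=> //.
  by apply/forallP => k; apply/forallP => l; apply/implyP => kl; exact: cI.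
- pose f : {rmorphism mpol K X -> mpol K XT} := @R_to_Rt K n m L r.
  pose g : {rmorphism mpol K RT -> mpol K XT} := @rees_map K n m L r.
  have tE j : g (t j) =
      f ((-1) ^+ (i + j) * ladder_mx K L i (c j) * lminor K L (col_del c j)) * t_ K L (val p).2.
    apply: (rmorph_sign_comb (g := g) (f := f) _ (rees_map_R_to_RT _)).
    exact: etrans (rees_map_KT_to_RT _) (fiber_map_T _ (delI j)).
  apply: etrans (rmorph_sum g _ _ _) _; apply: etrans (eq_bigr _ (fun j _ => tE j)) _.
  rewrite -mulr_suml -(rmorph_sum f) [X in f X](sum_cofactor_row (ladder_mx K L) c i).
  by rewrite rmorph0 mul0r.
- rewrite (bigD1 j0) //=; apply: f_equal2; last by [].
  have e1 : R_to_RT r (ladder_mx K L i (c j0)) = 'V_(inl x : RT).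
    have -> : ladder_mx K L i (c j0) = 'V_x by rewrite mxE cj0 -surjective_pairing valK.
    exact: mevV.
  have e2 : KT_to_RT (T_ K L (col_del c j0) (val p).2) = 'V_(inr p : RT).
    by rewrite del_j0 T_val; exact: mevV.
  have e0 : (-1) ^+ (i + j0) = 1 :> mpol K RT := sign_addnn _ i.
  apply: etrans (f_equal2 *%R (f_equal2 *%R e0 e1) e2) _; rewrite mul1r.
  exact: esym (mUM K (ucm (inl x : RT)) (ucm (inr p : RT))).
apply: tail_of_sum => j jj0; rewrite /t -mulrA; apply: tail_of_sign.
case: (R_to_RT_ladder i (c j)) => [->|[y [yE ->]]]; first by rewrite mul0r; exact: tail_of0.
case: (KT_to_RT_T (col_del c j) (val p).2) => [->|[q [qE ->]]]; first by rewrite mulr0; exact: tail_of0.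
rewrite -mUM.
have [le ne] : omega' (ucm (inl y) ** ucm (inr q)) (ucm (inl x) ** ucm (inr p)) /\
   ucm (inl y) ** ucm (inr q) != ucm (inl x) ** ucm (inr p) :> {cmonom RT}.
  have e1 : psi (ucm (inl y) ** ucm (inr q) : {cmonom RT}) =
      injx r (ucm y ** rowmon L (col_del c j)) ** ucm (inr (val p).2 : XT).
    by apply: etrans (psi_xT y q) _; rewrite qE.
  have e2 := psi_xT x p.
  case: (ltngtP j i.+1) => [ji|ij|ji].
  - have ji' : (j < j0)%N by rewrite ltn_neqAle -ltnS ji andbT; move: jj0; rewrite -(inj_eq val_inj).
    have [le ne] := en_before ji' yE.
    have [le' ne'] := tau'_injx_mul (ucm (inr (val p).2 : XT)) le ne.
    apply: omega'_lt_psi; first exact: etrans (congr2 tau' e1 e2) le'.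
    by apply: contraNneq ne' => e3; apply/eqP; exact: etrans (esym e1) (etrans e3 e2).
  - have [le ne] := en_after ij yE.
    have [le' ne'] := tau'_injx_mul (ucm (inr (val p).2 : XT)) le ne.
    apply: omega'_lt_psi; first exact: etrans (congr2 tau' e1 e2) le'.
    by apply: contraNneq ne' => e3; apply/eqP; exact: etrans (esym e1) (etrans e3 e2).
  have [cE dE] := en_next ji.
  have [||e lt] := @lower_psi K n m L r x y p q xp; [by rewrite qE dE | by rewrite yE cE|].
  apply: (omega'_lt_wt e).
  have wE (z : X) (s : T) : wt (ucm (inl z) ** ucm (inr s) : {cmonom RT}) = twt s.
    exact: etrans (wtM _ _) (congr2 addn (wtUl K r z) (wtUr _)).
  by apply: etrans (congr2 (fun k l => (k < l)%N) (wE x p) (wE y q)) _.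
apply: tail_ofU le ne _; exact: etrans (mdegUU (inl y : RT) (inr q)) (esym (mdegUU (inl x : RT) (inr p))).
Qed.

End EagonNorthcott.

End Relations.

(** * Bases, initial algebras and fiber type *)

Lemma eq_alg_gen (K : fieldType) (A : comAlgType K) (S S' : A -> Prop) :
  (forall p, S p <-> S' p) -> same_set (alg_gen S) (alg_gen S').
Proof. by move=> SS' p; split; apply: alg_gen_sub => q /SS'; exact: alg_genS. Qed.

Lemma same_set_trans (T : Type) (A B C : T -> Prop) : same_set A B -> same_set B C -> same_set A C.
Proof. by move=> AB BC x; split=> [/AB/BC|/BC/AB]. Qed.

Lemma msub_relabel (U V W : finType) (f : V -> {cmonom W}) (e : U -> V) (u : {cmonom U}) :
  msub f (msub (fun x => ucm (e x)) u) = msub (fun x => f (e x)) u.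
Proof.
apply: cmonomP => z; rewrite !msubE; under eq_bigr do rewrite msubE big_distrl /=.
rewrite exchange_big /=; apply: eq_bigr => x _.
rewrite -(sum_mul_eq (fun y => u x * f y z)%N); apply: eq_bigr => y _.
by rewrite cmU eq_sym mulnAC.
Qed.

Lemma ucm2_gt0 (V : choiceType) (x y : V) (w : {cmonom V}) :
  (0 < (ucm x ** ucm y ** w) x)%N /\ (0 < (ucm x ** ucm y ** w) y)%N.
Proof. by rewrite !cmM !cmUU; lia. Qed.

Section Assembly.
Variables (K : fieldType) (n m : nat) (L : {set 'I_n * 'I_m}) (r : nat).
Hypothesis ladL : ladder L.
Local Notation X := (xvar L).
Local Notation XT := (xtvar L r).
Local Notation T := (Tvar K L r).
Local Notation RT := (xTvar K L r).

Let fgen (v : T) : mpol K XT := R_to_Rt r (lminor K L (val v).1) * t_ K L (val v).2.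

Let fgen_neq0 v : fgen v != 0.
Proof. by have [] := inm_rees_gen ladL (inr v). Qed.

Let rgen_neq0 (w : RT) : rees_gen w != 0.
Proof. by have [] := inm_rees_gen ladL w. Qed.

Let psiTE : msub (fun v => inm tau' (fgen v)) =1 (fun u => psi (iT u)).
Proof.
move=> u; rewrite /psi /iT msub_relabel; apply: eq_msub => v.
by have [_] := inm_rees_gen ladL (inr v).
Qed.

Let psiT_le u v : omega u v ->
  tau' (msub (fun v => inm tau' (fgen v)) u) (msub (fun v => inm tau' (fgen v)) v).
Proof. by rewrite !psiTE; exact: omega'_psi. Qed.

Let psiR_le (u v : {cmonom RT}) : omega' u v ->
  tau' (msub (fun w => inm tau' (rees_gen w)) u) (msub (fun w => inm tau' (rees_gen w)) v).
Proof. by rewrite !(psi_lead ladL); exact: omega'_psi. Qed.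

(** The conditional form lets finite choice produce a total family, with the value 0 at comparable
    pairs; those are filtered out of the basis. *)
Definition plucker_spec (pq : T * T) (P : mpol K T) : Prop := ~~ comparable_T pq.1 pq.2 ->
  [/\ plucker P, fiber_map P = 0 & exists h, P = << ucm pq.1 ** ucm pq.2 >> + h /\
    tail_of (@omega K n m L r) (ucm pq.1 ** ucm pq.2) h].

Definition en_spec (px : T * X) (P : mpol K RT) : Prop := lowers px.2 px.1 ->
  [/\ eagon_northcott P, rees_map P = 0 & exists h,
    P = << ucm (inl px.2) ** ucm (inr px.1) >> + h /\
    tail_of (@omega' K n m L r) (ucm (inl px.2) ** ucm (inr px.1)) h].

Lemma plucker_family : exists pl : T * T -> mpol K T, forall pq, plucker_spec pq (pl pq).
Proof.
apply: (fin_all_exists (P := plucker_spec)) => -[p q].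
case: (boolP (comparable_T p q)) => [pq|/(plucker_rel ladL)[P [h [H1 H2 H3 H4]]]].
  by exists 0; rewrite /plucker_spec pq.
by exists P => _; split=> //; exists h.
Qed.

Lemma en_family : exists en : T * X -> mpol K RT, forall px, en_spec px (en px).
Proof.
apply: (fin_all_exists (P := en_spec)) => -[p x].
case: (boolP (lowers x p)) => [/(en_rel ladL)[P [h [H1 H2 H3 H4]]]|xp].
  by exists P => _; split=> //; exists h.
by exists 0; rewrite /en_spec (negPf xp).
Qed.

Section Bases.
Variables (pl : T * T -> mpol K T) (en : T * X -> mpol K RT).
Hypothesis plP : forall pq, plucker_spec pq (pl pq).
Hypothesis enP : forall px, en_spec px (en px).

Definition fiber_basis : seq (mpol K T) :=
  [seq pl pq | pq : T * T <- enum {: T * T} & ~~ comparable_T pq.1 pq.2].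

Definition rees_basis : seq (mpol K RT) :=
  [seq @KT_to_RT K n m L r g | g <- fiber_basis] ++
  [seq en px | px : T * X <- enum {: T * X} & lowers px.2 px.1].

Lemma fiber_basisP g : g \in fiber_basis -> exists2 pq, ~~ comparable_T pq.1 pq.2 & g = pl pq.
Proof. by case/mapP => pq; rewrite mem_filter => /andP[pqN _] ->; exists pq. Qed.

Lemma mem_fiber_basis pq : ~~ comparable_T pq.1 pq.2 -> pl pq \in fiber_basis.
Proof. by move=> pqN; apply/mapP; exists pq; rewrite // mem_filter pqN mem_enum. Qed.

Lemma rees_basisP g : g \in rees_basis ->
  (exists2 pq, ~~ comparable_T pq.1 pq.2 & g = KT_to_RT (pl pq)) \/
  (exists2 px, lowers px.2 px.1 & g = en px).
Proof.
rewrite mem_cat => /orP[/mapP[h /fiber_basisP[pq pqN ->] ->]|/mapP[px]]; first by left; exists pq.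
by rewrite mem_filter => /andP[pxL _] ->; right; exists px.
Qed.

Lemma fiber_basis_ker g : g \in fiber_basis -> mev fgen g = 0.
Proof. by case/fiber_basisP => pq /(@plP pq)[_ H _] ->. Qed.

Lemma rees_basis_ker g : g \in rees_basis -> mev (@rees_gen K n m L r) g = 0.
Proof.
case/rees_basisP => [[pq /(@plP pq)[_ H _] ->]|[px /(@enP px)[_ H _] ->]]; last exact: H.
exact: etrans (rees_map_KT_to_RT _) H.
Qed.

Let incomparable_neq (p q : T) : ~~ comparable_T p q -> p != q.
Proof.
apply: contraNneq => ->; apply/orP; left; apply/andP; split=> //.
by apply/forallP.
Qed.

(** A monomial in the [T]-variables alone offers no [x] to lower with, so if it is not reduced it
    contains an incomparable pair. *)
Lemma fiber_basis_lead u : fiber_min fgen (@omega K n m L r) tau' u \/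
  exists v w h, [/\ << v >> + h \in fiber_basis, tail_of (@omega K n m L r) v h & u = v ** w].
Proof.
case: (boolP (reduced (iT u))) => [uR|].
  by left=> v; rewrite !psiTE; exact: (reduced_min ladL uR).
have uE p : iT u (inr p) = u p by apply: (@msub_ucmE T RT inr) => x y [].
case/not_reducedP => [[p [q [w [pq uw]]]]|[p [x [w [xp uw]]]]]; last first.
  have u0 : iT u (inl x) = 0%N by apply: (@msub_ucm0 T RT inr).
  by have [+ _] := ucm2_gt0 (inl x : RT) (inr p) w; rewrite -uw u0.
have [pu qu] := ucm2_gt0 (inr p : RT) (inr q) w; rewrite -uw !uE in pu qu.
have [w' ->] := ucm2_dvd (incomparable_neq pq) pu qu.
have [_ _ [h [plE hT]]] := @plP (p, q) pq.
right; exists (ucm p ** ucm q), w', h; split=> //.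
by rewrite -plE; exact: mem_fiber_basis.
Qed.

Lemma rees_basis_lead u : fiber_min (@rees_gen K n m L r) (@omega' K n m L r) tau' u \/
  exists v w h, [/\ << v >> + h \in rees_basis, tail_of (@omega' K n m L r) v h & u = v ** w].
Proof.
case: (boolP (reduced u)) => [uR|].
  by left=> v; rewrite !(psi_lead ladL); exact: (reduced_min ladL uR).
case/not_reducedP => [[p [q [w [pq uw]]]]|[p [x [w [xp uw]]]]]; right.
  have [_ _ [h [plE hT]]] := @plP (p, q) pq.
  exists (iT (ucm p ** ucm q)), w, (KT_to_RT h); split.
  - have e1 : KT_to_RT (pl (p, q)) = << iT (ucm p ** ucm q) >> + KT_to_RT h.
      rewrite plE; apply: etrans (rmorphD _ _ _) _.
      by apply: f_equal2; [exact: KT_to_RT_mon | by []].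
    rewrite -e1 mem_cat; apply/orP; left; apply: map_f.
    exact: (mem_fiber_basis (pq := (p, q))).
  - exact: tail_of_KT_to_RT.
  - by rewrite uw (iTUU p q).
have [_ _ [h [enE hT]]] := @enP (p, x) xp.
exists (ucm (inl x) ** ucm (inr p)), w, h; split=> //.
rewrite -enE mem_cat; apply/orP; right; apply/mapP; exists (p, x) => //.
by rewrite mem_filter xp mem_enum.
Qed.

Lemma fiber_groebner : groebner (@omega K n m L r) fiber_basis (@fiber_ideal K n m L r).
Proof.
split; first exact: fiber_basis_ker.
move=> p; exact: (initial_ideal_ker (omega_order K L r) (tau'_order L r) fgen_neq0 psiT_le
  fiber_basis_ker fiber_basis_lead).
Qed.

Lemma rees_groebner : groebner (@omega' K n m L r) rees_basis (@rees_ideal K n m L r).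
Proof.
split; first exact: rees_basis_ker.
move=> p; exact: (initial_ideal_ker (omega'_order K L r) (tau'_order L r) rgen_neq0 psiR_le
  rees_basis_ker rees_basis_lead).
Qed.

Lemma rees_ideal_gen p : rees_ideal p -> ideal_gen (fun g => g \in rees_basis) p.
Proof.
exact: (ker_ideal_gen (omega'_order K L r) (tau'_order L r) rgen_neq0 psiR_le
  rees_basis_ker rees_basis_lead).
Qed.

Lemma fiber_initial_algebra (A : mpol K XT -> Prop) : (forall p, A p <-> exists P, p = mev fgen P) ->
  same_set (initial_algebra tau' A) (alg_gen (fun q => exists v, q = << inm tau' (fgen v) >>)).
Proof.
exact: (initial_algebra_image (omega_order K L r) (tau'_order L r) fgen_neq0 psiT_le
  fiber_basis_ker fiber_basis_lead).
Qed.

Lemma rees_initial_algebra (A : mpol K XT -> Prop) :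
  (forall p, A p <-> exists P, p = mev (@rees_gen K n m L r) P) ->
  same_set (initial_algebra tau' A)
    (alg_gen (fun q => exists w : RT, q = << inm tau' (rees_gen w) >>)).
Proof.
exact: (initial_algebra_image (omega'_order K L r) (tau'_order L r) rgen_neq0 psiR_le
  rees_basis_ker rees_basis_lead).
Qed.

Lemma rees_inm_image P : mev (@rees_gen K n m L r) P != 0 ->
  alg_gen (fun q => exists w : RT, q = << inm tau' (rees_gen w) >>)
    (<< inm tau' (mev (@rees_gen K n m L r) P) >> : mpol K XT).
Proof.
move=> P0; have [u ->] := inm_image (omega'_order K L r) (tau'_order L r) rgen_neq0 psiR_le
  rees_basis_ker rees_basis_lead P0.
exact: alg_gen_psi.
Qed.

End Bases.

Lemma induced_omega : induced_order (@omega K n m L r).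
Proof.
move=> u v uv.
have [_ eu] := inm_mev (tau'_order L r) u fgen_neq0.
have [_ ev] := inm_mev (tau'_order L r) v fgen_neq0.
exact: etrans (congr2 tau' eu ev) (psiT_le uv).
Qed.

Lemma minor_gensP p : @minor_gens K n m L r p <-> exists v, p = fgen v.
Proof.
split=> [[a [i [aC ->]]]|[v ->]]; first by exists (exist _ (a, i) aC).
by exists (val v).1, (val v).2; split=> //; exact: valP v.
Qed.

Lemma rees_gensP p : x_gens p \/ @minor_gens K n m L r p <-> exists w : RT, p = rees_gen w.
Proof.
split=> [[[x ->]|/minor_gensP[v ->]]|[[x|v] ->]].
- by exists (inl x).
- by exists (inr v).
- by left; exists x.
- by right; apply/minor_gensP; exists v.
Qed.

Lemma R_to_Rt_mon u : R_to_Rt r (<< u >> : mpol K X) = << injx r u >>.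
Proof. exact: mev_monE. Qed.

Lemma inminor_gen v : R_to_Rt r << inm tau (lminor K L (val v).1) >> * t_ K L (val v).2 =
  << inm tau' (fgen v) >> :> mpol K XT.
Proof.
have [_ e] := inm_rees_gen ladL (inr v); apply: etrans _ (esym (congr1 (fun u => << u >>) e)).
have [vI vL] := colset_mem ladL v; have [_ ->] := inm_lminor K vI vL.
apply: etrans (f_equal2 *%R (R_to_Rt_mon (rowmon L (val v).1)) erefl) _.
exact: esym (mUM K (injx r (rowmon L (val v).1)) (ucm (inr (val v).2 : XT))).
Qed.

Lemma inminor_gensP p : @inminor_gens K n m L r p <-> exists v, p = << inm tau' (fgen v) >>.
Proof.
split=> [[a [i [aC ->]]]|[v ->]].
  by exists (exist _ (a, i) aC); rewrite -inminor_gen.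
by exists (val v).1, (val v).2; split; [exact: valP v | rewrite inminor_gen].
Qed.

Lemma inrees_gensP p : x_gens p \/ @inminor_gens K n m L r p <->
  exists w : RT, p = << inm tau' (rees_gen w) >>.
Proof.
split=> [[[x ->]|/inminor_gensP[v ->]]|[[x|v] ->]].
- by exists (inl x); rewrite (inmU K (tau'_order L r)).
- by exists (inr v).
- by left; exists x; rewrite (inmU K (tau'_order L r)).
- by right; apply/inminor_gensP; exists v.
Qed.

Lemma initialsP (I : Type) (G : mpol K XT -> Prop) (F : I -> mpol K XT) :
  (forall p, G p <-> exists i, p = F i) -> (forall i, F i != 0) ->
  forall q, initials tau' G q <-> exists i, q = << inm tau' (F i) >>.
Proof.
move=> GF F0 q; split=> [[p [/GF[i ->] _ ->]]|[i ->]]; first by exists i.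
by exists (F i); split=> //; apply/GF; exists i.
Qed.

Lemma alg_gen_R_to_Rt (S : mpol K XT -> Prop) f : (forall p, x_gens p -> alg_gen S p) ->
  alg_gen S (R_to_Rt r f).
Proof. by move=> xS; apply: alg_gen_mev => x; apply: xS; exists x. Qed.

(** Once the target subalgebra contains [R], multiplication by [t_i] has to be checked on generators
    of the ideal only. This serves both the minors and the initial monomials. *)
Lemma rees_sub (I : mpol K X -> Prop) (S : mpol K XT -> Prop) :
  (forall p, x_gens p -> alg_gen S p) ->
  (forall f i, I f -> alg_gen S (R_to_Rt r f * t_ K L i)) ->
  forall p, @rees K n m L r (ideal_gen I) p -> alg_gen S p.
Proof.
move=> xS IS; apply: alg_gen_sub => _ [[f ->]|[f [i [If ->]]]]; first exact: alg_gen_R_to_Rt.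
pose F : {rmorphism mpol K X -> mpol K XT} := @R_to_Rt K n m L r.
elim: If => [|g /(IS _ i) //|g g' _ Hg _ Hg'|c g _ Hg].
- have -> : F 0 * t_ K L i = 0%:A by rewrite rmorph0 mul0r scale0r.
  exact: alg_genC.
- have -> : F (g + g') * t_ K L i = F g * t_ K L i + F g' * t_ K L i by rewrite rmorphD mulrDl.
  exact: alg_genD Hg Hg'.
- have -> : F (c * g) * t_ K L i = F c * (F g * t_ K L i) by rewrite rmorphM mulrA.
  exact: alg_genM (alg_gen_R_to_Rt _ xS) Hg.
Qed.

Lemma rees_minorP p : @rees K n m L r (@minor_ideal K n m L) p <->
  exists P, p = mev (@rees_gen K n m L r) P.
Proof.
apply: iff_trans (alg_gen_image (@rees_gen K n m L r) p); split.
  apply: rees_sub => [_ [x ->]|_ i [a aI ->]]; first by apply: alg_genS; exists (inl x).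
  case: (eqVneq (lminor K L a) 0) => [->|a0].
    by rewrite rmorph0 mul0r -(scale0r (1 : mpol K XT)); exact: alg_genC.
  have aC : a \in colset K L by rewrite inE aI.
  by apply: alg_genS; exists (inr (exist _ (a, i) aC)).
apply: alg_gen_sub => _ [[x|v] ->]; apply: alg_genS.
  by left; exists 'V_x; rewrite /R_to_Rt mevV.
right; exists (lminor K L (val v).1), (val v).2; split=> //.
by apply: ideal_genS; exists (val v).1 => //; case: (colset_mem ladL v).
Qed.

Lemma fiber_sagbi : let A := alg_gen (@minor_gens K n m L r) in
  sagbi tau' (@minor_gens K n m L r) A /\
  same_set (initial_algebra tau' A) (alg_gen (@inminor_gens K n m L r)).
Proof.
move=> A; have [pl plP] := plucker_family.
have AP p : A p <-> exists P, p = mev fgen P.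
  by apply: iff_trans (alg_gen_image fgen p); apply: (eq_alg_gen minor_gensP).
have inA := fiber_initial_algebra plP AP.
split; first split; first by move=> p; exact: alg_genS.
- apply: same_set_trans inA _; apply: eq_alg_gen => q; apply: iff_sym.
  exact: (initialsP minor_gensP).
- by apply: same_set_trans inA _; apply: eq_alg_gen => q; apply: iff_sym; exact: inminor_gensP.
Qed.

Lemma rees_sagbi : let Rees := @rees K n m L r (@minor_ideal K n m L) in
  [/\ sagbi tau' (fun p => x_gens p \/ minor_gens p) Rees,
      same_set (initial_algebra tau' Rees) (alg_gen (fun p => x_gens p \/ inminor_gens p))
    & same_set (alg_gen (fun p => x_gens p \/ inminor_gens p))
               (@rees K n m L r (initial_ideal tau (@minor_ideal K n m L)))].
Proof.
move=> Rees; have [pl plP] := plucker_family; have [en enP] := en_family.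
have inR := rees_initial_algebra plP enP rees_minorP.
have gensR p : x_gens p \/ minor_gens p -> Rees p.
  by move=> /rees_gensP[w ->]; apply/rees_minorP; exists 'V_w; rewrite mevV.
split; first split=> //.
- apply: same_set_trans inR _; apply: eq_alg_gen => q; apply: iff_sym.
  exact: (initialsP rees_gensP).
- by apply: same_set_trans inR _; apply: eq_alg_gen => q; apply: iff_sym; exact: inrees_gensP.
move=> p; split.
  apply: alg_gen_sub => q [[x ->]|[a [i [aC ->]]]]; apply: alg_genS.
    by left; exists 'V_x; rewrite /R_to_Rt mevV.
  right; exists << inm tau (lminor K L a) >>, i; split=> //; apply: ideal_genS.
  exists (lminor K L a); split=> //; last by move: aC; rewrite inE => /andP[].
  by apply: ideal_genS; exists a => //; move: aC; rewrite inE => /andP[].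
apply: rees_sub => [q xq|_ i [f [If f0 ->]]]; first by apply: alg_genS; left.
(* For arbitrary [f] in the ideal, [f t_i] lies in the Rees algebra, and its initial monomial is
   that of [f] times [t_i]. *)
have [P PE] : exists P, R_to_Rt r f * t_ K L i = mev (@rees_gen K n m L r) P.
  by apply/rees_minorP; apply: alg_genS; right; exists f, i.
have [R0 RE] := inm_R_to_Rt r f0.
have [ft0 ftE] := inmM (tau'_order L r) R0 (mU_neq0 K (ucm (inr i : XT))).
have e : R_to_Rt r << inm tau f >> * t_ K L i = << inm tau' (R_to_Rt r f * t_ K L i) >> :> mpol K XT.
  apply: etrans _ (esym (congr1 (fun u => << u >>) ftE)); rewrite RE (inmU K (tau'_order L r)).
  apply: etrans (f_equal2 *%R (R_to_Rt_mon (inm tau f)) erefl) _.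
  exact: esym (mUM K (injx r (inm tau f)) (ucm (inr i : XT))).
rewrite e PE; apply/(eq_alg_gen inrees_gensP).
by apply: (rees_inm_image plP enP); rewrite -PE.
Qed.

Lemma plucker_groebner : exists omega : rel {cmonom T},
  [/\ monomial_order omega, induced_order omega
    & exists G : seq (mpol K T), (forall p, p \in G -> plucker p) /\
        groebner omega G (@fiber_ideal K n m L r)].
Proof.
have [pl plP] := plucker_family.
exists (@omega K n m L r); split; [exact: omega_order | exact: induced_omega |].
exists (fiber_basis pl); split; last exact: fiber_groebner.
by move=> p /fiber_basisP[pq /(@plP pq)[H _ _] ->].
Qed.


(** Accounts for the convention that [T_] is 0 outside [colset]: a missing index must go with a
    vanishing value. *)
Lemma sum_T_delta (M : zmodType) (G : T -> M) (g : M) (a : colidx n m) (k : 'I_r) :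
  (a \notin colset K L -> g = 0) -> (forall v : T, val v = (a, k) -> G v = g) ->
  \sum_(v : T) (if val v == (a, k) then G v else 0) = g.
Proof.
move=> g0 Gg; case: (boolP (a \in colset K L)) => [aC|aN]; last first.
  rewrite g0 // big1 // => v _; case: eqP => // vE.
  by have := valP v; rewrite vE (negPf aN).
pose v0 : T := exist _ (a, k) aC.
rewrite (bigD1 v0) //= eqxx Gg // big1 ?addr0 // => v vv0; case: eqP => // vE.
by case/eqP: vv0; apply: val_inj.
Qed.

(** The relation is linear in the [T]-variables of the single summand [k]. Its coefficient at [v]
    collects the signed entries of all [j] whose deletion yields the index of [v], and the cofactor
    identity makes this a syzygy. *)
Lemma en_sym_relation q : @eagon_northcott K n m L r q -> @sym_relation K n m L r q.
Proof.
case=> c [i [k [cI ->]]].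
pose s (j : 'I_n.+1) : mpol K X := (-1) ^+ (i + j) * ladder_mx K L i (c j).
have delI j : increasing (col_del c j).
  have /increasingP cI' := cI.
  apply/increasingP => k1 k2 kk; rewrite !ffunE; apply: cI'.
  by rewrite /= ltnNge leq_bump2 -ltnNge.
exists (fun v => \sum_j (if val v == (col_del c j, k) then s j else 0)); split=> [i'|].
  under eq_bigr do rewrite big_distrl /=; rewrite exchange_big /=.
  case: (eqVneq i' k) => [->|ik]; last first.
    rewrite big1 // => j _; rewrite big1 // => v /eqP vi.
    by case: eqP => [vE|_]; [rewrite -vi vE eqxx in ik | rewrite mul0r].
  rewrite -[RHS](sum_cofactor_row (ladder_mx K L) c i); apply: eq_bigr => j _.
  rewrite -[RHS](@sum_T_delta _ (fun v => s j * lminor K L (val v).1) _ (col_del c j) k).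
  - rewrite [RHS](bigID (fun v : T => (val v).2 == k)) /= [X in _ = _ + X]big1 ?addr0 => [|v vk].
      by apply: eq_bigr => v _; case: eqP => // _; rewrite mul0r.
    by case: eqP => // vE; rewrite vE eqxx in vk.
  - rewrite inE delI negbK => /eqP d0; apply: etrans (f_equal2 *%R erefl d0) _; exact: mulr0.
  - by move=> v ->.
pose F : {rmorphism mpol K X -> mpol K RT} := @R_to_RT K n m L r.
have step (v : T) : F (\sum_j (if val v == (col_del c j, k) then s j else 0)) * 'V_(inr v : RT) =
    \sum_j (if val v == (col_del c j, k) then F (s j) * 'V_(inr v : RT) else 0).
  rewrite rmorph_sum mulr_suml; apply: eq_bigr => j _.
  by case: ifP => // _; rewrite rmorph0 mul0r.
rewrite (eq_bigr _ (fun v _ => step v)) exchange_big /=; apply: eq_bigr => j _.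
have sE : F (s j) = (-1) ^+ (i + j) * F (ladder_mx K L i (c j)).
  by rewrite rmorphM rmorphXn rmorphN1.
apply: esym; apply: sum_T_delta => [aN|v vE].
  have T0 : KT_to_RT (T_ K L (col_del c j) k) = 0.
    have -> : T_ K L (col_del c j) k = 0 by rewrite /T_ insubN.
    exact: (rmorph0 (@KT_to_RT K n m L r)).
  by apply: etrans (f_equal2 *%R erefl T0) _; exact: mulr0.
apply: f_equal2 sE _; apply: esym.
have -> : T_ K L (col_del c j) k = 'V_v.
  by have := T_val v; rewrite vE.
exact: mevV.
Qed.

Lemma eagon_northcott_plucker_groebner : (exists omega' : rel {cmonom RT}, monomial_order omega' /\
    exists G : seq (mpol K RT),
      (forall p, p \in G -> eagon_northcott p \/ (exists2 q, plucker q & p = KT_to_RT q)) /\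
      groebner omega' G (@rees_ideal K n m L r)) /\
  fiber_type K L r.
Proof.
have [pl plP] := plucker_family; have [en enP] := en_family.
have GP p : p \in rees_basis pl en ->
    eagon_northcott p \/ (exists2 q, plucker q /\ fiber_map q = 0 & p = KT_to_RT q).
  case/rees_basisP => [[pq /(@plP pq)[H1 H2 _] ->]|[px /(@enP px)[H _ _] ->]]; last by left.
  by right; exists (pl pq).
split.
  exists (@omega' K n m L r); split; first exact: omega'_order.
  exists (rees_basis pl en); split; last exact: rees_groebner.
  by move=> p /GP[H|[q [H _] ->]]; [left | right; exists q].
move=> p; split=> [/(rees_ideal_gen plP enP)|].
  apply: ideal_gen_sub => g /GP[/en_sym_relation H|[q [_ H] ->]]; apply: ideal_genS.
    by right.
  by left; exists q.
pose F : {rmorphism mpol K RT -> mpol K XT} := @rees_map K n m L r.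
pose R : {rmorphism mpol K X -> mpol K XT} := @R_to_Rt K n m L r.
suff gen q : (exists2 g, @fiber_ideal K n m L r g & q = KT_to_RT g) \/ sym_relation q -> F q = 0.
  elim=> [|q /gen //|q q' _ Hq _ Hq'|c q _ Hq]; first exact: (rmorph0 F).
  - by apply: etrans (rmorphD F q q') _; rewrite [X in X + _]Hq [X in _ + X]Hq' addr0.
  - by apply: etrans (rmorphM F c q) _; rewrite [X in _ * X]Hq mulr0.
case=> [[g gK ->]|[f [f0 ->]]]; first exact: etrans (rees_map_KT_to_RT g) gK.
have term (v : T) : F (R_to_RT r (f v) * 'V_(inr v : RT)) =
    R (f v * lminor K L (val v).1) * t_ K L (val v).2.
  have e1 : F (R_to_RT r (f v)) = R (f v) := @rees_map_R_to_RT K n m L r (f v).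
  have e2 : F 'V_(inr v : RT) = R (lminor K L (val v).1) * t_ K L (val v).2 :=
    mevV (@rees_gen K n m L r) (inr v).
  exact: rmorph_mul_comb e1 e2.
rewrite (rmorph_sum F) (eq_bigr _ (fun v _ => term v)).
(* Grouping by the second component isolates the coefficient of each [t_i], which is the syzygy in
   the [i]-th copy of the ideal. *)
rewrite (partition_big (fun v : T => (val v).2) predT) //= big1 // => i _.
rewrite (eq_bigr (fun v : T => R (f v * lminor K L (val v).1) * t_ K L i)) => [|v /eqP -> //].
rewrite -mulr_suml -(rmorph_sum R) [X in R X]f0.
by rewrite rmorph0 mul0r.
Qed.

End Assembly.

Theorem theorem5p5 (K : fieldType) (n m : nat) (L : {set 'I_n * 'I_m})
    (n_gt0 : (0 < n)%N) (le_nm : (n <= m)%N)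
    (ladder_L : ladder L)
    (colset_neq0 : colset K L != set0)
    (r : nat) (r_gt0 : (0 < r)%N) :
  (* (a) *)
  (let A := alg_gen (@minor_gens K n m L r) in
   sagbi tau' (@minor_gens K n m L r) A /\
   same_set (initial_algebra tau' A) (alg_gen (@inminor_gens K n m L r)))
  /\
  (* (b) *)
  (let Rees := @rees K n m L r (@minor_ideal K n m L) in
   [/\ sagbi tau' (fun p => x_gens p \/ minor_gens p) Rees,
       same_set (initial_algebra tau' Rees)
                (alg_gen (fun p => x_gens p \/ inminor_gens p))
     & same_set (alg_gen (fun p => x_gens p \/ inminor_gens p))
                (@rees K n m L r (initial_ideal tau (@minor_ideal K n m L)))])
  /\
  (* (c) *)
  (exists omega : rel {cmonom (Tvar K L r)},
     [/\ monomial_order omega,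
         induced_order omega
       & exists G : seq (mpol K (Tvar K L r)),
           (forall p, p \in G -> plucker p) /\
           groebner omega G (@fiber_ideal K n m L r)])
  /\
  (* (d) *)
  ((exists omega' : rel {cmonom (xTvar K L r)},
      monomial_order omega' /\
      exists G : seq (mpol K (xTvar K L r)),
        (forall p, p \in G ->
           eagon_northcott p \/ (exists2 q, plucker q & p = KT_to_RT q)) /\
        groebner omega' G (@rees_ideal K n m L r))
   /\ fiber_type K L r).
Proof.
split; first exact: fiber_sagbi.
split; first exact: rees_sagbi.
split; first exact: plucker_groebner.
exact: eagon_northcott_plucker_groebner.
Qed.
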